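(* Let $d\ge 1$ and let $B$ be a two-parameter Brownian sheet in $\mathbf{R}^d$. Define $\mathcal{Z}_d:=\{s\ge 0:\ B(s,t)=0\text{ for some }t>0\}$. Then for every non-random compact set $F\subset(0,\infty)$, \[ \mathrm{P}\{\mathcal{Z}_d\cap F\neq\varnothing\}>0 \iff \mathrm{Cap}_{(d-2)/2}(F)>0 . \]
   Context: A two-parameter Brownian sheet in $\mathbf{R}^d$ is a continuous centered Gaussian process $\{B(s,t)\}_{s,t\ge0}$ with values in $\mathbf{R}^d$ and $\mathrm{Cov}(B_i(s,t),B_j(u,v))=\min(s,u)\min(t,v)\delta_{i,j}$. Riesz capacity: for $\beta\in\mathbf{R}$ and $x\neq 0$ let $U_\beta(x)=1$ if $\beta<0$, $U_\beta(x)=\log_+(1/|x|)$ if $\beta=0$, $U_\beta(x)=|x|^{-\beta}$ if $\beta>0$, extended continuously to $x=0$ as a $[0,\infty]$-valued function. For a probability measure $\mu$, $I_\beta(\mu)=\iint U_\beta(x-y)\,\mu(dx)\mu(dy)$, and for a Borel set $F$, $\mathrm{Cap}_\beta(F)=[\inf_{\mu\in\mathcal{P}(F)}I_\beta(\mu)]^{-1}$, where $\mathcal{P}(F)$ is the set of Borel probability measures on $F$, $\inf\varnothing=\infty$, $1/\infty=0$. *)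

(* Defs.v *)
From HB Require Import structures.
From mathcomp Require Import all_boot all_order all_algebra.
From mathcomp Require Import all_classical all_reals all_analysis.
Set Implicit Arguments. Unset Strict Implicit. Unset Printing Implicit Defensive.
Import Order.TTheory GRing.Theory Num.Theory.
Import numFieldNormedType.Exports.
Local Open Scope classical_set_scope.
Local Open Scope ring_scope.

Definition centered_gaussian_law (R : realType) (d0 : measure_display)
  (T : measurableType d0) (P : probability T R) (X : T -> R) (v : R) : Prop :=
  forall A : set R, measurable A ->
    P (X @^-1` A) = (if v == 0 then \d_(0:R) A else normal_prob 0 (Num.sqrt v) A).

(* B i s t w : i-th coordinate of the two-parameter Brownian sheet in R^d at
   (s,t), sample point w.  Continuous centered Gaussian process with
   Cov(B_i(s,t), B_j(u,v)) = min(s,u) min(t,v) delta_ij, on s,t >= 0. *)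
Definition brownian_sheet (R : realType) (d : nat) (d0 : measure_display)
  (T : measurableType d0) (P : probability T R) (B : 'I_d -> R -> R -> T -> R) : Prop :=
  [/\ (forall i s t, measurable_fun setT (B i s t)),
      (forall (w : T) (i : 'I_d),
          {within [set st : R * R | 0 <= st.1 /\ 0 <= st.2],
             continuous (fun st : R * R => B i st.1 st.2 w)}) &
      (forall (n : nat) (c : 'I_n -> R) (idx : 'I_n -> 'I_d) (s t : 'I_n -> R),
          (forall k, 0 <= s k) -> (forall k, 0 <= t k) ->
          centered_gaussian_law P
            (fun w => \sum_(k < n) c k * B (idx k) (s k) (t k) w)
            (\sum_(k < n) \sum_(l < n)
                c k * c l * (Num.min (s k) (s l) * Num.min (t k) (t l))
                  * (idx k == idx l)%:R))].

Definition riesz_kernel (R : realType) (b : R) (x : R) : \bar R :=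
  if b < 0 then 1%E
  else if x == 0 then +oo%E
  else if b == 0 then (Num.max 0 (ln (`|x|^-1)))%:E
  else (`|x| `^ (- b))%:E.

Definition riesz_energy (R : realType) (b : R) (mu : probability R R) : \bar R :=
  (\int[mu \x mu]_xy riesz_kernel b (xy.1 - xy.2))%E.

Definition einv (R : realType) (x : \bar R) : \bar R :=
  if x == +oo%E then 0%E else if x == 0%E then +oo%E else ((fine x)^-1)%:E.

Definition riesz_cap (R : realType) (b : R) (F : set R) : \bar R :=
  einv (ereal_inf [set riesz_energy b mu | mu in
          [set mu : probability R R | mu F = 1%E]]).

(* Main.v *)
(* Replace the local time of the zeros by the smoothed grid sums Z = sum_k w_k
   sum_l h N_e(B(s_k,t_l)), with h = 1/(n+1) the mesh, N_e a Gaussian bump of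
   variance e (an approximate delta function at 0), w_k the masses that a measure
   mu on F gives to the cells [s_k, s_k + h[, and t_l running through an interval
   of length 2.  Splitting B(s',t') into B(s,t) and independent increments gives
   E Z >= c and E Z^2 <= C energy(w), where the discrete energy, with kernel
   kap(x) = sum_r h (e + x + r h)^(-d/2), is comparable to the Riesz energy of mu
   of order (d-2)/2.

   If mu has finite energy and the zero set almost surely missed F, then Z would
   tend to 0 almost surely while E Z >= c and E Z^2 stays bounded: contradiction.

   Conversely let H be the event that F is hit with t in [p, p+1], let S be the
   least zero in F, and let mu be the law of S given H.  For the filtration
   generated by the values of the sheet before (s,t), the conditional expectation
   of Z at a zero (S,t) is at least c times the potential of the part of mu on the
   right of S.  The maximal function W of this two-parameter martingale satisfies
   E W^2 <= 16 E Z^2 by Cairoli's inequality.  Hence E(1_H W) is at least of the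
   order of the energy (up to a factor 2, the mean potential of the part on the
   right), and at most of the order of its square root: the energy is bounded
   independently of e, and Fatou's lemma lets the mesh and e tend to 0.
   Cairoli's inequality needs the commutation of the two families of conditional
   expectations: they are realised by splicing a sheet with the increments of an
   independent copy, which preserves the law because the law of a Gaussian sheet
   is determined by its covariance. *)
Require Import Defs.
From HB Require Import structures.
From mathcomp Require Import all_boot all_order all_algebra.
From mathcomp Require Import all_classical all_reals all_analysis.
From mathcomp Require Import measurable_realfun ring lra.
Set Implicit Arguments. Unset Strict Implicit. Unset Printing Implicit Defensive.
Import Order.TTheory GRing.Theory Num.Theory.
Import numFieldNormedType.Exports.
Local Open Scope classical_set_scope.
Local Open Scope ring_scope.

(** * Expectations of bounded functions *)

(** The order of the capacity comes from [kap]: away from the axes the variance of B(s,t) - B(u,v)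
    is comparable to |s-u| + |t-v|, and integrating (|s-u| + r)^(-d/2) over r lowers the exponent
    d/2 to (d-2)/2, with a logarithm for d = 2 and a bounded kernel for d = 1.

    The maximal function bounds all grid points at once, hence also the random one. The times fill
    an interval of length 2 so that a zero with t in [p, p+1] still has a unit interval of times
    ahead.

    The limits differ in the two directions. From capacity to hitting, e is the mesh itself. In the
    converse e stays fixed while the mesh tends to 0, so that by continuity the grid point next to
    the zero has squared norm at most e; only then does e tend to 0.

    Real integrands under a probability are all bounded, so that [bmf] stands for every
    integrability condition. *)

Definition bmf d (T : measurableType d) (R : realType) (f : T -> R) : Prop :=
  measurable_fun setT f /\ exists M : R, forall x, `|f x| <= M.

Section bounded_measurable.
Context d (T : measurableType d) (R : realType).
Implicit Types f g : T -> R.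

Lemma bmf_cst (c : R) : bmf (fun _ : T => c).
Proof. by split=> //; exists `|c|. Qed.

Lemma bmfD f g : bmf f -> bmf g -> bmf (fun x => f x + g x).
Proof.
move=> [mf [M fM]] [mg [N gN]]; split; first exact: measurable_funD.
by exists (M + N) => x; rewrite (le_trans (ler_normD _ _))// lerD.
Qed.

Lemma bmfN f : bmf f -> bmf (fun x => - f x).
Proof.
move=> [mf [M fM]]; split; first exact: measurable_funN.
by exists M => x; rewrite normrN.
Qed.

Lemma bmfB f g : bmf f -> bmf g -> bmf (fun x => f x - g x).
Proof. by move=> bf bg; apply: bmfD => //; exact: bmfN. Qed.

Lemma bmfM f g : bmf f -> bmf g -> bmf (fun x => f x * g x).
Proof.
move=> [mf [M fM]] [mg [N gN]]; split; first exact: measurable_funM.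
by exists (M * N) => x; rewrite normrM ler_pM.
Qed.

Lemma bmfZ (c : R) f : bmf f -> bmf (fun x => c * f x).
Proof. by move=> bf; apply: bmfM => //; exact: bmf_cst. Qed.

Lemma bmfX f n : bmf f -> bmf (fun x => f x ^+ n).
Proof.
move=> bf; elim: n => [|n IH]; first exact: bmf_cst.
by under eq_fun do rewrite exprS; exact: bmfM.
Qed.

Lemma bmf_max f g : bmf f -> bmf g -> bmf (fun x => Num.max (f x) (g x)).
Proof.
move=> [mf [M fM]] [mg [N gN]]; split; first exact: measurable_maxr.
exists (Num.max M N) => x; rewrite le_max.
by case: (leP (f x) (g x)) => _; rewrite ?fM ?gN ?orbT.
Qed.

Lemma bmf_sum I (r : seq I) (F : I -> T -> R) :
  (forall i, bmf (F i)) -> bmf (fun x => \sum_(i <- r) F i x).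
Proof.
move=> bF; elim: r => [|i r IH].
  by under eq_fun do rewrite big_nil; exact: bmf_cst.
by under eq_fun do rewrite big_cons; exact: bmfD.
Qed.

Lemma bmf_prod I (r : seq I) (F : I -> T -> R) :
  (forall i, bmf (F i)) -> bmf (fun x => \prod_(i <- r) F i x).
Proof.
move=> bF; elim: r => [|i r IH].
  by under eq_fun do rewrite big_nil; exact: bmf_cst.
by under eq_fun do rewrite big_cons; exact: bmfM.
Qed.

Lemma bmf_indic (A : set T) : measurable A -> bmf (\1_A : T -> R).
Proof.
move=> mA; split; first exact: measurable_indic.
by exists 1 => x; rewrite indicE; case: (_ \in _); rewrite ?normr1 ?normr0.
Qed.

Lemma bmf_cos f : measurable_fun setT f -> bmf (fun x => cos (f x)).
Proof.
move=> mf; split.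
  apply: (measurableT_comp (f := @cos R)) => //.
  by apply: continuous_measurable_fun; exact: continuous_cos.
by exists 1 => x; rewrite ler_norml cos_geN1 cos_le1.
Qed.

Lemma bmf_comp d' (T' : measurableType d') (f : T' -> R) (g : T -> T') :
  bmf f -> measurable_fun setT g -> bmf (fun x => f (g x)).
Proof.
move=> [mf [M fM]] mg; split; first exact: (measurableT_comp mf).
by exists M => x.
Qed.

End bounded_measurable.

Section expectation.
Context d (T : measurableType d) (R : realType) (P : probability T R).
Implicit Types f g : T -> R.

Lemma bmf_integrable f : bmf f -> P.-integrable setT (EFin \o f).
Proof.
move=> [mf [M fM]].
apply: (@le_integrable _ _ _ P _ measurableT _ (EFin \o cst M)).
- exact/measurable_EFinP.
- by move=> x _ /=; rewrite lee_fin (le_trans (fM x))// ler_norm.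
- apply/integrableP; split; first exact/measurable_EFinP.
  rewrite /= integral_cst//= [P setT]probability_setT mule1.
  by rewrite ltry.
Qed.

Lemma EFin_Rintegral f : bmf f -> (\int[P]_x f x)%:E = (\int[P]_x (f x)%:E)%E.
Proof.
move=> bf; rewrite /Rintegral fineK//.
by apply: integrable_fin_num => //; exact: bmf_integrable.
Qed.

Lemma RintD f g : bmf f -> bmf g ->
  \int[P]_x (f x + g x) = \int[P]_x f x + \int[P]_x g x.
Proof. by move=> bf bg; rewrite RintegralD//; exact: bmf_integrable. Qed.

Lemma RintB f g : bmf f -> bmf g ->
  \int[P]_x (f x - g x) = \int[P]_x f x - \int[P]_x g x.
Proof. by move=> bf bg; rewrite RintegralB//; exact: bmf_integrable. Qed.

Lemma RintZ c f : bmf f -> \int[P]_x (c * f x) = c * \int[P]_x f x.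
Proof. by move=> bf; rewrite RintegralZl//; exact: bmf_integrable. Qed.

Lemma Rint_cst c : \int[P]_x (cst c x) = c.
Proof.
rewrite Rintegral_cst// [X in fine X](_ : _ = 1%E) ?mulr1//.
exact: probability_setT.
Qed.

Lemma Rint_le f g : bmf f -> bmf g -> (forall x, f x <= g x) ->
  \int[P]_x f x <= \int[P]_x g x.
Proof. by move=> bf bg fg; apply: le_Rintegral => //; exact: bmf_integrable. Qed.

Lemma Rint_ge0 f : (forall x, 0 <= f x) -> 0 <= \int[P]_x f x.
Proof. by move=> f0; exact: Rintegral_ge0. Qed.

Lemma Rint_sum I (r : seq I) (F : I -> T -> R) : (forall i, bmf (F i)) ->
  \int[P]_x (\sum_(i <- r) F i x) = \sum_(i <- r) \int[P]_x F i x.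
Proof.
move=> bF; elim: r => [|i r IH].
  by under eq_Rintegral do rewrite big_nil; rewrite big_nil Rint_cst.
under eq_Rintegral do rewrite big_cons.
by rewrite RintD// ?big_cons ?IH//; exact: bmf_sum.
Qed.

Lemma Rint_indic (A : set T) : measurable A -> \int[P]_x \1_A x = fine (P A).
Proof. by move=> mA; rewrite /Rintegral integral_indic// setIT. Qed.

Lemma Rint_norm_le f M : bmf f -> (forall x, `|f x| <= M) ->
  `|\int[P]_x f x| <= M.
Proof.
move=> bf fM; rewrite ler_norml -{1}(Rint_cst (- M)) -{2}(Rint_cst M).
rewrite !Rint_le//; try exact: bmf_cst; move=> x; have := fM x;
  by rewrite ler_norml => /andP[].
Qed.

Lemma Rint_cvg (f_ : nat -> T -> R) f M :
  (forall n, measurable_fun setT (f_ n)) -> (forall n x, `|f_ n x| <= M) ->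
  (forall x, f_ n x @[n --> \oo] --> f x) ->
  \int[P]_x f_ n x @[n --> \oo] --> \int[P]_x f x.
Proof.
move=> mf fM ff.
have iM : P.-integrable setT (EFin \o cst M).
  by apply: bmf_integrable; exact: bmf_cst.
have bf : bmf f.
  split; first by apply: (measurable_fun_cvg (h := f_)) => // x _; exact: ff.
  exists M => x; have := ff x; move/cvg_norm => h.
  rewrite -(cvg_lim (@Rhausdorff R) h).
  by apply: limr_le; [exact: cvgP h|exact: nearW].
apply: fine_cvg; rewrite fineK; last first.
  by apply: integrable_fin_num => //; exact: bmf_integrable.
apply: (@dominated_cvg _ _ _ P setT measurableT _ _ (EFin \o cst M)) => //.
- by move=> n; exact/measurable_EFinP.
- by move=> x _; apply: cvg_EFin; [exact: nearW|exact: ff].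
- by move=> n x _; rewrite lee_fin.
Qed.

End expectation.

Section fubini.
Context d1 d2 (T1 : measurableType d1) (T2 : measurableType d2) (R : realType).
Variables (P1 : probability T1 R) (P2 : probability T2 R).
Variable f : T1 * T2 -> R.
Hypothesis bf : bmf f.

Lemma bmf_section1 x : bmf (fun y => f (x, y)).
Proof. exact: (bmf_comp bf (measurable_pair1 x)). Qed.

Lemma bmf_section2 y : bmf (fun x => f (x, y)).
Proof. exact: (bmf_comp bf (measurable_pair2 y)). Qed.

Lemma bmf_Rint1 : bmf (fun x => \int[P2]_y f (x, y)).
Proof.
have [mf [M fM]] := bf; split.
  apply/measurable_EFinP.
  rewrite (_ : _ \o _ = fubini_F P2 (EFin \o f)).
    by apply: (@measurable_fubini_F _ _ _ _ _ P1); exact: bmf_integrable.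
  by apply/funext => x /=; rewrite EFin_Rintegral//; exact: bmf_section1.
exists M => x; apply: Rint_norm_le => //; exact: bmf_section1.
Qed.

Lemma Rint_prod1 :
  \int[(P1 \x P2)%E]_z f z = \int[P1]_x \int[P2]_y f (x, y).
Proof.
rewrite {1}/Rintegral -integral12_prod_meas1; last exact: bmf_integrable.
by congr fine; apply: eq_integral => x _; rewrite EFin_Rintegral//; exact: bmf_section1.
Qed.

Lemma Rint_prod2 :
  \int[(P1 \x P2)%E]_z f z = \int[P2]_y \int[P1]_x f (x, y).
Proof.
rewrite {1}/Rintegral -integral21_prod_meas1; last exact: bmf_integrable.
by congr fine; apply: eq_integral => x _; rewrite EFin_Rintegral//; exact: bmf_section2.
Qed.

End fubini.

Lemma Rint_law d1 d2 (T1 : measurableType d1) (T2 : measurableType d2)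
    (R : realType) (P1 : probability T1 R) (P2 : probability T2 R)
    (S : T1 -> T2) (f : T2 -> R) :
  measurable_fun setT S ->
  (forall A, measurable A -> P2 A = P1 (S @^-1` A)) -> bmf f ->
  \int[P2]_y f y = \int[P1]_x f (S x).
Proof.
move=> mS SP bf; congr fine.
transitivity (\int[pushforward P1 S]_y (f y)%:E)%E.
  by apply: eq_measure_integral => A mA _; exact: SP.
rewrite integral_pushforward//; first by case: bf => /measurable_EFinP.
by apply: bmf_integrable; exact: bmf_comp.
Qed.

(* Doob's L2 inequality for the martingale [E(f | first i levels)], realised by
   resampling: [S i (y, y')] keeps the first [i] levels of [y] and takes the
   other ones from an independent copy [y']. *)
Section doob.
Context d (T : measurableType d) (R : realType) (Q : probability T R).
Variable S : nat -> T * T -> T.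
Hypothesis mS : forall i, measurable_fun setT (S i).
Hypothesis SQ : forall i A, measurable A -> Q A = (Q \x Q)%E (S i @^-1` A).
Hypothesis SS : forall i j y y' y'', (i <= j)%N ->
  S i (S j (y, y''), y') = S i (y, y').

Definition resample i (f : T -> R) y := \int[Q]_y' f (S i (y, y')).

Lemma bmf_resample i f : bmf f -> bmf (resample i f).
Proof.
by move=> bf; apply: (@bmf_Rint1 _ _ _ _ _ Q Q (f \o S i)); exact: bmf_comp.
Qed.

Lemma resample_inv i j f y y' : (i <= j)%N ->
  resample i f (S j (y, y')) = resample i f y.
Proof. by move=> ij; apply: eq_Rintegral => z _; rewrite SS. Qed.

Lemma resample_le i f g y : bmf f -> bmf g -> (forall x, f x <= g x) ->
  resample i f y <= resample i g y.
Proof.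
move=> bf bg fg; apply: Rint_le => //.
- exact: (bmf_comp bf (measurableT_comp (mS i) (measurable_pair1 y))).
- exact: (bmf_comp bg (measurableT_comp (mS i) (measurable_pair1 y))).
Qed.

(** Projection property of a conditional expectation: being determined by the first i levels is
    expressed as invariance of g under resampling. The law of [S i] turns the mean of g f into a
    double integral in which g depends on the first variable alone. *)
Lemma Rint_resample i f g : bmf f -> bmf g ->
  (forall y y', g (S i (y, y')) = g y) ->
  \int[Q]_y (g y * resample i f y) = \int[Q]_y (g y * f y).
Proof.
move=> bf bg gS.
rewrite [RHS](Rint_law (mS i) (SQ i)); last exact: bmfM.
rewrite Rint_prod1; last exact: (bmf_comp (bmfM bg bf)).
apply: eq_Rintegral => y _; rewrite -RintZ; last first.
  exact: (bmf_comp bf (measurableT_comp (mS i) (measurable_pair1 y))).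
by apply: eq_Rintegral => y' _; rewrite gS.
Qed.

Fixpoint maxres f n y : R :=
  if n is n'.+1 then Num.max (maxres f n' y) (resample n f y)
  else resample 0 f y.

Lemma bmf_maxres f n : bmf f -> bmf (maxres f n).
Proof.
move=> bf; elim: n => [|n IH] /=; first exact: bmf_resample.
by apply: bmf_max => //; exact: bmf_resample.
Qed.

Lemma le_maxres f n i y : (i <= n)%N -> resample i f y <= maxres f n y.
Proof.
elim: n => [|n IH] /=; first by rewrite leqn0 => /eqP ->.
by rewrite leq_eqVlt => /predU1P[->|/IH h]; rewrite le_max ?lexx ?orbT// h.
Qed.

Lemma maxres_inv f n j y y' : (n <= j)%N ->
  maxres f n (S j (y, y')) = maxres f n y.
Proof.
elim: n => [|n IH] /= nj; first exact: resample_inv.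
by rewrite IH ?resample_inv// ltnW.
Qed.

(** Induction on n, with M_n the running maximum and R_n the conditional expectations. M increases
    only where M_{n+1} = R_{n+1}, so the product of M_{n+1} - M_n and R_{n+1} - (M_{n+1} + M_n)/2 is
    nonnegative; in the mean of (M_{n+1} - M_n) R_{n+1}, the factor R_{n+1} may be replaced by f. *)
Lemma doob_half f n : bmf f ->
  2^-1 * \int[Q]_y (maxres f n y ^+ 2) <= \int[Q]_y (maxres f n y * f y).
Proof.
move=> bf.
have bm k : bmf (maxres f k) by exact: bmf_maxres.
elim: n => [|n IH].
  have bR := bmf_resample 0 bf.
  rewrite /= -(@Rint_resample 0)// => [|y y']; last by rewrite resample_inv.
  rewrite -RintZ; last exact: bmfX.
  apply: Rint_le; [exact/bmfZ/bmfX|exact: bmfM|move=> y].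
  by rewrite -expr2 ler_piMl ?sqr_ge0// invf_le1// ler1n.
have bR := bmf_resample n.+1 bf.
have e : \int[Q]_y ((maxres f n.+1 y - maxres f n y) * f y) =
   \int[Q]_y ((maxres f n.+1 y - maxres f n y) * resample n.+1 f y).
  rewrite Rint_resample//; first exact: bmfB.
  by move=> y y'; rewrite !maxres_inv.
have : 0 <= \int[Q]_y ((maxres f n.+1 y - maxres f n y) *
    (resample n.+1 f y - 2^-1 * (maxres f n.+1 y + maxres f n y))).
  apply: Rint_ge0 => y; rewrite [maxres f n.+1 y]/=.
  case: (leP (maxres f n y) (resample n.+1 f y)) => h; nra.
rewrite (_ : (fun y => _) = (fun y : T =>
   (maxres f n.+1 y - maxres f n y) * resample n.+1 f y -
   2^-1 * (maxres f n.+1 y ^+ 2 - maxres f n y ^+ 2))); last first.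
  by apply/funext => y; ring.
rewrite RintB; [|by apply: bmfM => //; exact: bmfB|
  by apply: bmfZ; apply: bmfB; exact: bmfX].
rewrite RintZ; last by apply: bmfB; exact: bmfX.
rewrite RintB; [|exact: bmfX|exact: bmfX].
rewrite -e (_ : (fun y => _) = (fun y : T =>
   maxres f n.+1 y * f y - maxres f n y * f y)); last first.
  by apply/funext => y; ring.
rewrite RintB; [|exact: bmfM|exact: bmfM].
move: IH; lra.
Qed.

(** Since M f <= M^2/4 + f^2, half of the left side of [doob_half] is absorbed. *)
Lemma doob f n : bmf f ->
  \int[Q]_y (maxres f n y ^+ 2) <= 4 * \int[Q]_y (f y ^+ 2).
Proof.
move=> bf; have bm : bmf (maxres f n) by exact: bmf_maxres.
have h := doob_half n bf.
suff : \int[Q]_y (maxres f n y * f y) <=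
   4^-1 * \int[Q]_y (maxres f n y ^+ 2) + \int[Q]_y (f y ^+ 2).
  by move: h; lra.
rewrite -RintZ; last exact: bmfX.
rewrite -RintD; [|exact/bmfZ/bmfX|exact: bmfX].
apply: Rint_le; [exact: bmfM|by apply: bmfD; [exact/bmfZ/bmfX|exact: bmfX]|].
move=> y; rewrite -subr_ge0.
rewrite (_ : _ - _ = (2^-1 * maxres f n y - f y) ^+ 2) ?sqr_ge0//.
by field.
Qed.

End doob.

(** * The normal law and its Fourier transform *)

Section normal_law.
Context {R : realType}.
Implicit Types (m s x z e v h : R).
Local Notation mu := (@lebesgue_measure R).

Lemma normal_pdf_expR m s z : s != 0 ->
  normal_pdf m s z = (Num.sqrt (s ^+ 2 * pi *+ 2))^-1 *
    expR (- (z - m) ^+ 2 / (s ^+ 2 *+ 2)).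
Proof. by move=> s0; rewrite normal_pdfE. Qed.

Lemma integral_normal_prob m s (f : R -> \bar R) : measurable_fun setT f ->
  (normal_prob m s).-integrable setT f ->
  (\int[normal_prob m s]_x f x = \int[mu]_x (f x * (normal_pdf m s x)%:E))%E.
Proof.
move=> mf intf.
have dom := normal_prob_dominates m s.
have mp : measurable_fun setT (fun x => (normal_pdf m s x)%:E).
  by apply/measurable_EFinP; exact: measurable_normal_pdf.
have iRN := @Radon_Nikodym_integrable _ _ _ (charge_of_finite_measure (normal_prob m s)) mu dom.
rewrite -(Radon_Nikodym_change_of_variables dom)//.
apply: ae_eq_integral => //.
- apply: emeasurable_funM; first exact: mf.
  exact: (measurable_int _ iRN).
- apply: emeasurable_funM; first exact: mf.
  exact: mp.
- apply: ae_eqe_mul2l => /=.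
  apply: integral_ae_eq => //=.
  + by move=> E _ mE; rewrite -Radon_Nikodym_integral.
Qed.

Lemma Rintegral_normal_prob m s (f : R -> R) : bmf f ->
  \int[normal_prob m s]_x f x = \int[mu]_x (f x * normal_pdf m s x).
Proof.
move=> bf; congr fine; rewrite integral_normal_prob//.
- by case: bf => /measurable_EFinP.
- exact: bmf_integrable.
Qed.

(** Unnormalised, hence bounded by 1; [nbump] supplies the factor e^(-1/2) and leaves out the power
    of 2 pi. *)
Definition gauss_bump e x := expR (- x ^+ 2 / (2 * e)).

Lemma bmf_gauss_bump e : 0 < e -> bmf (gauss_bump e).
Proof.
move=> e0; split.
  apply: measurableT_comp => //=; apply: measurable_funM => //.
  by apply: measurableT_comp => //; exact: measurable_funX.
exists 1 => x; rewrite ger0_norm ?expR_ge0// -expR0 ler_expR.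
by rewrite mulNr oppr_le0 divr_ge0 ?sqr_ge0// mulr_ge0// ltW.
Qed.

Lemma gauss_bump_ge0 e x : 0 <= gauss_bump e x.
Proof. exact: expR_ge0. Qed.

Lemma gauss_bumpM e e' x : 0 < e -> 0 < e' ->
  gauss_bump e x * gauss_bump e' x = gauss_bump (e * e' / (e + e')) x.
Proof.
move=> e0 e'0; rewrite /gauss_bump -expRD; congr expR; field.
by rewrite !gt_eqF// addr_gt0.
Qed.

(* Completing the square. *)
Lemma gauss_bump_normal_pdf e s x z : 0 < e -> s != 0 ->
  gauss_bump e (x + z) * normal_pdf 0 s z =
  Num.sqrt (e / (e + s ^+ 2)) * gauss_bump (e + s ^+ 2) x *
  normal_pdf (- x * s ^+ 2 / (e + s ^+ 2)) (Num.sqrt (e / (e + s ^+ 2)) * s) z.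
Proof.
move=> e0 s0.
have s2 : 0 < s ^+ 2 by rewrite exprn_even_gt0.
have q0 : 0 < e / (e + s ^+ 2) by rewrite divr_gt0// addr_gt0.
have sq0 : 0 < Num.sqrt (e / (e + s ^+ 2)) by rewrite sqrtr_gt0.
rewrite !normal_pdf_expR ?mulf_neq0 ?(gt_eqF sq0)//.
rewrite exprMn sqr_sqrtr ?ltW//.
have -> : e / (e + s ^+ 2) * s ^+ 2 * pi *+ 2 =
  (e / (e + s ^+ 2)) * (s ^+ 2 * pi *+ 2).
  by ring.
rewrite (sqrtrM (s ^+ 2 * pi *+ 2) (ltW q0)) invfM /gauss_bump.
rewrite [LHS]mulrCA -expRD.
rewrite [RHS](_ : _ = (Num.sqrt (s ^+ 2 * pi *+ 2))^-1 *
  (expR (- x ^+ 2 / (2 * (e + s ^+ 2))) *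
   expR (- (z - - x * s ^+ 2 / (e + s ^+ 2)) ^+ 2
      / (e / (e + s ^+ 2) * s ^+ 2 *+ 2))) *
   (Num.sqrt (e / (e + s ^+ 2)) * (Num.sqrt (e / (e + s ^+ 2)))^-1)); last by ring.
rewrite divff ?mulr1 ?gt_eqF// -expRD; congr (_ * expR _).
by field; rewrite s0 !gt_eqF// addr_gt0.
Qed.

Lemma gauss_bump_normal_prob e s x : 0 < e -> s != 0 ->
  \int[normal_prob 0 s]_z gauss_bump e (x + z) =
  Num.sqrt (e / (e + s ^+ 2)) * gauss_bump (e + s ^+ 2) x.
Proof.
move=> e0 s0; rewrite Rintegral_normal_prob; last first.
  by apply: (bmf_comp (bmf_gauss_bump e0)); exact: measurable_funD.
under eq_Rintegral do rewrite gauss_bump_normal_pdf//.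
rewrite RintegralZl//; last exact: integrable_normal_pdf.
by rewrite [X in _ * X]/Rintegral integral_normal_pdf /= mulr1.
Qed.

(** Half of the Gaussian exponent is bounded on the tail by its value at h; the other half is, up to
    the factor sqrt 2, the density of doubled variance, of total mass 1. *)
Lemma normal_prob_tail x s h : 0 < s -> 0 <= h ->
  (normal_prob x s [set z | (h < `|z - x|)%R] <=
    (Num.sqrt 2 * expR (- (h ^+ 2 / (4 * s ^+ 2))))%:E)%E.
Proof.
move=> s0 h0.
have s2 : 0 < s ^+ 2 by rewrite exprn_gt0.
have t0 : 0 < Num.sqrt 2 * s by rewrite mulr_gt0// sqrtr_gt0.
have mA : measurable [set z | (h < `|z - x|)%R].
  rewrite -[X in measurable X]setTI.
  apply: measurable_fun_ltr => //; apply: measurableT_comp => //.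
  exact: measurable_funB.
rewrite /normal_prob.
apply: (@le_trans _ _ (\int[mu]_(z in [set z | (h < `|z - x|)%R])
   ((Num.sqrt 2 * expR (- (h ^+ 2 / (4 * s ^+ 2)))) *
      normal_pdf x (Num.sqrt 2 * s) z)%:E)%E).
  apply: ge0_le_integral => //.
  - by move=> z _; rewrite lee_fin normal_pdf_ge0.
  - by apply/measurable_EFinP; apply: measurable_funTS; exact: measurable_normal_pdf.
  - apply/measurable_EFinP; apply: measurable_funTS; apply: measurable_funM => //.
    exact: measurable_normal_pdf.
  - move=> z /= hz; rewrite lee_fin !normal_pdf_expR ?gt_eqF//.
    rewrite exprMn sqr_sqrtr//.
    have -> : (2 * s ^+ 2) * pi *+ 2 = 2 * (s ^+ 2 * pi *+ 2) by ring.
    rewrite (sqrtrM (s ^+ 2 * pi *+ 2))// [(Num.sqrt 2 * _)^-1]invfM.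
    rewrite [leRHS](_ : _ = (Num.sqrt (s ^+ 2 * pi *+ 2))^-1 *
      (expR (- (h ^+ 2 / (4 * s ^+ 2))) *
       expR (- (z - x) ^+ 2 / (2 * s ^+ 2 *+ 2))) * (Num.sqrt 2 / Num.sqrt 2));
      last by ring.
    rewrite divff ?mulr1 ?gt_eqF ?sqrtr_gt0// -expRD.
    apply: ler_wpM2l; first by rewrite invr_ge0 sqrtr_ge0.
    rewrite ler_expR.
    have hz2 : h ^+ 2 <= (z - x) ^+ 2.
      by rewrite -(real_normK (num_real (z - x))) lerXn2r ?nnegrE// ltW.
    rewrite -subr_ge0.
    rewrite (_ : _ - _ = ((z - x) ^+ 2 - h ^+ 2) / (4 * s ^+ 2)).
      by rewrite divr_ge0 ?subr_ge0// mulr_ge0// ltW.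
    by field; rewrite gt_eqF.
under eq_integral do rewrite EFinM.
rewrite ge0_integralZl//.
- rewrite -[leRHS]mule1; apply: lee_wpmul2l.
    by rewrite lee_fin mulr_ge0// ?expR_ge0// sqrtr_ge0.
  exact: (@probability_le1 _ _ _ (normal_prob x (Num.sqrt 2 * s))).
- apply/measurable_EFinP; apply: measurable_funTS; exact: measurable_normal_pdf.
- by move=> z _; rewrite lee_fin normal_pdf_ge0.
Qed.

End normal_law.

(** * The Fourier transform of the normal density, by integration by parts *)

Section normal_fourier.
Context {R : realType}.
Variables s th : R.
Implicit Types xi : R.
Hypothesis s0 : 0 < s.
Local Notation mu := (@lebesgue_measure R).

Let s2 : 0 < s ^+ 2. Proof. by rewrite exprn_gt0. Qed.

Lemma is_derive_normal_pdf (z : R) :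
  is_derive z 1 (normal_pdf 0 s) (- (z / s ^+ 2) * normal_pdf 0 s z).
Proof.
rewrite (_ : normal_pdf 0 s = fun z => (Num.sqrt (s ^+ 2 * pi *+ 2))^-1 *
    expR (- z ^+ 2 / (s ^+ 2 *+ 2))); last first.
  by apply/funext => y; rewrite normal_pdf_expR ?gt_eqF// subr0.
apply: trigger_derive; rewrite /GRing.scale/=.
by field; rewrite ?gt_eqF// sqrtr_gt0 mulrn_wgt0// mulr_gt0// pi_gt0.
Qed.

Lemma normal_pdf_even (z : R) : normal_pdf 0 s (- z) = normal_pdf 0 s z.
Proof. by rewrite !normal_pdf_expR ?gt_eqF// !subr0 sqrrN. Qed.

Let G z := `|z| * normal_pdf 0 s z.

Let mG : measurable_fun setT G.
Proof.
by apply: measurable_funM; [exact: normr_measurable|exact: measurable_normal_pdf].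
Qed.

(** Half of the Gaussian exponent absorbs |z| <= 1 + z^2, leaving a multiple of the density of
    doubled variance. This is the dominating function for differentiating under the integral. *)
Lemma integrable_normr_normal_pdf : mu.-integrable setT (EFin \o G).
Proof.
pose K := (1 + 4 * s ^+ 2) * Num.sqrt 2.
apply: (@le_integrable _ _ _ mu _ measurableT _
   (EFin \o (fun z => K * normal_pdf 0 (Num.sqrt 2 * s) z))).
- exact/measurable_EFinP.
- move=> z _; rewrite lee_fin !ger0_norm; last 2 first.
    by rewrite /K !mulr_ge0 ?sqrtr_ge0 ?normal_pdf_ge0// addr_ge0// mulr_ge0// ltW.
    by rewrite /G mulr_ge0// normal_pdf_ge0.
  rewrite /G /K !normal_pdf_expR ?gt_eqF ?mulr_gt0 ?sqrtr_gt0// !subr0.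
  rewrite exprMn sqr_sqrtr//.
  have -> : (2 * s ^+ 2) * pi *+ 2 = 2 * (s ^+ 2 * pi *+ 2) by ring.
  rewrite (sqrtrM (s ^+ 2 * pi *+ 2))// [(Num.sqrt 2 * _)^-1]invfM.
  set c := (Num.sqrt (s ^+ 2 * _ *+ 2))^-1.
  rewrite [leRHS](_ : _ = c * ((1 + 4 * s ^+ 2) *
       expR (- z ^+ 2 / (2 * s ^+ 2 *+ 2))) * (Num.sqrt 2 / Num.sqrt 2)); last by ring.
  rewrite divff ?mulr1 ?gt_eqF ?sqrtr_gt0// mulrCA.
  apply: ler_wpM2l; first by rewrite /c invr_ge0 sqrtr_ge0.
  rewrite (_ : - z ^+ 2 / (s ^+ 2 *+ 2) =
    - (z ^+ 2 / (4 * s ^+ 2)) + - z ^+ 2 / (2 * s ^+ 2 *+ 2)); last first.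
    by field; rewrite gt_eqF.
  rewrite expRD mulrA; apply: ler_wpM2r; first exact: expR_ge0.
  rewrite expRN ler_pdivrMr ?expR_gt0//.
  have z1 : `|z| <= 1 + z ^+ 2.
    rewrite -(real_normK (num_real z)); have := sqr_ge0 (`|z| - 2^-1); lra.
  have q0 : 0 <= z ^+ 2 / (4 * s ^+ 2).
    by rewrite divr_ge0 ?sqr_ge0// mulr_ge0// ltW.
  have h1 := expR_ge1Dx (z ^+ 2 / (4 * s ^+ 2)).
  have zq : z ^+ 2 = 4 * s ^+ 2 * (z ^+ 2 / (4 * s ^+ 2)) by field; rewrite gt_eqF.
  nra.
- exact: (integrableZl measurableT K (integrable_normal_pdf 0 (Num.sqrt 2 * s))).
Qed.

(** The phase [th] gives the real and imaginary parts of the characteristic function in one real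
    integral. *)
Definition normal_cf xi := \int[mu]_z (cos (xi * z + th) * normal_pdf 0 s z).

Lemma integrable_bounded_normal_pdf (f : R -> R) : bmf f ->
  mu.-integrable setT (EFin \o (fun z => f z * normal_pdf 0 s z)).
Proof.
move=> [mf [M fM]].
apply: (@le_integrable _ _ _ mu _ measurableT _
   (EFin \o (fun z => M * normal_pdf 0 s z))).
- apply/measurable_EFinP; apply: measurable_funM => //.
  exact: measurable_normal_pdf.
- move=> z _; rewrite lee_fin !normrM ler_wpM2r ?normr_ge0 ?(le_trans (fM z)) ?ler_norm //.
- exact: (integrableZl measurableT M (integrable_normal_pdf 0 s)).
Qed.

Let bcos xi : bmf (fun z : R => cos (xi * z + th)).
Proof. by apply: bmf_cos; apply: measurable_funD => //; exact: measurable_funM. Qed.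

Let bsin xi : bmf (fun z : R => sin (xi * z + th)).
Proof.
rewrite (_ : (fun z => _) = fun z => cos (xi * z + th - pi / 2)).
  by apply: bmf_cos; do 2 apply: measurable_funD => //; exact: measurable_funM.
by apply/funext => z; rewrite cosB cos_pihalf sin_pihalf mulr0 add0r mulr1.
Qed.

Lemma is_derive_normal_cf_aux xi : is_derive xi 1 normal_cf
  (\int[mu]_z (- z * sin (xi * z + th) * normal_pdf 0 s z)).
Proof.
pose f (xi z : R) := cos (xi * z + th) * normal_pdf 0 s z.
have fd (x z : R) : is_derive x 1 (f ^~ z) (- z * sin (x * z + th) * normal_pdf 0 s z).
  by apply: trigger_derive; rewrite /GRing.scale/=; ring.
have p1 (x z : R) : partial1of2 f x z = - z * sin (x * z + th) * normal_pdf 0 s z.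
  by rewrite partial1of2E; have /@derive_val -> := fd x z.
have I0 : `]xi - 1, xi + 1[%classic xi.
  by rewrite /= in_itv/=; apply/andP; split; lra.
have H1 (x : R) : `]xi - 1, xi + 1[%classic x -> mu.-integrable setT (EFin \o f x).
  by move=> _; exact: integrable_bounded_normal_pdf.
have H2 (x z : R) : `]xi - 1, xi + 1[%classic x -> setT z -> derivable (f ^~ z) x 1.
  by move=> _ _; apply: ex_derive; exact: fd.
have H3 z : 0 <= G z by rewrite mulr_ge0// normal_pdf_ge0.
have H4 (x z : R) : `]xi - 1, xi + 1[%classic x -> setT z ->
    `|partial1of2 f x z| <= G z.
  move=> _ _; rewrite p1 !normrM normrN (ger0_norm (normal_pdf_ge0 _ _ _)).
  rewrite /G; apply: ler_wpM2r; first exact: normal_pdf_ge0.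
  by rewrite ler_piMr// ler_norml sin_geN1 sin_le1.
apply: DeriveDef.
  exact: (derivable_under_integral measurableT I0 H1 H2 H3
    integrable_normr_normal_pdf H4).
rewrite -derive1E.
rewrite (differentiation_under_integral measurableT I0 H1 H2 H3
    integrable_normr_normal_pdf H4).
by apply: eq_Rintegral => z _; rewrite p1.
Qed.

Lemma cvg_normal_pdf0 : normal_pdf 0 s n%:R @[n --> \oo] --> (0 : R).
Proof.
pose c := (Num.sqrt (s ^+ 2 * pi *+ 2))^-1.
have c0 : 0 <= c by rewrite invr_ge0 sqrtr_ge0.
have h : c * expR (- (n%:R * (2 * s ^+ 2)^-1)) @[n --> \oo] --> (0 : R).
  rewrite -(mulr0 c); apply: cvgM; first exact: cvg_cst.
  apply: (cvg_comp (fun n : nat => n%:R) (fun x => expR (- (x * (2 * s ^+ 2)^-1)))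
    cvgr_idn).
  apply: (cvg_comp (fun x => x * (2 * s ^+ 2)^-1) (fun x => expR (- x)) _
    (@cvgr_expR R)).
  by apply: gt0_cvgMly => //; rewrite invr_gt0 mulr_gt0.
apply: squeeze_cvgr h; last exact: cvg_cst.
apply: nearW => n; rewrite normal_pdf_ge0 normal_pdf_expR ?gt_eqF// subr0 -/c.
rewrite ler_wpM2l// ler_expR mulNr lerN2 (_ : s ^+ 2 *+ 2 = 2 * s ^+ 2); last by ring.
rewrite ler_wpM2r//; first by rewrite invr_ge0 mulr_ge0// ltW.
by rewrite -natrX ler_nat; case: n => // n; rewrite expnS expn1 leq_pmulr.
Qed.

(** The derivative [h] of sin(xi z + th) times the density integrates to 0, because the density
    vanishes at infinity. Together with [is_derive_normal_cf_aux] this is a linear differential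
    equation for [normal_cf]. *)
Lemma normal_stein xi :
  \int[mu]_z (- z * sin (xi * z + th) * normal_pdf 0 s z) =
  - (xi * s ^+ 2) * normal_cf xi.
Proof.
pose F (z : R) := sin (xi * z + th) * normal_pdf 0 s z.
pose h (z : R) := xi * (cos (xi * z + th) * normal_pdf 0 s z) +
  (s ^+ 2)^-1 * (- z * sin (xi * z + th) * normal_pdf 0 s z).
have dF (z : R) : is_derive z 1 F (h z).
  have := is_derive_normal_pdf z => ?.
  by apply: trigger_derive; rewrite /GRing.scale/= /h; ring.
have i1 : mu.-integrable setT (EFin \o fun z => cos (xi * z + th) * normal_pdf 0 s z).
  exact: integrable_bounded_normal_pdf.
have i2 : mu.-integrable setT
    (EFin \o fun z => - z * sin (xi * z + th) * normal_pdf 0 s z).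
  apply: le_integrable integrable_normr_normal_pdf => //.
    apply/measurable_EFinP; apply: measurable_funM; last exact: measurable_normal_pdf.
    apply: measurable_funM; first exact: measurable_funN.
    by case: (bsin xi).
  move=> z _; rewrite lee_fin /G !normrM normr_id normrN.
  apply: ler_wpM2r => //.
  by rewrite ler_piMr// ler_norml sin_geN1 sin_le1.
have i1' : mu.-integrable setT
    (EFin \o fun z => xi * (cos (xi * z + th) * normal_pdf 0 s z)).
  exact: (integrableZl measurableT xi i1).
have i2' : mu.-integrable setT
    (EFin \o fun z => (s ^+ 2)^-1 * (- z * sin (xi * z + th) * normal_pdf 0 s z)).
  exact: (integrableZl measurableT (s ^+ 2)^-1 i2).
have ih : mu.-integrable setT (EFin \o h) by exact: (integrableD measurableT i1' i2').
have ch : continuous h.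
  move=> z.
  have cP : {for z, continuous (normal_pdf 0 s)}.
    by apply: continuous_normal_pdf; rewrite gt_eqF.
  have cid : {for z, continuous (fun z : R => xi * z + th)}.
    apply: cvgD; last exact: cvg_cst.
    by apply: cvgM; [exact: cvg_cst|exact: cvg_id].
  have cc : {for z, continuous (fun z => cos (xi * z + th))}.
    by apply: (continuous_comp cid); exact: continuous_cos.
  have cs : {for z, continuous (fun z => sin (xi * z + th))}.
    by apply: (continuous_comp cid); exact: continuous_sin.
  apply: cvgD; first by apply: cvgM; [exact: cvg_cst|exact: cvgM].
  apply: cvgM; first exact: cvg_cst.
  by apply: cvgM => //; apply: cvgM => //; apply: cvgN; exact: cvg_id.
pose I n : set R := `[- n.+1%:R, n.+1%:R]%classic.
have FTC n : (\int[mu]_(z in I n) (h z)%:E =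
    (F n.+1%:R - F (- n.+1%:R))%:E)%E.
  have cF : continuous F.
    move=> z; apply: differentiable_continuous.
    by apply/derivable1_diffP; apply: ex_derive; exact: dF.
  rewrite (@continuous_FTC2 _ h F)//.
  - by rewrite -subr_gt0 opprK addr_gt0.
  - exact: continuous_subspaceT.
  - split => [x _||]; first by apply: ex_derive; exact: dF.
    + by apply: cvg_at_right_filter; exact: cF.
    + by apply: cvg_at_left_filter; exact: cF.
  - by move=> x _; rewrite derive1E; have /@derive_val := dF x.
have L1 : (\int[mu]_(z in I n) (h z)%:E)%E
    @[n --> \oo] --> (\int[mu]_z (h z)%:E)%E.
  under eq_fun do rewrite integral_mkcond.
  apply: (@dominated_cvg _ _ _ mu setT measurableT _ _ (abse \o (EFin \o h))) => //.
  - move=> n; apply/(measurable_restrictT _ _).1; first exact: measurable_itv.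
    exact: (measurable_funTS (measurable_int _ ih)).
  - move=> z _; apply: cvg_near_cst; near=> n.
    rewrite patchE ifT// inE /I/= in_itv/= -ler_norml.
    near: n; exists (Num.truncn `|z|) => // n /= hn.
    by apply: ltW; rewrite (lt_le_trans (truncnS_gt _))// ler_nat.
  - exact: integrable_abse.
  - by move=> n z _; rewrite patchE; case: ifP => // _; rewrite /point/= normr0 lee_fin.
have L2 : (\int[mu]_(z in I n) (h z)%:E)%E
    @[n --> \oo] --> (0 : \bar R)%E.
  under eq_fun do rewrite FTC.
  apply: cvg_EFin; first exact: nearW.
  apply: norm_cvg0; rewrite /=.
  have l : 2 * normal_pdf 0 s n.+1%:R @[n --> \oo] --> (0 : R).
    have l0 : normal_pdf 0 s n.+1%:R @[n --> \oo] --> (0 : R).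
      by have := cvg_normal_pdf0; rewrite -cvg_shiftS.
    have l2 (p : nat -> R) : p n @[n --> \oo] --> (0 : R) ->
        2 * p n @[n --> \oo] --> (0 : R).
      by move=> hp; rewrite -(mulr0 2); apply: cvgM => //; exact: cvg_cst.
    exact: l2.
  apply: squeeze_cvgr l; last exact: cvg_cst.
  have hF z : `|F z| <= normal_pdf 0 s z.
    rewrite normrM (ger0_norm (normal_pdf_ge0 _ _ _)).
    by rewrite ler_piMl ?normal_pdf_ge0// ler_norml sin_geN1 sin_le1.
  apply: nearW => n; rewrite normr_ge0/= (le_trans (ler_normB _ _))//.
  by rewrite mulr_natl mulr2n lerD// (le_trans (hF _))// normal_pdf_even.
have e0 : (\int[mu]_z (h z)%:E = 0)%E.
  by apply: cvg_unique L1 L2; exact: ereal_hausdorff.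
have : \int[mu]_z h z = 0 by rewrite /Rintegral e0.
rewrite RintegralD// !RintegralZl// -/(normal_cf xi) => /eqP.
rewrite addrC addr_eq0 => /eqP h0.
have -> : \int[mu]_z (- z * sin (xi * z + th) * normal_pdf 0 s z) =
  s ^+ 2 * ((s ^+ 2)^-1 * \int[mu]_z (- z * sin (xi * z + th) * normal_pdf 0 s z)).
  by rewrite mulrA divff ?mul1r// gt_eqF.
by rewrite h0; ring.
Unshelve. all: by end_near. Qed.

(** The integrating factor exp(xi^2 s^2 / 2) makes the solution of that differential equation
    constant. *)
Lemma normal_cfE xi : normal_cf xi = expR (- (xi ^+ 2 * s ^+ 2) / 2) * cos th.
Proof.
pose g (xi : R) := normal_cf xi * expR (xi ^+ 2 * s ^+ 2 / 2).
have dg (x : R) : is_derive x 1 g 0.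
  have dc := is_derive_normal_cf_aux x.
  rewrite normal_stein in dc.
  apply: trigger_derive; rewrite /GRing.scale/=.
  by field.
have g1 : g xi = g 0 by apply: is_derive_0_is_cst.
have cf0 : normal_cf 0 = cos th.
  rewrite /normal_cf; under eq_Rintegral do rewrite mul0r add0r.
  rewrite RintegralZl//; last exact: integrable_normal_pdf.
  by rewrite [X in _ * X]/Rintegral integral_normal_pdf mulr1.
move: g1; rewrite /g cf0 expr0n/= !mul0r expR0 mulr1 => g1.
have E0 : expR (xi ^+ 2 * s ^+ 2 / 2) != 0 by rewrite gt_eqF// expR_gt0.
by rewrite mulNr expRN; apply: (mulIf E0); rewrite g1 mulrAC mulVf// mul1r.
Qed.

Lemma normal_prob_cos xi :
  \int[normal_prob 0 s]_z cos (xi * z + th) =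
  expR (- (xi ^+ 2 * s ^+ 2) / 2) * cos th.
Proof. by rewrite Rintegral_normal_prob// -normal_cfE. Qed.
End normal_fourier.

(** * Laws on the space of sheets *)

Section cylinder.
Variables (R : realType) (d : nat).

Definition index : Type := ('I_d * R * R)%type.
Definition sheet : Type := 'I_d -> R -> R -> R.
HB.instance Definition _ := Pointed.on sheet.

Definition ev (p : index) (y : sheet) : R := y p.1.1 p.1.2 p.2.

Definition cylinders : set (set sheet) :=
  [set C | exists p, exists2 A : set R, measurable A & C = ev p @^-1` A].

(** All functions, not only continuous ones, with the sigma-algebra of the coordinates: laws are
    then determined by finite-dimensional distributions, and splices act on the whole space. *)
Definition path := g_sigma_algebraType cylinders.

Lemma measurable_ev p : measurable_fun setT (ev p : path -> R).
Proof.
move=> _ A mA; rewrite setTI; apply: sub_sigma_algebra.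
by exists p; exists A.
Qed.

Lemma measurable_pathP d0 (T : measurableType d0) (f : T -> path) :
  (forall p, measurable_fun setT (fun w => ev p (f w))) -> measurable_fun setT f.
Proof.
move=> mf; apply: (@measurability _ _ T path setT f cylinders) => //.
move=> _ [_ [p [A mA ->] <-]].
by have := mf p measurableT _ mA.
Qed.

Definition lin (l : seq (R * index)) (y : path) : R :=
  \sum_(c <- l) c.1 * ev c.2 y.

Lemma measurable_lin l : measurable_fun setT (lin l).
Proof.
apply: measurable_sum => c; apply: measurable_funM => //; exact: measurable_ev.
Qed.

Lemma lin_cons c p l y : lin ((c, p) :: l) y = c * ev p y + lin l y.
Proof. by rewrite /lin big_cons. Qed.

End cylinder.

Arguments ev {R d}. Arguments lin {R d}. Arguments cylinders {R d}.

Section ray_smoothing.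
Variable R : realType.

(* The probability that a normal variable with mean x and standard deviation
   (n+1)^-2 is below a - (n+1)^-1; it tends to the indicator of x < a. *)
Definition smooth_ray (a : R) n x : R :=
  fine (normal_prob x (n.+1%:R ^- 2) `]-oo, a - n.+1%:R^-1[).

Let sgt0 n : 0 < n.+1%:R ^- 2 :> R. Proof. by rewrite invr_gt0 exprn_gt0. Qed.

Lemma smooth_ray_ge0 a n x : 0 <= smooth_ray a n x.
Proof. by rewrite fine_ge0. Qed.

Lemma smooth_ray_le1 a n x : smooth_ray a n x <= 1.
Proof.
rewrite -[leRHS]/(fine 1%:E) fine_le ?fin_num_measure//.
exact: (@probability_le1 _ _ _ (normal_prob x _)).
Qed.

Lemma EFin_smooth_ray a n x : (smooth_ray a n x)%:E =
  (\int[lebesgue_measure]_z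
    (\1_(`]-oo, a - n.+1%:R^-1[%classic) z * normal_pdf x (n.+1%:R ^- 2) z)%:E)%E.
Proof.
rewrite /smooth_ray fineK ?fin_num_measure// /normal_prob integral_mkcond.
apply: eq_integral => z _; rewrite patchE indicE; case: (_ \in _).
  by rewrite mul1r.
by rewrite mul0r.
Qed.

Lemma measurable_normal_pdf2 (s : R) : s != 0 ->
  measurable_fun setT (fun xz : R * R => normal_pdf xz.1 s xz.2).
Proof.
move=> s0; rewrite (_ : (fun _ => _) = fun xz => normal_pdf 0 s (xz.2 - xz.1)).
  apply: (measurableT_comp (measurable_normal_pdf 0 s)).
  exact: measurable_funB.
by apply/funext => xz; rewrite !normal_pdf_expR// subr0.
Qed.

Let tail n : R := Num.sqrt 2 * expR (- (n.+1%:R / 4)).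

Let cvg_tail : tail n @[n --> \oo] --> (0 : R).
Proof.
rewrite -(mulr0 (Num.sqrt 2)); apply: cvgM; first exact: cvg_cst.
have hS : (n.+1%:R : R) @[n --> \oo] --> +oo.
  by have := @cvgr_idn R; rewrite -cvg_shiftS; exact.
apply: (cvg_comp (fun n : nat => n.+1%:R) (fun x => expR (- (x / 4))) hS).
apply: (cvg_comp (fun x => x / 4) (fun x => expR (- x)) _ (@cvgr_expR R)).
by apply: gt0_cvgMly.
Qed.

Let tail_le n x : (normal_prob x (n.+1%:R ^- 2) [set z | (n.+1%:R^-1 < `|z - x|)%R]
  <= (tail n)%:E)%E.
Proof.
apply: (le_trans (normal_prob_tail _ (sgt0 n) _)); first by rewrite invr_ge0.
rewrite lee_fin ler_wpM2l ?sqrtr_ge0// ler_expR lerN2.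
rewrite (_ : _ / (4 * _) = n.+1%:R ^+ 2 / 4); last first.
  have : n.+1%:R != 0 :> R by rewrite pnatr_eq0.
  by move: (n.+1%:R : R) => c c0; field.
by rewrite ler_wpM2r ?invr_ge0// -natrX ler_nat expnS expn1 leq_pmulr.
Qed.

Let mtail n (x : R) : measurable [set z : R | (n.+1%:R^-1 < `|z - x|)%R].
Proof.
rewrite -[X in measurable X]setTI.
by apply: measurable_fun_ltr => //; apply: measurableT_comp => //; exact: measurable_funB.
Qed.

(** The shift (n+1)^-1 amounts to n+1 standard deviations, so the mass beyond it is at most
    [tail n]. Shifting to the left gives the limit 0 at x = a, as the open ray demands. *)
Lemma cvg_smooth_ray a x :
  smooth_ray a n x @[n --> \oo] --> (\1_(`]-oo, a[%classic) x : R).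
Proof.
rewrite indicE; case: (ltP x a) => xa; last first.
  rewrite memNset/= ?in_itv/=; last by apply/negP; rewrite -leNgt.
  apply: squeeze_cvgr cvg_tail; last exact: cvg_cst.
  apply: nearW => n; rewrite smooth_ray_ge0/= /smooth_ray -lee_fin.
  rewrite fineK ?fin_num_measure//; apply: le_trans (tail_le n x).
  have key (z : R) : z < a - n.+1%:R^-1 -> n.+1%:R^-1 < `|z - x|.
    have n0 : 0 < n.+1%:R^-1 :> R by rewrite invr_gt0.
    by move: (n.+1%:R^-1) n0 => c c0 za; rewrite ltr0_norm; move: za xa c0; lra.
  apply: le_measure; rewrite ?inE//; first exact: mtail.
rewrite mem_set/= ?in_itv//=.
have ax2 : 0 < (a - x) / 2 by move: xa; lra.
have h : 1 - tail n @[n --> \oo] --> (1 : R).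
  rewrite -[X in _ --> X]subr0.
  by apply: cvgB; [exact: cvg_cst|exact: cvg_tail].
apply: squeeze_cvgr (@cvg_cst _ (1 : R) _ \oo _); last exact: h.
near=> n; rewrite smooth_ray_le1 andbT.
have ha : n.+1%:R^-1 < (a - x) / 2 by near: n; exact: near_infty_natSinv_lt (PosNum ax2).
rewrite lerBlDr -lee_fin EFinD /smooth_ray fineK ?fin_num_measure//.
apply: le_trans (leeD2l _ (tail_le n x)).
rewrite -(@probability_setT _ _ _ (normal_prob x (n.+1%:R ^- 2))).
apply: le_trans (measureU2 _ _ _) => //; last exact: mtail.
have key (z : R) : z >= a - n.+1%:R^-1 -> n.+1%:R^-1 < `|z - x|.
  by move: (n.+1%:R^-1) ha => c c0 za; rewrite ger0_norm; move: za c0 (ax2); lra.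
apply: le_measure; rewrite ?inE//.
  by apply: measurableU => //; exact: mtail.
move=> z _ /=; rewrite in_itv/=.
by case: (ltP z (a - n.+1%:R^-1)) => zz; [left|right; exact: key].
Unshelve. all: by end_near. Qed.

Lemma measurable_smooth_ray a n : measurable_fun setT (smooth_ray a n).
Proof.
apply/measurable_EFinP.
rewrite (_ : _ \o _ = fubini_F lebesgue_measure
   (fun xz : R * R => (\1_(`]-oo, a - n.+1%:R^-1[%classic) xz.2 *
      normal_pdf xz.1 (n.+1%:R ^- 2) xz.2)%:E)); last first.
  by apply/funext => x; rewrite /= EFin_smooth_ray.
apply: measurable_fun_fubini_tonelli_F => /=; last first.
  by move=> xz; rewrite lee_fin mulr_ge0// normal_pdf_ge0.
apply/measurable_EFinP; apply: measurable_funM.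
  have m1 : measurable_fun setT (\1_(`]-oo, a - n.+1%:R^-1[%classic) : R -> R).
    exact: measurable_indic.
  exact: (measurableT_comp m1 measurable_snd).
by apply: measurable_normal_pdf2; rewrite gt_eqF.
Qed.

End ray_smoothing.

(* Cramer-Wold: a law on sheets is determined by the characteristic functions of
   its finite linear combinations.  One coordinate at a time, the factor
   1{y_p < a} is smoothed by a narrow normal density, which is itself a mixture
   of cosines and is absorbed in the phase. *)
Section uniqueness.
Variables (R : realType) (d : nat).
Local Notation path := (path R d).
Local Notation index := (index R d).

Definition orthant (rs : seq (index * R)) (y : path) : R :=
  \prod_(r <- rs) \1_(`]-oo, r.2[%classic) (ev r.1 y).

Lemma bmf_ray (p : index) (a : R) :
  bmf (fun y : path => \1_(`]-oo, a[%classic) (ev p y) : R).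
Proof.
apply: (@bmf_comp _ _ _ _ _ (\1_(`]-oo, a[%classic) : R -> R)).
  exact: bmf_indic.
exact: measurable_ev.
Qed.

Lemma bmf_orthant rs : bmf (orthant rs).
Proof. by apply: bmf_prod => r; exact: bmf_ray. Qed.

Lemma orthant_ge0 rs y : 0 <= orthant rs y.
Proof. by apply: prodr_ge0 => r _; rewrite indicE. Qed.

Lemma bmf_cos_lin (l : seq (R * index)) th :
  bmf (fun y : path => cos (lin l y + th)).
Proof. by apply: bmf_cos; apply: measurable_funD => //; exact: measurable_lin. Qed.

Section one_measure.
Variable m : probability path R.
Variables (rs : seq (index * R)) (l : seq (R * index)) (th : R) (p : index).

(** The factor 1 + cos is nonnegative, which allows Tonelli's theorem against Lebesgue measure on a
    ray; [Rint_orthant_cos] recovers the cosine by subtraction. *)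
Let u y := orthant rs y * (1 + cos (lin l y + th)).

Let bu : bmf u.
Proof.
apply: bmfM; first exact: bmf_orthant.
by apply: bmfD; [exact: bmf_cst|exact: bmf_cos_lin].
Qed.

Let u_ge0 y : 0 <= u y.
Proof.
by rewrite mulr_ge0 ?orthant_ge0// -lerBlDl sub0r cos_geN1.
Qed.

(** Fourier inversion for the normal density, whose transform is again normal, with inverse standard
    deviation. *)
Lemma normal_pdf_cos (s x z : R) : 0 < s ->
  normal_pdf x s z = (Num.sqrt (s ^+ 2 * pi *+ 2))^-1 *
    \int[normal_prob 0 s^-1]_xi cos ((z - x) * xi + 0).
Proof.
move=> s0; rewrite normal_pdf_expR ?gt_eqF// normal_prob_cos ?invr_gt0// cos0 mulr1.
by congr (_ * expR _); field; rewrite gt_eqF.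
Qed.

(** Fourier inversion moves the normal factor into the phase, and the product formula for cosines
    leaves integrals of an orthant times one cosine, the form to which the induction on [rs]
    applies. *)
Lemma Rint_normal_pdf (s z : R) : 0 < s ->
  \int[m]_y (u y * normal_pdf (ev p y) s z) =
  (Num.sqrt (s ^+ 2 * pi *+ 2))^-1 * \int[normal_prob 0 s^-1]_xi
   (\int[m]_y (orthant rs y * cos (lin [:: (- xi, p)] y + xi * z)) +
    2^-1 * (\int[m]_y (orthant rs y * cos (lin ((- xi, p) :: l) y + (th + xi * z))) +
     \int[m]_y (orthant rs y * cos (lin ((xi, p) :: l) y + (th - xi * z))))).
Proof.
move=> s0.
have b2 : bmf (fun xy : path * R => u xy.1 * cos ((z - ev p xy.1) * xy.2 + 0)).
  apply: bmfM; first exact: (bmf_comp bu measurable_fst).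
  apply: bmf_cos; apply: measurable_funD => //; apply: measurable_funM => //.
  apply: measurable_funB => //.
  exact: (measurableT_comp (measurable_ev p) measurable_fst).
have mcos y : bmf (fun xi => cos ((z - ev p y) * xi + 0)).
  by apply: bmf_cos; apply: measurable_funD => //; exact: measurable_funM.
transitivity (\int[m]_y ((Num.sqrt (s ^+ 2 * pi *+ 2))^-1 *
    \int[normal_prob 0 s^-1]_xi (u y * cos ((z - ev p y) * xi + 0)))).
  apply: eq_Rintegral => y _; rewrite normal_pdf_cos// mulrCA.
  by rewrite (@RintZ _ _ _ (normal_prob 0 s^-1)); last exact: mcos.
rewrite RintZ; last exact: (bmf_Rint1 m (normal_prob 0 s^-1) b2).
congr (_ * _).
rewrite -(Rint_prod1 m (normal_prob 0 s^-1) b2) (Rint_prod2 m (normal_prob 0 s^-1) b2).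
apply: eq_Rintegral => xi _ /=.
rewrite -RintD; try by apply: bmfM; [exact: bmf_orthant|exact: bmf_cos_lin].
rewrite -RintZ; last by apply: bmfD; apply: bmfM; [exact: bmf_orthant|exact: bmf_cos_lin|exact: bmf_orthant|exact: bmf_cos_lin].
rewrite -RintD; first last.
- by apply: bmfZ; apply: bmfD; apply: bmfM; [exact: bmf_orthant|exact: bmf_cos_lin|exact: bmf_orthant|exact: bmf_cos_lin].
- by apply: bmfM; [exact: bmf_orthant|exact: bmf_cos_lin].
apply: eq_Rintegral => y _; rewrite /u !lin_cons /lin big_nil -/(lin l y).
rewrite (_ : - xi * ev p y + 0 + xi * z = (z - ev p y) * xi + 0); last by ring.
rewrite (_ : - xi * ev p y + lin l y + (th + xi * z) =
   (lin l y + th) + ((z - ev p y) * xi + 0)); last by ring.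
rewrite (_ : xi * ev p y + lin l y + (th - xi * z) =
   (lin l y + th) - ((z - ev p y) * xi + 0)); last by ring.
move: (lin l y + th) ((z - ev p y) * xi + 0) => A B.
by rewrite cosD cosB; field.
Qed.

Lemma Rint_smooth_ray a n :
  (\int[m]_y (u y * smooth_ray a n (ev p y)))%:E =
  (\int[lebesgue_measure]_(z in `]-oo, (a - n.+1%:R^-1)%R[)
     (\int[m]_y (u y * normal_pdf (ev p y) (n.+1%:R ^- 2) z))%R%:E)%E.
Proof.
have sgt0 : 0 < n.+1%:R ^- 2 :> R by rewrite invr_gt0 exprn_gt0.
set s := n.+1%:R ^- 2 in sgt0 *; set b := a - n.+1%:R^-1.
have bpdf (z : R) : bmf (fun y : path => normal_pdf (ev p y) s z).
  split.
    have := @measurable_normal_pdf2 R s (lt0r_neq0 sgt0) => h.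
    have h2 : measurable_fun setT (fun y : path => (ev p y, z)).
      by apply: measurable_fun_pair => //; exact: measurable_ev.
    exact: (measurableT_comp h h2).
  exists (normal_peak s) => y; rewrite ger0_norm ?normal_pdf_ge0//.
  by rewrite normal_pdf_ub// gt_eqF.
have bs : bmf (fun y : path => smooth_ray a n (ev p y)).
  apply: (@bmf_comp _ _ _ _ _ (smooth_ray a n)); last exact: measurable_ev.
  split; first exact: measurable_smooth_ray.
  by exists 1 => x; rewrite ger0_norm ?smooth_ray_ge0// smooth_ray_le1.
rewrite EFin_Rintegral; last exact: bmfM.
pose f (yz : path * R) : \bar R :=
  (u yz.1 * (\1_(`]-oo, b[%classic) yz.2 * normal_pdf (ev p yz.1) s yz.2))%:E.
have f0 yz : (0 <= f yz)%E.
  rewrite /f lee_fin; apply: mulr_ge0; first exact: u_ge0.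
  by apply: mulr_ge0; [rewrite indicE; exact: ler0n|exact: normal_pdf_ge0].
have mf : measurable_fun setT f.
  apply/measurable_EFinP; apply: measurable_funM.
    exact: (measurableT_comp bu.1 measurable_fst).
  apply: measurable_funM.
    have m1 : measurable_fun setT (\1_(`]-oo, b[%classic) : R -> R).
      exact: measurable_indic.
    exact: (measurableT_comp m1 measurable_snd).
  have h := @measurable_normal_pdf2 R s (lt0r_neq0 sgt0).
  have h2 : measurable_fun setT (fun yz : path * R => (ev p yz.1, yz.2)).
    apply: measurable_fun_pair => //.
    exact: (measurableT_comp (measurable_ev p) measurable_fst).
  exact: (measurableT_comp h h2).
transitivity (\int[m]_y \int[lebesgue_measure]_z f (y, z))%E.
  apply: eq_integral => y _; rewrite EFinM EFin_smooth_ray -/s -/b.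
  rewrite -ge0_integralZl//.
  - apply/measurable_EFinP; apply: measurable_funM; first exact: measurable_indic.
    exact: measurable_normal_pdf.
  - move=> z _; rewrite lee_fin.
    by apply: mulr_ge0; [rewrite indicE; exact: ler0n|exact: normal_pdf_ge0].
  - by rewrite lee_fin.
rewrite (@fubini_tonelli _ _ _ _ _ m lebesgue_measure f mf f0) [RHS]integral_mkcond.
apply: eq_integral => z _; rewrite patchE /f /=.
case: ifPn => zb.
  rewrite EFin_Rintegral; last exact: bmfM.
  by apply: eq_integral => y _; rewrite indicE zb mul1r.
rewrite /point/=; apply: integral0_eq => y _.
by rewrite indicE (negbTE zb) mul0r mulr0.
Qed.

End one_measure.

Section two_measures.
Variables m1 m2 : probability path R.
Hypothesis cf : forall (l : seq (R * index)) th,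
  \int[m1]_y cos (lin l y + th) = \int[m2]_y cos (lin l y + th).

Lemma Rint_orthant_cos rs (l : seq (R * index)) th :
  \int[m1]_y (orthant rs y * cos (lin l y + th)) =
  \int[m2]_y (orthant rs y * cos (lin l y + th)).
Proof.
elim: rs l th => [|[p a] rs IH] l th.
  by rewrite /orthant; under eq_Rintegral do rewrite big_nil mul1r;
     under [RHS]eq_Rintegral do rewrite big_nil mul1r; exact: cf.
have step l' th' :
  \int[m1]_y (orthant rs y * (1 + cos (lin l' y + th')) *
     \1_(`]-oo, a[%classic) (ev p y)) =
  \int[m2]_y (orthant rs y * (1 + cos (lin l' y + th')) *
     \1_(`]-oo, a[%classic) (ev p y)).
  have L (m : probability path R) :
    \int[m]_y (orthant rs y * (1 + cos (lin l' y + th')) * smooth_ray a n (ev p y))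
    @[n --> \oo] --> \int[m]_y (orthant rs y * (1 + cos (lin l' y + th')) *
      \1_(`]-oo, a[%classic) (ev p y)).
    have bu : bmf (fun y => orthant rs y * (1 + cos (lin l' y + th'))).
      apply: bmfM; first exact: bmf_orthant.
      by apply: bmfD; [exact: bmf_cst|exact: bmf_cos_lin].
    have [mu [M uM]] := bu.
    apply: (@Rint_cvg _ _ _ _ _ _ M).
    - move=> n; apply: measurable_funM => //.
      exact: (measurableT_comp (measurable_smooth_ray a n) (measurable_ev p)).
    - move=> n y; rewrite normrM (ger0_norm (smooth_ray_ge0 _ _ _)).
      by rewrite (le_trans _ (uM y))// ler_piMr ?smooth_ray_le1.
    - by move=> y; apply: cvgM; [exact: cvg_cst|exact: cvg_smooth_ray].
  have := L m2; rewrite (_ : (fun n => _) = (fun n => \int[m1]_y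
    (orthant rs y * (1 + cos (lin l' y + th')) * smooth_ray a n (ev p y)))).
    by move=> L2; apply: cvg_unique (L m1) L2; exact: Rhausdorff.
  apply/funext => n; apply: EFin_inj; rewrite !Rint_smooth_ray.
  apply: eq_integral => z _; congr EFin.
  rewrite !Rint_normal_pdf ?invr_gt0 ?exprn_gt0//; congr (_ * _).
  by apply: eq_Rintegral => xi _; rewrite !IH.
(* The subtracted constant 1 is itself 2^-1 (1 + cos 0), with the empty linear form, so [step]
   covers both terms. *)
have h (m : probability path R) :
    \int[m]_y (orthant ((p, a) :: rs) y * cos (lin l y + th)) =
    \int[m]_y (orthant rs y * (1 + cos (lin l y + th)) *
       \1_(`]-oo, a[%classic) (ev p y)) -
    2^-1 * \int[m]_y (orthant rs y * (1 + cos (lin [::] y + 0)) *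
       \1_(`]-oo, a[%classic) (ev p y)).
  rewrite -RintZ; last first.
    apply: bmfM; last exact: bmf_ray.
    apply: bmfM; first exact: bmf_orthant.
    by apply: bmfD; [exact: bmf_cst|exact: bmf_cos_lin].
  rewrite -RintB; first last.
  - apply: bmfZ; apply: bmfM; last exact: bmf_ray.
    apply: bmfM; first exact: bmf_orthant.
    by apply: bmfD; [exact: bmf_cst|exact: bmf_cos_lin].
  - apply: bmfM; last exact: bmf_ray.
    apply: bmfM; first exact: bmf_orthant.
    by apply: bmfD; [exact: bmf_cst|exact: bmf_cos_lin].
  apply: eq_Rintegral => y _; rewrite /orthant big_cons /= /lin big_nil addr0 cos0.
  by field.
by rewrite !h !step.
Qed.

(** Finite intersections of open coordinate rays form a pi-system generating the cylinder
    sigma-algebra; their masses are the integrals of [Rint_orthant_cos] with the cosine equal to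
    1. *)
Lemma path_law_unique A : measurable A -> m1 A = m2 A.
Proof.
pose G : set (set path) :=
  [set C | exists rs, C = [set y | all (fun r => ev r.1 y < r.2) rs]].
have E rs y : orthant rs y = (all (fun r => ev r.1 y < r.2) rs)%:R.
  rewrite /orthant; elim: rs => [|r rs IH]; first by rewrite big_nil.
  rewrite big_cons IH /= indicE.
  rewrite (_ : (ev r.1 y \in _) = (ev r.1 y < r.2)); last first.
    by apply/idP/idP; rewrite inE/= in_itv.
  by case: (_ < _); rewrite ?mul1r ?mul0r.
have Gm : G `<=` measurable.
  move=> _ [rs ->]; rewrite (_ : [set _ | _] = orthant rs @^-1` [set 1]).
    rewrite -[X in measurable X]setTI; apply: (bmf_orthant rs).1 => //.
  apply/seteqP; split => y /=; rewrite E; case: (all _ _) => //.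
  by move=> /eqP; rewrite eq_sym oner_eq0.
have sG : @measurable _ path `<=` <<s G >>.
  apply: smallest_sub; first exact: smallest_sigma_algebra.
  move=> _ [p [B mB ->]].
  have me : measurable_fun setT (ev p : g_sigma_algebraType G -> R).
    apply: (@measurability _ _ (g_sigma_algebraType G) R setT (ev p) _
      (RGenInftyO.measurableE R)) => //= _ [_ [a ->] <-].
    rewrite setTI; apply: sub_sigma_algebra; exists [:: (p, a)].
    by apply/seteqP; split => y /=; rewrite in_itv/= ?andbT.
  by have := me measurableT _ mB; rewrite setTI.
move=> mA; apply: (g_sigma_algebra_measure_unique G Gm (fun=> setT)) => //.
- by move=> _; exists [::]; apply/seteqP; split.
- by rewrite bigcup_const.
- move=> _ _ [rs ->] [rs' ->]; exists (rs ++ rs').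
  by apply/seteqP; split => y /=; rewrite all_cat => /andP.
- move=> C GC; have mC := Gm _ GC; case: GC => rs CE.
  have I (m : probability path R) :
      m C = (\int[m]_y (orthant rs y * cos (lin [::] y + 0)))%:E.
    transitivity (\int[m]_y \1_C y)%:E.
      by rewrite Rint_indic// fineK// fin_num_measure.
    congr EFin; apply: eq_Rintegral => y _.
    rewrite /lin big_nil addr0 cos0 mulr1 E indicE; congr (nat_of_bool _)%:R.
    by apply/idP/idP; rewrite inE CE.
  by apply: etrans (I m1) _; rewrite Rint_orthant_cos; exact/esym/I.
- by move=> _; rewrite (le_lt_trans (probability_le1 m1 _)) ?ltry.
- exact: sG.
Qed.

End two_measures.

End uniqueness.

(** * Gaussian sheets *)

Section gaussian_law.
Context d (T : measurableType d) (R : realType) (P : probability T R).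
Variables (X : T -> R) (v : R).
Hypothesis mX : measurable_fun setT X.
Hypothesis XP : centered_gaussian_law P X v.

Lemma Rint_gaussian_law (f : R -> R) : bmf f -> \int[P]_w f (X w) =
  if v == 0 then f 0 else \int[normal_prob 0 (Num.sqrt v)]_z f z.
Proof.
move=> bf; case: ifPn => v0.
  rewrite -(@Rint_law _ _ _ _ _ P (\d_(0 : R)) X f)//.
    rewrite /Rintegral integral_dirac//; last by case: bf => /measurable_EFinP.
    by rewrite diracT mul1e.
  by move=> A mA; rewrite XP// v0.
rewrite -(@Rint_law _ _ _ _ _ P (normal_prob 0 (Num.sqrt v)) X f)//.
by move=> A mA; rewrite XP// (negbTE v0).
Qed.

(* For v < 0 the definition degenerates to the uniform law on [0, 1], which is
   not symmetric. *)
Lemma gaussian_law_ge0 : centered_gaussian_law P (fun w => - X w) v -> 0 <= v.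
Proof.
move=> XN; rewrite leNgt; apply/negP => v0.
have s0 : Num.sqrt v = 0 by apply/eqP; rewrite sqrtr_eq0 ltW.
have h (Y : T -> R) : measurable_fun setT Y -> centered_gaussian_law P Y v ->
    P (Y @^-1` `]-oo, 0]) = 0%E.
  move=> mY ->//; rewrite lt_eqF// s0 /normal_prob /normal_pdf eqxx.
  rewrite (_ : (fun x => _) = (fun x => (\1_(`[0, 1]%classic) x)%:E))//.
  rewrite integral_indic//.
  rewrite (_ : `[0, 1]%classic `&` `]-oo, 0]%classic = [set (0 : R)]).
    exact: lebesgue_measure_set1.
  apply/seteqP; split => x /=; rewrite !in_itv/=.
    by move=> [/andP[x0 _] x1]; apply/eqP; rewrite eq_le x0 x1.
  by move=> ->; rewrite lexx ler01.
pose N : set R := `]-oo, 0]%classic.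
have mN : measurable N by exact: measurable_itv.
have : (P setT <= P (X @^-1` N) + P ((fun w => (- X w)%R) @^-1` N))%E.
  have mXN : measurable_fun setT (fun w => - X w) by exact: measurable_funN.
  have m1 : measurable (X @^-1` N) by rewrite -[X in measurable X]setTI; apply: mX.
  have m2 : measurable ((fun w => - X w) @^-1` N).
    by rewrite -[X in measurable X]setTI; apply: mXN.
  apply: le_trans (measureU2 _ m1 m2).
  apply: le_measure; rewrite ?inE//; first exact: measurableU.
  move=> w _; rewrite /N/= !in_itv/= oppr_le0.
  by case: (leP (X w) 0) => h'; [left|right; exact: ltW].
rewrite !h//; last exact: measurable_funN.
by rewrite probability_setT adde0 lee_fin ler10.
Qed.

Hypothesis v0 : 0 <= v.

Lemma gaussian_law_cos th :
  \int[P]_w cos (X w + th) = expR (- v / 2) * cos th.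
Proof.
rewrite (@Rint_gaussian_law (fun x => cos (x + th))); last first.
  by apply: bmf_cos; exact: measurable_funD.
case: ifPn => [/eqP ->|vn0]; first by rewrite add0r oppr0 mul0r expR0 mul1r.
have sv0 : 0 < Num.sqrt v by rewrite sqrtr_gt0 lt_neqAle eq_sym vn0.
under eq_Rintegral do rewrite -[X in cos (X + _)]mul1r.
by rewrite normal_prob_cos// expr1n mul1r sqr_sqrtr.
Qed.

Lemma gaussian_law_bump e x : 0 < e ->
  \int[P]_w gauss_bump e (x + X w) = Num.sqrt (e / (e + v)) * gauss_bump (e + v) x.
Proof.
move=> e0; rewrite (@Rint_gaussian_law (fun z => gauss_bump e (x + z))); last first.
  by apply: (bmf_comp (bmf_gauss_bump e0)); exact: measurable_funD.
case: ifPn => [/eqP ->|vn0]; first by rewrite !addr0 divff ?gt_eqF// sqrtr1 mul1r.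
have sv0 : 0 < Num.sqrt v by rewrite sqrtr_gt0 lt_neqAle eq_sym vn0.
by rewrite gauss_bump_normal_prob ?gt_eqF// sqr_sqrtr.
Qed.

End gaussian_law.

Section gaussian_sheet.
Variables (R : realType) (d : nat).
Local Notation path := (path R d).
Local Notation index := (index R d).
Implicit Types (p q : index) (l : seq (R * index)) (m : probability path R).

Definition sheet_cov p q : R := Num.min `|p.1.2| `|q.1.2| *
  Num.min `|p.2| `|q.2| * (p.1.1 == q.1.1)%:R.

Definition lin_cov l l' : R :=
  \sum_(c <- l) \sum_(c' <- l') c.1 * c'.1 * sheet_cov c.2 c'.2.

(** The sign of the variance is recorded because [centered_gaussian_law] alone does not imply it,
    while the Fourier formula depends on it. *)
Definition gaussian_sheet m := forall l, 0 <= lin_cov l l /\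
  centered_gaussian_law m (lin l) (lin_cov l l).

Lemma gaussian_sheet_cos m l th : gaussian_sheet m ->
  \int[m]_y cos (lin l y + th) = expR (- lin_cov l l / 2) * cos th.
Proof.
by move=> /(_ l)[v0 h]; rewrite (gaussian_law_cos _ h)//; exact: measurable_lin.
Qed.

Section mixing.
Variables (m : probability path R) (a b : index -> seq (R * index)).
Variable S : path * path -> path.
Hypothesis gm : gaussian_sheet m.
Hypothesis Sab : forall p z, ev p (S z) = lin (a p) z.1 + lin (b p) z.2.
Hypothesis abK : forall p q,
  lin_cov (a p) (a q) + lin_cov (b p) (b q) = sheet_cov p q.

Let ext (a : index -> seq (R * index)) l :=
  flatten [seq [seq (c.1 * e.1, e.2) | e <- a c.2] | c <- l].

Let lin_ext a' l y : lin (ext a' l) y = \sum_(c <- l) c.1 * lin (a' c.2) y.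
Proof.
rewrite /lin /ext big_flatten/= big_map; apply: eq_bigr => c _.
by rewrite big_map mulr_sumr; apply: eq_bigr => e _; rewrite mulrA.
Qed.

Let cov_ext a' l l' : lin_cov (ext a' l) (ext a' l') =
  \sum_(c <- l) \sum_(c' <- l') c.1 * c'.1 * lin_cov (a' c.2) (a' c'.2).
Proof.
rewrite /lin_cov /ext big_flatten/= big_map; apply: eq_bigr => c _.
rewrite big_map.
under eq_bigr do rewrite big_flatten/= big_map.
rewrite exchange_big/=; apply: eq_bigr => c' _.
rewrite mulr_sumr; apply: eq_bigr => e _.
by rewrite big_map mulr_sumr; apply: eq_bigr => e' _ /=; ring.
Qed.

Lemma measurable_mixing : measurable_fun setT S.
Proof.
apply: measurable_pathP => p; under eq_fun do rewrite Sab.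
apply: measurable_funD.
  exact: (measurableT_comp (measurable_lin _) measurable_fst).
exact: (measurableT_comp (measurable_lin _) measurable_snd).
Qed.

(** Under [S] a linear form becomes a sum of two forms in independent sheets ([ext a l] and
    [ext b l]), whose variances add up to the original one by [abK]. The characteristic functions
    therefore agree, and [path_law_unique] concludes. *)
Lemma mixing_law A : measurable A -> m A = (m \x m)%E (S @^-1` A).
Proof.
move=> mA.
pose S' : {mfun (path * path)%type >-> path} :=
  HB.pack S (isMeasurableFun.Build _ _ _ _ S measurable_mixing).
apply: etrans (_ : distribution (m \x m)%E S' A = _) => //.
apply: path_law_unique => // l th.
rewrite (@gaussian_sheet_cos m)//.
have bl l' th' : bmf (fun y : path => cos (lin l' y + th')) by exact: bmf_cos_lin.
rewrite (@Rint_law _ _ _ _ _ (m \x m)%E (distribution (m \x m)%E S') S)//; last first.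
  exact: measurable_mixing.
rewrite Rint_prod1; last exact: (bmf_comp (bl l th) measurable_mixing).
have -> : lin_cov l l = lin_cov (ext a l) (ext a l) + lin_cov (ext b l) (ext b l).
  rewrite !cov_ext -big_split; apply: eq_bigr => c _; rewrite -big_split.
  by apply: eq_bigr => c' _ /=; rewrite -mulrDr abK.
transitivity (\int[m]_y (expR (- lin_cov (ext b l) (ext b l) / 2) *
    cos (lin (ext a l) y + th))).
  rewrite RintZ// gaussian_sheet_cos// mulrA -expRD; congr (expR _ * _); ring.
apply: eq_Rintegral => y _; rewrite -(@gaussian_sheet_cos m)//.
apply: eq_Rintegral => y' _; congr cos.
rewrite {3}/lin; under [in RHS]eq_bigr do rewrite Sab/= mulrDr.
by rewrite big_split/= !lin_ext; ring.
Qed.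

End mixing.

End gaussian_sheet.

Section sheet_law.
Context (R : realType) (d : nat) (d0 : measure_display) (T : measurableType d0).
Variables (P : probability T R) (B : 'I_d -> R -> R -> T -> R).
Hypothesis BP : brownian_sheet P B.

(* Absolute values extend the sheet from the positive quadrant to the plane. *)
Definition sheet_map (w : T) : path R d := fun i s t => B i `|s| `|t| w.

Lemma measurable_sheet_map : measurable_fun setT sheet_map.
Proof. by case: BP => mB _ _; apply: measurable_pathP => p; exact: mB. Qed.

Lemma sheet_map_gaussian (l : seq (R * index R d)) :
  centered_gaussian_law P (lin l \o sheet_map) (lin_cov l l).
Proof.
case: BP => _ _ gB.
pose x k := tnth (in_tuple l) k.
have vE : lin_cov l l = \sum_(k < size l) \sum_(k' < size l) (x k).1 * (x k').1 *
    (Num.min `|(x k).2.1.2| `|(x k').2.1.2| * Num.min `|(x k).2.2| `|(x k').2.2|) *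
    ((x k).2.1.1 == (x k').2.1.1)%:R.
  rewrite /lin_cov [LHS]big_tnth; apply: eq_bigr => k _.
  by rewrite [LHS]big_tnth; apply: eq_bigr => k' _; rewrite /sheet_cov mulrA.
have lE : lin l \o sheet_map = fun w => \sum_(k < size l)
    (x k).1 * B (x k).2.1.1 `|(x k).2.1.2| `|(x k).2.2| w.
  by apply/funext => w; rewrite /= /lin [LHS]big_tnth.
by rewrite vE lE; apply: gB.
Qed.

Let X : {mfun T >-> path R d} :=
  HB.pack sheet_map (isMeasurableFun.Build _ _ _ _ sheet_map measurable_sheet_map).

Definition sheet_law : probability (path R d) R := distribution P X.

Lemma Rint_sheet_law (f : path R d -> R) : bmf f ->
  \int[sheet_law]_y f y = \int[P]_w f (sheet_map w).
Proof. by move=> bf; rewrite (@Rint_law _ _ _ _ _ P sheet_law sheet_map)//; exact: measurable_sheet_map. Qed.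

(** Nonnegativity of the variance: the opposite of a linear form is a linear form with the same
    variance, so [gaussian_law_ge0] applies. *)
Lemma sheet_law_gaussian : gaussian_sheet sheet_law.
Proof.
have h l : centered_gaussian_law sheet_law (lin l) (lin_cov l l).
  by move=> A mA; exact: sheet_map_gaussian.
move=> l; split; last exact: h.
apply: (@gaussian_law_ge0 _ _ _ sheet_law (lin l)) => //; first exact: measurable_lin.
pose ln := [seq (- c.1, c.2) | c <- l].
have -> : (fun y => - lin l y) = lin ln.
  apply/funext => y; rewrite /lin big_map -sumrN.
  by apply: eq_bigr => c _; rewrite mulNr.
have -> : lin_cov l l = lin_cov ln ln; last exact: h.
rewrite /lin_cov big_map; apply: eq_bigr => c _; rewrite big_map.
by apply: eq_bigr => c' _; rewrite mulrNN.
Qed.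

End sheet_law.

(** * Splicing independent sheets in either time and in the coordinates *)

Section splices.
Variables (R : realType) (d : nat).
Local Notation path := (path R d).
Local Notation index := (index R d).

(** The Brownian covariance split at time c into the part of the past and that of the increments
    after c. *)
Lemma minr_splice (x u c : R) :
  Num.min (Num.min x c) (Num.min u c) + Num.min (Num.max x c) (Num.max u c) -
  Num.min (Num.max x c) c - Num.min c (Num.max u c) + Num.min c c = Num.min x u.
Proof.
case: (leP x c) => h1; case: (leP u c) => h2; rewrite ?minxx;
  by do ?case: leP => ?; lra.
Qed.

(** The sheet z.1 up to time c, continued by the increments of z.2. In min/max form each value is
    one linear combination of coordinates, whatever the position of s, as [mixing_law] requires. *)
Definition splice1 (c : R) (z : path * path) : path := fun i s t =>
  z.1 i (Num.min `|s| c) t + z.2 i (Num.max `|s| c) t - z.2 i c t.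

Definition splice2 (c : R) (z : path * path) : path := fun i s t =>
  z.1 i s (Num.min `|t| c) + z.2 i s (Num.max `|t| c) - z.2 i s c.

Definition splice_coord (i : 'I_d) (z : path * path) : path := fun j s t =>
  if j == i then z.1 j s t else z.2 j s t.

(** The outer splice reads its first argument only before c, where the inner splice at c' >= c
    leaves y unchanged. This is the hypothesis [SS] of Doob's inequality. *)
Lemma splice1_splice1 c c' y y' y'' : 0 <= c -> c <= c' ->
  splice1 c (splice1 c' (y, y''), y') = splice1 c (y, y').
Proof.
move=> c0 cc'; apply/funext => i; apply/funext => s; apply/funext => t.
rewrite /splice1/=; set x := Num.min `|s| c.
have x0 : 0 <= x by rewrite le_min normr_ge0.
have xc : x <= c' by rewrite (le_trans _ cc')// ge_min lexx orbT.
by rewrite ger0_norm// (min_idPl xc) (max_idPr xc) addrK.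
Qed.

Lemma splice2_splice2 c c' y y' y'' : 0 <= c -> c <= c' ->
  splice2 c (splice2 c' (y, y''), y') = splice2 c (y, y').
Proof.
move=> c0 cc'; apply/funext => i; apply/funext => s; apply/funext => t.
rewrite /splice2/=; set x := Num.min `|t| c.
have x0 : 0 <= x by rewrite le_min normr_ge0.
have xc : x <= c' by rewrite (le_trans _ cc')// ge_min lexx orbT.
by rewrite ger0_norm// (min_idPl xc) (max_idPr xc) addrK.
Qed.

Lemma splice1_past c z i s t : 0 <= s -> s <= c -> splice1 c z i s t = z.1 i s t.
Proof.
by move=> s0 sc; rewrite /splice1 ger0_norm// (min_idPl sc) (max_idPr sc) addrK.
Qed.

Lemma splice1_future c z i s t : 0 <= c -> c <= s ->
  splice1 c z i s t = z.1 i c t + (z.2 i s t - z.2 i c t).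
Proof.
move=> c0 cs; rewrite /splice1 ger0_norm ?(le_trans c0)//.
by rewrite (min_idPr cs) (max_idPl cs) addrA.
Qed.

Lemma splice2_past c z i s t : 0 <= t -> t <= c -> splice2 c z i s t = z.1 i s t.
Proof.
by move=> s0 sc; rewrite /splice2 ger0_norm// (min_idPl sc) (max_idPr sc) addrK.
Qed.

Lemma splice2_future c z i s t : 0 <= c -> c <= t ->
  splice2 c z i s t = z.1 i s c + (z.2 i s t - z.2 i s c).
Proof.
move=> c0 cs; rewrite /splice2 ger0_norm ?(le_trans c0)//.
by rewrite (min_idPr cs) (max_idPl cs) addrA.
Qed.

Let ab1 c (p : index) : seq (R * index) := [:: (1, (p.1.1, Num.min `|p.1.2| c, p.2))].
Let bb1 c (p : index) : seq (R * index) :=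
  [:: (1, (p.1.1, Num.max `|p.1.2| c, p.2)); (-1, (p.1.1, c, p.2))].
Let ab2 c (p : index) : seq (R * index) := [:: (1, (p.1, Num.min `|p.2| c))].
Let bb2 c (p : index) : seq (R * index) :=
  [:: (1, (p.1, Num.max `|p.2| c)); (-1, (p.1, c))].
Let abc i (p : index) : seq (R * index) := if p.1.1 == i then [:: (1, p)] else [::].
Let bbc i (p : index) : seq (R * index) := if p.1.1 == i then [::] else [:: (1, p)].

Let splice1E c p z : ev p (splice1 c z) = lin (ab1 c p) z.1 + lin (bb1 c p) z.2.
Proof. by rewrite /lin !big_cons !big_nil /ev/= /splice1; ring. Qed.

Let splice2E c p z : ev p (splice2 c z) = lin (ab2 c p) z.1 + lin (bb2 c p) z.2.
Proof. by rewrite /lin !big_cons !big_nil /ev/= /splice2; ring. Qed.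

Let splice_coordE i p z :
  ev p (splice_coord i z) = lin (abc i p) z.1 + lin (bbc i p) z.2.
Proof.
rewrite /lin /abc /bbc /ev/= /splice_coord; case: ifP => _;
  by rewrite !big_cons !big_nil /=; ring.
Qed.

Let norm_min (x c : R) : 0 <= c -> `|Num.min `|x| c| = Num.min `|x| c.
Proof. by move=> c0; rewrite ger0_norm// le_min normr_ge0. Qed.

Let norm_max (x c : R) : `|Num.max `|x| c| = Num.max `|x| c.
Proof. by rewrite ger0_norm// le_max normr_ge0. Qed.

Let cov1 c p q : 0 <= c ->
  lin_cov (ab1 c p) (ab1 c q) + lin_cov (bb1 c p) (bb1 c q) = sheet_cov p q.
Proof.
move=> c0; rewrite /lin_cov !big_cons !big_nil /sheet_cov /=.
rewrite !norm_min// !norm_max (ger0_norm c0) -(minr_splice `|p.1.2| `|q.1.2| c).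
by ring.
Qed.

Let cov2 c p q : 0 <= c ->
  lin_cov (ab2 c p) (ab2 c q) + lin_cov (bb2 c p) (bb2 c q) = sheet_cov p q.
Proof.
move=> c0; rewrite /lin_cov !big_cons !big_nil /sheet_cov /=.
rewrite !norm_min// !norm_max (ger0_norm c0) -(minr_splice `|p.2| `|q.2| c).
by ring.
Qed.

Let covc i p q :
  lin_cov (abc i p) (abc i q) + lin_cov (bbc i p) (bbc i q) = sheet_cov p q.
Proof.
rewrite /lin_cov /abc /bbc /sheet_cov.
case: (eqVneq p.1.1 i) => pi; case: (eqVneq q.1.1 i) => qi;
  rewrite !big_cons !big_nil /= ?pi ?qi ?eqxx ?[i == _]eq_sym ?(negbTE pi) ?(negbTE qi) /=;
  by ring.
Qed.

Lemma measurable_splice1 c : measurable_fun setT (splice1 c).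
Proof. exact: measurable_mixing (splice1E c). Qed.

Lemma measurable_splice2 c : measurable_fun setT (splice2 c).
Proof. exact: measurable_mixing (splice2E c). Qed.

Lemma measurable_splice_coord i : measurable_fun setT (splice_coord i).
Proof. exact: measurable_mixing (splice_coordE i). Qed.

Variable m : probability path R.
Hypothesis gm : gaussian_sheet m.

Lemma splice1_law c A : 0 <= c -> measurable A -> m A = (m \x m)%E (splice1 c @^-1` A).
Proof. by move=> c0; apply: (mixing_law gm (splice1E c)) => p q; exact: cov1. Qed.

Lemma splice2_law c A : 0 <= c -> measurable A -> m A = (m \x m)%E (splice2 c @^-1` A).
Proof. by move=> c0; apply: (mixing_law gm (splice2E c)) => p q; exact: cov2. Qed.

Lemma splice_coord_law i A : measurable A -> m A = (m \x m)%E (splice_coord i @^-1` A).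
Proof. by apply: (mixing_law gm (splice_coordE i)) => p q; exact: covc. Qed.

Lemma Rint_splice1 c f : 0 <= c -> bmf f ->
  \int[m]_y f y = \int[m]_y \int[m]_y' f (splice1 c (y, y')).
Proof.
move=> c0 bf; rewrite (@Rint_law _ _ _ _ _ (m \x m)%E m (splice1 c))//.
- rewrite Rint_prod1//; apply: (bmf_comp bf); exact: measurable_splice1.
- exact: measurable_splice1.
- by move=> A mA; rewrite (splice1_law c0).
Qed.

Lemma Rint_splice2 c f : 0 <= c -> bmf f ->
  \int[m]_y f y = \int[m]_y \int[m]_y' f (splice2 c (y, y')).
Proof.
move=> c0 bf; rewrite (@Rint_law _ _ _ _ _ (m \x m)%E m (splice2 c))//.
- rewrite Rint_prod1//; apply: (bmf_comp bf); exact: measurable_splice2.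
- exact: measurable_splice2.
- by move=> A mA; rewrite (splice2_law c0).
Qed.

(** Independence of the coordinates: taking coordinate i from a separate copy preserves the law and
    detaches one factor of the product at a time. *)
Lemma Rint_prod_coord (h : 'I_d -> path -> R) : (forall i, bmf (h i)) ->
  (forall i y y', (forall s t, y i s t = y' i s t) -> h i y = h i y') ->
  \int[m]_y (\prod_(i < d) h i y) = \prod_(i < d) \int[m]_y h i y.
Proof.
move=> bh hi.
suff H (r : seq 'I_d) : uniq r ->
    \int[m]_y (\prod_(i <- r) h i y) = \prod_(i <- r) \int[m]_y h i y.
  exact: H (index_enum_uniq _).
elim: r => [_|i r IH /= /andP[ir ur]].
  by under eq_Rintegral do rewrite big_nil; rewrite big_nil Rint_cst.
under eq_Rintegral do rewrite big_cons.
have bp : bmf (fun y => \prod_(j <- r) h j y) by exact: bmf_prod.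
have bb : bmf (fun y => h i y * \prod_(j <- r) h j y) by exact: bmfM.
rewrite (@Rint_law _ _ _ _ _ (m \x m)%E m (splice_coord i))//; first last.
- exact: splice_coord_law.
- exact: measurable_splice_coord.
rewrite Rint_prod1; last exact: (bmf_comp bb (measurable_splice_coord i)).
rewrite big_cons -IH// mulrC -RintZ//; apply: eq_Rintegral => y _.
rewrite mulrC -RintZ//; apply: eq_Rintegral => y' _; congr (_ * _).
  by apply: hi => s t; rewrite /splice_coord eqxx.
apply: eq_big_seq => j jr; apply: hi => s t.
by rewrite /splice_coord ifN//; apply: contraNneq ir => <-.
Qed.

End splices.

Lemma prodr_const_ord (R : pzRingType) n (x : R) : \prod_(i < n) x = x ^+ n.
Proof. by rewrite big_const_ord iter_mulr_1. Qed.

(** * First and second moments of Gaussian bumps of the sheet *)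

Section bump_moments.
Variables (R : realType) (d : nat) (m : probability (path R d) R).
Hypothesis gm : gaussian_sheet m.
Local Notation path := (path R d).
Implicit Types (e x : R) (i : 'I_d) (y : path).

Lemma lin_cov_incr i (s0 s t0 t : R) : 0 <= s0 -> s0 <= s -> 0 <= t0 -> t0 <= t ->
  let l := [:: (1, (i, s, t)); (-1, (i, s0, t0))] in
  lin_cov l l = s * t - s0 * t0.
Proof.
move=> h1 h2 h3 h4 /=; rewrite /lin_cov !big_cons !big_nil /sheet_cov /= eqxx /=.
have h5 := le_trans h1 h2; have h6 := le_trans h3 h4.
rewrite !ger0_norm// !minxx.
by rewrite (min_idPl h2) (min_idPl h4) (min_idPr h2) (min_idPr h4); ring.
Qed.

Lemma lin_cov_point i (s t : R) : 0 <= s -> 0 <= t ->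
  let l := [:: (1, (i, s, t))] in lin_cov l l = s * t.
Proof.
move=> h1 h2 /=; rewrite /lin_cov !big_cons !big_nil /sheet_cov /= eqxx /=.
by rewrite !ger0_norm// !minxx; ring.
Qed.

Lemma measurable_coord i (s t : R) : measurable_fun setT (fun y : path => y i s t).
Proof. exact: (measurable_ev (i, s, t)). Qed.

Lemma bmf_gauss_bump_coord e x i s t s0 t0 : 0 < e ->
  bmf (fun y : path => gauss_bump e (x + (y i s t - y i s0 t0))).
Proof.
move=> e0; apply: (bmf_comp (bmf_gauss_bump e0)); apply: measurable_funD => //.
by apply: measurable_funB; exact: measurable_coord.
Qed.

Lemma bmf_gauss_bump_point e i s t : 0 < e ->
  bmf (fun y : path => gauss_bump e (y i s t)).
Proof. by move=> e0; apply: (bmf_comp (bmf_gauss_bump e0)); exact: measurable_coord. Qed.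

Lemma gauss_bump_incr e x i (s0 s t0 t : R) :
  0 < e -> 0 <= s0 -> s0 <= s -> 0 <= t0 -> t0 <= t ->
  \int[m]_y gauss_bump e (x + (y i s t - y i s0 t0)) =
  Num.sqrt (e / (e + (s * t - s0 * t0))) * gauss_bump (e + (s * t - s0 * t0)) x.
Proof.
move=> e0 h1 h2 h3 h4.
pose l : seq (R * index R d) := [:: (1, (i, s, t)); (-1, (i, s0, t0))].
have [v0 h] := gm l.
rewrite -(lin_cov_incr i h1 h2 h3 h4) -/l.
rewrite -(gaussian_law_bump (measurable_lin l) h v0)//.
by apply: eq_Rintegral => y _; rewrite /lin !big_cons big_nil /ev/=; congr gauss_bump; ring.
Qed.

Lemma gauss_bump_point e i (s t : R) : 0 < e -> 0 <= s -> 0 <= t ->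
  \int[m]_y gauss_bump e (y i s t) = Num.sqrt (e / (e + s * t)).
Proof.
move=> e0 h1 h2.
pose l : seq (R * index R d) := [:: (1, (i, s, t))].
have [v0 h] := gm l.
have := gaussian_law_bump (measurable_lin l) h v0 0 e0.
rewrite (lin_cov_point i h1 h2) [gauss_bump _ 0]/gauss_bump expr0n/= oppr0 mul0r expR0.
rewrite mulr1 => <-.
by apply: eq_Rintegral => y _; rewrite /lin !big_cons big_nil /ev/=; congr gauss_bump; ring.
Qed.

(** The increments in s, then in t, are averaged out by resampling, each widening one bump by its
    variance, until both bumps sit at the point (s, min(t, v)) and merge. The remaining integral is
    explicit; nonnegative terms of its denominator are then dropped. *)
Lemma two_bump_le e i (s u t v : R) : 0 < e -> 0 < s -> s <= u -> 0 < t -> 0 < v ->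
  \int[m]_y (gauss_bump e (y i s t) * gauss_bump e (y i u v)) <=
  Num.sqrt (e ^+ 2 / (s * Num.min t v * (e + ((u - s) * v + s * `|t - v|)))).
Proof.
move=> e0 s0 su t0 v0.
have bb a b a' b' c c' : 0 < c -> 0 < c' ->
    bmf (fun y : path => gauss_bump c (y i a b) * gauss_bump c' (y i a' b')).
  by move=> *; apply: bmfM; exact: bmf_gauss_bump_point.
set r2 := (u - s) * v.
have r20 : 0 <= r2 by rewrite mulr_ge0 ?subr_ge0// ltW.
have e20 : 0 < e + r2 by rewrite ltr_wpDr.
(* The increment from (s, v) to (u, v) has variance [r2]; averaging it moves the second point to
   first coordinate s. *)
have -> : \int[m]_y (gauss_bump e (y i s t) * gauss_bump e (y i u v)) =
    Num.sqrt (e / (e + r2)) *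
    \int[m]_y (gauss_bump e (y i s t) * gauss_bump (e + r2) (y i s v)).
  rewrite (Rint_splice1 gm (ltW s0)); last exact: bb.
  rewrite -RintZ; last exact: bb.
  apply: eq_Rintegral => y _.
  rewrite [RHS]mulrCA (_ : r2 = u * v - s * v); last by rewrite /r2 mulrBl.
  rewrite -(@gauss_bump_incr e _ i)//; try exact: ltW.
  rewrite -RintZ; last exact: bmf_gauss_bump_coord.
  by apply: eq_Rintegral => y' _; rewrite splice1_past// ?(ltW s0)// splice1_future// ltW.
have r10 : 0 <= s * `|t - v| by rewrite mulr_ge0 ?normr_ge0// ltW.
have w0 : 0 < s * Num.min t v by rewrite mulr_gt0// lt_min t0.
set w := s * Num.min t v in w0 *; set r1 := s * `|t - v| in r10 *.
have e10 : 0 < e + r1 by rewrite ltr_wpDr.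
have e120 : 0 < e + r2 + r1 by rewrite ltr_wpDr.
have [e_0 e2_0 e1_0 w_0] : [/\ 0 <= e, 0 <= e + r2, 0 <= e + r1 & 0 <= w].
  by split; exact: ltW.
have D1 : 0 < w * (e + (r2 + r1)) by rewrite mulr_gt0// addrA.
have p2 : 0 <= w * e by rewrite mulr_ge0.
have fin A : 0 <= A -> A <= e ^+ 2 / (w * (e + (r2 + r1))) ->
    Num.sqrt A <= Num.sqrt (e ^+ 2 / (w * (e + (r2 + r1)))).
  by move=> A0 h; rewrite ler_sqrt// (le_trans A0).
have [tv|vt] := leP t v.
  have wE : w = s * t by rewrite /w (min_idPl tv).
  have rE : r1 = s * v - s * t by rewrite /r1 distrC ger0_norm ?subr_ge0// mulrBr.
  have -> : \int[m]_y (gauss_bump e (y i s t) * gauss_bump (e + r2) (y i s v)) =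
     Num.sqrt ((e + r2) / (e + r2 + r1)) *
     \int[m]_y (gauss_bump (e * (e + r2 + r1) / (e + (e + r2 + r1))) (y i s t)).
    rewrite (Rint_splice2 gm (ltW t0)); last exact: bb.
    rewrite -RintZ; last first.
      by apply: bmf_gauss_bump_point; rewrite divr_gt0 ?mulr_gt0// addr_gt0.
    apply: eq_Rintegral => y _; rewrite -gauss_bumpM// mulrCA.
    rewrite rE -(@gauss_bump_incr (e + r2) _ i)//; try exact: ltW.
    rewrite -RintZ; last exact: bmf_gauss_bump_coord.
    by apply: eq_Rintegral => y' _; rewrite splice2_past// ?(ltW t0)// splice2_future// ltW.
  rewrite gauss_bump_point ?(ltW s0) ?(ltW t0)//; last first.
    by rewrite divr_gt0 ?mulr_gt0// addr_gt0.
  rewrite -wE mulrA -sqrtrM; last by rewrite divr_ge0 ?ltW.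
  rewrite -sqrtrM; last by rewrite mulr_ge0// divr_ge0 ?ltW.
  rewrite -addrA; apply: fin.
    by do ![by []|rewrite invr_ge0|apply: mulr_ge0|apply: addr_ge0].
  rewrite [leLHS](_ : _ = e ^+ 2 / (e * (e + r2 + r1) + w * (e + e + r2 + r1))); last first.
    field; rewrite !gt_eqF//; nra.
  have p1 : 0 <= e * (e + r2 + r1) by rewrite mulr_ge0// ltW.
  apply: ler_wpM2l; first by rewrite exprn_ge0.
  by rewrite lef_pV2 ?posrE//; move: D1 p1 p2; lra.
have wE : w = s * v by rewrite /w (min_idPr (ltW vt)).
have rE : r1 = s * t - s * v by rewrite /r1 gtr0_norm ?subr_gt0// mulrBr.
have -> : \int[m]_y (gauss_bump e (y i s t) * gauss_bump (e + r2) (y i s v)) =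
     Num.sqrt (e / (e + r1)) *
     \int[m]_y (gauss_bump ((e + r1) * (e + r2) / (e + r1 + (e + r2))) (y i s v)).
  rewrite (Rint_splice2 gm (ltW v0)); last exact: bb.
  rewrite -RintZ; last first.
    by apply: bmf_gauss_bump_point; rewrite divr_gt0 ?mulr_gt0// addr_gt0.
  apply: eq_Rintegral => y _; rewrite -gauss_bumpM// mulrA.
  rewrite rE -(@gauss_bump_incr e _ i) ?(ltW vt)//; try exact: ltW.
  rewrite mulrC -RintZ; last exact: bmf_gauss_bump_coord.
  apply: eq_Rintegral => y' _; rewrite mulrC splice2_past// ?(ltW v0)//.
  by rewrite splice2_future// ltW.
rewrite gauss_bump_point ?(ltW s0) ?(ltW v0)//; last first.
  by rewrite divr_gt0 ?mulr_gt0// addr_gt0.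
rewrite -wE mulrA -sqrtrM; last by rewrite divr_ge0 ?ltW.
rewrite -sqrtrM; last by rewrite mulr_ge0// divr_ge0 ?ltW.
apply: fin.
  by do ![by []|rewrite invr_ge0|apply: mulr_ge0|apply: addr_ge0].
rewrite [leLHS](_ : _ = e ^+ 2 / ((e + r1) * (e + r2) + w * (e + e + r2 + r1))); last first.
  field; rewrite !gt_eqF//; nra.
have p1 : 0 <= (e + r1) * (e + r2) by rewrite mulr_ge0.
apply: ler_wpM2l; first by rewrite exprn_ge0.
by rewrite lef_pV2 ?posrE//; move: D1 p1 p2; lra.
Qed.

(* An approximate density of the sheet at the point 0 and time (s, t). *)
Definition nbump e (s t : R) y : R := \prod_(i < d) ((Num.sqrt e)^-1 * gauss_bump e (y i s t)).

(** The power x^(-d/2): up to a power of 2 pi, the density at 0 of a centered normal vector in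
    dimension d with variance x. *)
Definition gker (x : R) : R := (Num.sqrt x)^-1 ^+ d.

Lemma bmf_nbump e s t : 0 < e -> bmf (nbump e s t).
Proof. by move=> e0; apply: bmf_prod => i; apply: bmfZ; exact: bmf_gauss_bump_point. Qed.

Lemma nbump_ge0 e s t y : 0 <= nbump e s t y.
Proof. by apply: prodr_ge0 => i _; rewrite mulr_ge0 ?gauss_bump_ge0// invr_ge0 sqrtr_ge0. Qed.

Lemma prod_gauss_bump e y (s t : R) : \prod_(i < d) gauss_bump e (y i s t) =
  expR (- (\sum_(i < d) y i s t ^+ 2) / (2 * e)).
Proof.
rewrite /gauss_bump -expR_sum; congr expR.
by rewrite mulNr mulr_suml -sumrN; apply: eq_bigr => i _; rewrite mulNr.
Qed.

Lemma nbumpE e y (s t : R) : nbump e s t y =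
  gker e * expR (- (\sum_(i < d) y i s t ^+ 2) / (2 * e)).
Proof. by rewrite /nbump big_split/= prodr_const_ord prod_gauss_bump. Qed.

Lemma Rint_nbump e (s t : R) : 0 < e -> 0 <= s -> 0 <= t ->
  \int[m]_y nbump e s t y = gker (e + s * t).
Proof.
move=> e0 s0 t0; rewrite (Rint_prod_coord gm); last 2 first.
- by move=> i; apply: bmfZ; exact: bmf_gauss_bump_point.
- by move=> i y y' h; rewrite h.
transitivity (\prod_(i < d) (Num.sqrt (e + s * t))^-1).
  apply: eq_bigr => i _; rewrite RintZ; last exact: bmf_gauss_bump_point.
  rewrite gauss_bump_point// sqrtrM ?(ltW e0)// sqrtrV ?addr_ge0 ?mulr_ge0 ?(ltW e0)//.
  by rewrite mulrA mulVf ?mul1r// gt_eqF// sqrtr_gt0.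
by rewrite prodr_const_ord.
Qed.

(** By independence of the coordinates, the d-th power of [two_bump_le]. In c^3, two factors bound s
    min(t, v) and one bounds the coefficients of |s - u| and |t - v|; c <= 1 takes care of the
    coefficient of e. *)
Lemma Rint_nbump2_le c e (s u t v : R) : 0 < c <= 1 -> 0 < e ->
  c <= s -> c <= u -> c <= t -> c <= v ->
  \int[m]_y (nbump e s t y * nbump e u v y) <=
  gker (c ^+ 3) * gker (e + `|s - u| + `|t - v|).
Proof.
move=> /andP[c0 c1] e0.
wlog su : s u t v / s <= u => [wl cs cu ct cv|cs cu ct cv].
  have [su|us] := leP s u; first exact: wl.
  under eq_Rintegral do rewrite mulrC.
  by rewrite (distrC s) (distrC t); apply: wl => //; exact: ltW.
have s0 := lt_le_trans c0 cs; have t0 := lt_le_trans c0 ct.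
have v0 := lt_le_trans c0 cv.
have b2 i : bmf (fun y : path => (Num.sqrt e)^-1 * gauss_bump e (y i s t) *
    ((Num.sqrt e)^-1 * gauss_bump e (y i u v))).
  by apply: bmfM; apply: bmfZ; exact: bmf_gauss_bump_point.
under eq_Rintegral do rewrite -big_split/=.
rewrite (Rint_prod_coord gm)//; last by move=> i y y' h; rewrite !h.
rewrite /gker -exprMn -prodr_const_ord.
apply: ler_prod => i _; apply/andP; split.
  apply: Rint_ge0 => y; rewrite !mulr_ge0 ?gauss_bump_ge0// invr_ge0 sqrtr_ge0//.
have bb : bmf (fun y : path => gauss_bump e (y i s t) * gauss_bump e (y i u v)).
  by apply: bmfM; exact: bmf_gauss_bump_point.
under eq_Rintegral do rewrite mulrACA.
rewrite RintZ// -invfM -expr2 sqr_sqrtr ?(ltW e0)//.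
apply: le_trans (ler_wpM2l _ (two_bump_le i e0 s0 su t0 v0)) _.
  by rewrite invr_ge0 ltW.
have D0 : 0 < e + `|s - u| + `|t - v|.
  by rewrite -addrA ltr_wpDr// addr_ge0.
have c30 : 0 < c ^+ 3 by rewrite exprn_gt0.
rewrite -invfM -sqrtrM ?(ltW c30)// (sqrtrM _ (sqr_ge0 e)) sqrtr_sqr gtr0_norm//.
rewrite mulrA mulVf ?gt_eqF// mul1r.
have W0 : 0 < c ^+ 3 * (e + `|s - u| + `|t - v|) by rewrite mulr_gt0.
have key : c ^+ 3 * (e + `|s - u| + `|t - v|) <=
    s * Num.min t v * (e + ((u - s) * v + s * `|t - v|)).
  rewrite (_ : c ^+ 3 * _ = (c * c) * (c * (e + `|s - u| + `|t - v|))); last by ring.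
  apply: ler_pM; rewrite ?mulr_ge0 ?(ltW c0) ?(ltW D0)//.
    by apply: ler_pM; rewrite ?(ltW c0)// le_min ct.
  rewrite (distrC s) (ger0_norm (_ : 0 <= u - s)) ?subr_ge0//.
  have := normr_ge0 (t - v); move: `|t - v| => x x0.
  have h1 : c * e <= e by rewrite ler_piMl// ltW.
  have h2 : c * (u - s) <= (u - s) * v by rewrite mulrC ler_wpM2l// subr_ge0.
  have h3 : c * x <= s * x by rewrite ler_wpM2r.
  by lra.
rewrite sqrtrV; last by rewrite (le_trans (ltW W0)).
by rewrite lef_pV2 ?posrE ?sqrtr_gt0 ?(lt_le_trans W0)// ler_wsqrtr.
Qed.

(** The conditional expectation given the sheet before (s0, t0), computed in two steps: y' supplies
    the increment from (s0, t0) to (s0, t), y'' the one from (s0, t) to (s, t). They are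
    independent, and their variances sum to s t - s0 t0. *)
Lemma Rint_nbump_splice e (s0 s t0 t : R) y : 0 < e ->
  0 <= s0 -> s0 <= s -> 0 <= t0 -> t0 <= t ->
  \int[m]_y' \int[m]_y'' nbump e s t (splice1 s0 (splice2 t0 (y, y'), y'')) =
  nbump (e + (s * t - s0 * t0)) s0 t0 y.
Proof.
move=> e0 hs0 hs ht0 ht.
have incr e' (x : 'I_d -> R) a b a' b' : 0 < e' -> 0 <= a' -> a' <= a -> 0 <= b' -> b' <= b ->
  \int[m]_y \prod_(i < d) ((Num.sqrt e')^-1 * gauss_bump e' (x i + (y i a b - y i a' b'))) =
  \prod_(i < d) ((Num.sqrt (e' + (a * b - a' * b')))^-1 *
     gauss_bump (e' + (a * b - a' * b')) (x i)).
  move=> e'0 h1 h2 h3 h4; rewrite (Rint_prod_coord gm); last 2 first.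
  - by move=> i; apply: bmfZ; exact: bmf_gauss_bump_coord.
  - by move=> i z z' h; rewrite !h.
  have v0 : 0 <= a * b - a' * b' by rewrite subr_ge0 ler_pM.
  apply: eq_bigr => i _; rewrite RintZ; last exact: bmf_gauss_bump_coord.
  rewrite gauss_bump_incr// sqrtrM ?(ltW e'0)// sqrtrV ?(addr_ge0 (ltW e'0) v0)//.
  by rewrite !mulrA mulVf ?mul1r// gt_eqF// sqrtr_gt0.
have w0 : 0 <= s * t - s0 * t by rewrite subr_ge0 ler_wpM2r// (le_trans ht0).
transitivity (\int[m]_y' \prod_(i < d) ((Num.sqrt (e + (s * t - s0 * t)))^-1 *
   gauss_bump (e + (s * t - s0 * t)) (y i s0 t0 + (y' i s0 t - y' i s0 t0)))).
  apply: eq_Rintegral => y' _.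
  rewrite -(incr e (fun i => y i s0 t0 + (y' i s0 t - y' i s0 t0)) s t s0 t)//; last exact: le_trans ht.
  apply: eq_Rintegral => y'' _; apply: eq_bigr => i _.
  by rewrite splice1_future//= splice2_future.
rewrite incr//; last by rewrite ltr_wpDr.
rewrite /nbump (_ : e + (s * t - s0 * t) + (s0 * t - s0 * t0) = e + (s * t - s0 * t0))//.
ring.
Qed.

Lemma gker_gt0 x : 0 < x -> 0 < gker x.
Proof. by move=> x0; rewrite exprn_gt0// invr_gt0 sqrtr_gt0. Qed.

Lemma le_gker (x y : R) : 0 < x -> x <= y -> gker y <= gker x.
Proof.
move=> x0 xy; rewrite /gker lerXn2r ?nnegrE ?invr_ge0 ?sqrtr_ge0//.
by rewrite lef_pV2 ?posrE ?sqrtr_gt0 ?(lt_le_trans x0)// ler_wsqrtr.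
Qed.

Lemma gkerM (x y : R) : 0 <= x -> gker (x * y) = gker x * gker y.
Proof. by move=> x0; rewrite /gker sqrtrM// invfM exprMn. Qed.

(** The variance is at least e, so a squared norm at most e costs no more than the factor exp(-1/2);
    and s t - s0 t0 <= C ((s - s0) + (t - t0)). *)
Lemma nbump_ge e y (s0 s t0 t C : R) : 0 < e -> 1 <= C ->
  0 <= s0 -> s0 <= s -> 0 <= t0 -> t0 <= t -> s <= C -> t <= C ->
  \sum_(i < d) y i s0 t0 ^+ 2 <= e ->
  expR (- 2^-1) * gker C * gker (e + (s - s0) + (t - t0)) <=
  nbump (e + (s * t - s0 * t0)) s0 t0 y.
Proof.
move=> e0 C1 hs0 hs ht0 ht sC tC he; rewrite nbumpE -mulrA mulrC.
have C0 : 0 < C by rewrite (lt_le_trans ltr01).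
have v0 : 0 <= s * t - s0 * t0 by rewrite subr_ge0 ler_pM.
have ev0 : 0 < e + (s * t - s0 * t0) by rewrite ltr_wpDr.
apply: ler_pM; rewrite ?expR_ge0//.
- by rewrite mulr_ge0// ltW// gker_gt0// -addrA ltr_wpDr// addr_ge0// subr_ge0.
- rewrite -gkerM ?(ltW C0)//; apply: le_gker => //.
  have h1 : s * t - s0 * t0 = (s - s0) * t + s0 * (t - t0) by ring.
  have h2 : (s - s0) * t <= (s - s0) * C by rewrite ler_wpM2l// subr_ge0.
  have h3 : s0 * (t - t0) <= C * (t - t0).
    by rewrite ler_wpM2r// ?subr_ge0// (le_trans hs).
  by have : e <= C * e; [rewrite ler_peMl// ltW|lra].
- rewrite ler_expR !mulNr lerN2 ler_pdivrMr ?mulr_gt0//.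
  by rewrite mulrA mulVf// mul1r (le_trans he)// lerDl.
Qed.

End bump_moments.

(** * Second moments on a grid and Cairoli's inequality *)

Section abs_diff_sum.
Variable R : realType.

(** Each distance from l occurs at most once on either side. *)
Lemma sum_abs_diff_le (F : nat -> R) l M : (forall r, 0 <= F r) -> (l < M)%N ->
  \sum_(l' < M) F (maxn l l' - minn l l')%N <= 2 * \sum_(r < M) F r.
Proof.
move=> F0 lM; rewrite -(big_mkord xpredT F).
rewrite -(big_mkord xpredT (fun l' => F (maxn l l' - minn l l')%N)).
have sub a b : (a <= b)%N -> (b <= M)%N ->
    \sum_(a <= r < b) F r <= \sum_(0 <= r < M) F r.
  move=> ab bM; rewrite [leRHS](@big_cat_nat _ _ _ a)//=; last exact: leq_trans bM.
  rewrite [X in _ + X](@big_cat_nat _ _ _ b)//= addrCA lerDl addr_ge0//;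
    by apply: sumr_ge0 => r _.
rewrite (@big_cat_nat _ _ _ l)//=; last exact: ltnW.
rewrite mulr_natl mulr2n; apply: lerD.
  rewrite big_nat_rev /= add0n.
  apply: le_trans (sub 1%N l.+1 _ _) => //.
  rewrite big_add1 /=; apply: ler_sum_nat => i /andP[_ il].
  rewrite (maxn_idPl _) ?(minn_idPr _) ?leq_subr// subKn//.
rewrite -{1}[l]add0n big_addn.
apply: le_trans (sub 0%N (M - l)%N _ _); rewrite ?leq_subr//.
apply: ler_sum_nat => i _.
by rewrite (maxn_idPr _) ?(minn_idPl _) ?leq_addl// addnK.
Qed.

(** A window of N terms that starts in the first half of a window of 2N terms stays inside it; this
    is where the doubled range of times is used. *)
Lemma sum_shift_le (F : nat -> R) a j N : (forall l, 0 <= F l) ->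
  (a <= j <= a + N)%N ->
  \sum_(r < N) F (j + r)%N <= \sum_(l < N + N) F (a + l)%N.
Proof.
move=> F0 /andP[aj jN].
rewrite -(big_mkord xpredT (fun r => F (j + r)%N)).
rewrite -(big_mkord xpredT (fun l => F (a + l)%N)).
rewrite [leRHS](@big_cat_nat _ _ _ (j - a))//=; last first.
  by rewrite (leq_trans (_ : _ <= N)%N) ?leq_addr// leq_subLR.
rewrite [X in _ + X](@big_cat_nat _ _ _ (j - a + N))//=; last 2 first.
- exact: leq_addr.
- by rewrite leq_add2r leq_subLR.
have -> : \sum_(j - a <= i < j - a + N) F (a + i)%N = \sum_(0 <= r < N) F (j + r)%N.
  rewrite -{1}[(j - a)%N]add0n big_addn addKn.
  by apply: eq_bigr => r _; rewrite addnCA subnKC// addnC.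
rewrite addrCA.
by rewrite lerDl addr_ge0//; apply: sumr_ge0 => l _.
Qed.

End abs_diff_sum.

Section grid.
Variables (R : realType) (d n : nat) (m : probability (path R d) R).
Hypothesis gm : gaussian_sheet m.
Local Notation path := (path R d).

Definition pt (k : nat) : R := k%:R / n.+1%:R.

Lemma pt_ge0 k : 0 <= pt k. Proof. by rewrite divr_ge0. Qed.

Lemma le_pt k k' : (k <= k')%N -> pt k <= pt k'.
Proof. by move=> kk'; rewrite ler_wpM2r ?invr_ge0// ler_nat. Qed.

Lemma ptD k k' : pt (k + k') = pt k + pt k'.
Proof. by rewrite /pt natrD mulrDl. Qed.

Lemma ptB k k' : (k' <= k)%N -> pt (k - k') = pt k - pt k'.
Proof. by move=> kk'; rewrite /pt natrB// mulrBl. Qed.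

Lemma ptN : pt n.+1 = 1. Proof. by rewrite /pt divff. Qed.

Lemma abs_ptB k k' : `|pt k - pt k'| = pt (maxn k k' - minn k k').
Proof.
have [kk'|kk'] := leqP k k'.
  by rewrite ptB// distrC ger0_norm// subr_ge0 le_pt.
by rewrite ptB ?(ltnW kk')// ger0_norm// subr_ge0 le_pt// ltnW.
Qed.

(* A Riemann sum for the integral of (e + x + r)^(-d/2) over 0 < r < 1. *)
Definition kap (e x : R) : R := \sum_(r < n.+1) n.+1%:R^-1 * gker d (e + x + pt r).

Lemma kap_ge0 e x : 0 <= kap e x.
Proof.
by apply: sumr_ge0 => r _; rewrite mulr_ge0 ?invr_ge0// exprn_ge0// invr_ge0 sqrtr_ge0.
Qed.

Lemma sum_mesh : \sum_(r < n.+1) n.+1%:R^-1 = 1 :> R.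
Proof. by rewrite big_const_ord iter_addr_0 -[_^-1 *+ _]mulr_natl divff. Qed.

Lemma kap_le e x : 0 < e -> 0 <= x -> kap e x <= gker d e.
Proof.
move=> e0 x0; rewrite -[leRHS]mul1r -sum_mesh mulr_suml; apply: ler_sum => r _.
by rewrite ler_wpM2l ?invr_ge0// le_gker// -addrA lerDl addr_ge0// pt_ge0.
Qed.

Lemma kap_decr e x e' x' : 0 < e + x -> e + x <= e' + x' -> kap e' x' <= kap e x.
Proof.
move=> e0 h; apply: ler_sum => r _; rewrite ler_wpM2l ?invr_ge0// le_gker ?lerD2r//.
by rewrite ltr_wpDr// pt_ge0.
Qed.

Section functional.
Variables (w : nat -> R) (K L0 : nat) (e : R).
Hypotheses (w0 : forall k, 0 <= w k) (e0 : 0 < e).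

Definition zfun (y : path) : R := \sum_(k < K) w k *
  \sum_(l < n.+1 + n.+1) n.+1%:R^-1 * nbump e (pt k) (pt (L0 + l)) y.

Definition energy : R := \sum_(k < K) \sum_(k' < K) w k * w k' * kap e `|pt k - pt k'|.

Lemma bmf_zfun : bmf zfun.
Proof.
apply: bmf_sum => k; apply: bmfZ; apply: bmf_sum => l; apply: bmfZ.
exact: bmf_nbump.
Qed.

Lemma zfun_ge0 y : 0 <= zfun y.
Proof.
apply: sumr_ge0 => k _; rewrite mulr_ge0//; apply: sumr_ge0 => l _.
by rewrite mulr_ge0 ?invr_ge0// nbump_ge0.
Qed.

Lemma Rint_zfun_ge C : (forall k, (k < K)%N -> pt k <= C) ->
  pt (L0 + (n.+1 + n.+1)) <= C ->
  gker d (e + C ^+ 2) * \sum_(k < K) w k <= \int[m]_y zfun y.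
Proof.
move=> kC lC.
rewrite Rint_sum; last first.
  by move=> k; apply: bmfZ; apply: bmf_sum => l; apply: bmfZ; exact: bmf_nbump.
rewrite mulr_sumr; apply: ler_sum => k _.
rewrite RintZ; last by apply: bmf_sum => l; apply: bmfZ; exact: bmf_nbump.
rewrite mulrC ler_wpM2l// Rint_sum; last by move=> l; apply: bmfZ; exact: bmf_nbump.
(* The first n+1 times already have total weight 1; the others contribute nonnegatively. *)
rewrite big_split_ord /= -[leLHS]addr0 lerD//; last first.
  apply: sumr_ge0 => l _; apply: Rint_ge0 => y.
  by rewrite mulr_ge0 ?invr_ge0// nbump_ge0.
have -> : gker d (e + C ^+ 2) = \sum_(l < n.+1) n.+1%:R^-1 * gker d (e + C ^+ 2).
  by rewrite -mulr_suml sum_mesh mul1r.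
apply: ler_sum => l _; rewrite RintZ; last exact: bmf_nbump.
rewrite Rint_nbump ?pt_ge0// ler_wpM2l ?invr_ge0// le_gker//.
  by rewrite ltr_wpDr// mulr_ge0// pt_ge0.
rewrite lerD2l expr2; apply: ler_pM; rewrite ?pt_ge0//; first exact: kC.
by apply: le_trans lC; apply: le_pt; rewrite leq_add2l ltnW// ltn_addr.
Qed.

(** The constant 8 is a product of three factors 2: the total weight of the times l, the two sides
    in [sum_abs_diff_le], and time differences up to 2, which are covered by two copies of [kap]
    since the kernel decreases. *)
Lemma Rint_zfun2_le c : 0 < c <= 1 -> (forall k, (k < K)%N -> w k != 0 -> c <= pt k) ->
  c <= pt L0 ->
  \int[m]_y (zfun y ^+ 2) <= 8 * gker d (c ^+ 3) * energy.
Proof.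
move=> c01 kc Lc.
have b1 k l : bmf (fun y : path => nbump e (pt k) (pt (L0 + l)) y) by exact: bmf_nbump.
have b2 k : bmf (fun y : path => \sum_(l < n.+1 + n.+1)
    n.+1%:R^-1 * nbump e (pt k) (pt (L0 + l)) y).
  by apply: bmf_sum => l; apply: bmfZ.
under eq_Rintegral do rewrite expr2 /zfun mulr_suml.
rewrite Rint_sum; last first.
  by move=> k; apply: bmfM; [exact: bmfZ|apply: bmf_sum => k'; exact: bmfZ].
rewrite /energy mulr_sumr; apply: ler_sum => k _.
under eq_Rintegral do rewrite mulr_sumr.
rewrite Rint_sum; last by move=> k'; apply: bmfM; exact: bmfZ.
rewrite mulr_sumr; apply: ler_sum => k' _.
under eq_Rintegral do rewrite mulrACA.
rewrite RintZ; last exact: bmfM.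
rewrite [leRHS]mulrCA.
have [wk|wk] := eqVneq (w k) 0; first by rewrite wk !mul0r.
have [wk'|wk'] := eqVneq (w k') 0; first by rewrite wk' mulr0 !mul0r.
apply: ler_wpM2l; first exact: mulr_ge0.
under eq_Rintegral do rewrite mulr_suml.
rewrite Rint_sum; last by move=> l; apply: bmfM => //; exact: bmfZ.
have G0 x : 0 <= gker d x by rewrite exprn_ge0// invr_ge0 sqrtr_ge0.
have step (l : 'I_(n.+1 + n.+1)) :
    \int[m]_y (n.+1%:R^-1 * nbump e (pt k) (pt (L0 + l)) y *
      \sum_(l' < n.+1 + n.+1) n.+1%:R^-1 * nbump e (pt k') (pt (L0 + l')) y) <=
    n.+1%:R^-1 * (4 * gker d (c ^+ 3) * kap e `|pt k - pt k'|).
  under eq_Rintegral do rewrite -mulrA mulr_sumr.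
  rewrite RintZ; last by apply: bmf_sum => l'; apply: bmfM => //; exact: bmfZ.
  rewrite ler_wpM2l ?invr_ge0//.
  rewrite Rint_sum; last by move=> l'; apply: bmfM => //; exact: bmfZ.
  pose F r := n.+1%:R^-1 * gker d (e + `|pt k - pt k'| + pt r).
  have F0 r : 0 <= F r by apply: mulr_ge0; [rewrite invr_ge0|exact: G0].
  apply: (@le_trans _ _ (gker d (c ^+ 3) * \sum_(l' < n.+1 + n.+1) F (maxn l l' - minn l l')%N)).
    rewrite mulr_sumr; apply: ler_sum => l' _.
    under eq_Rintegral do rewrite mulrCA.
    rewrite RintZ; last exact: bmfM.
    rewrite /F [leRHS]mulrCA ler_wpM2l ?invr_ge0//.
    apply: le_trans (Rint_nbump2_le gm c01 e0 (kc _ (ltn_ord k) wk)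
      (kc _ (ltn_ord k') wk') _ _) _.
    - by apply: le_trans Lc _; rewrite le_pt// leq_addr.
    - by apply: le_trans Lc _; rewrite le_pt// leq_addr.
    - by apply: ler_wpM2l; [exact: G0|rewrite -abs_ptB !ptD opprD addrACA subrr add0r].
  rewrite (_ : 4 * _ * _ = gker d (c ^+ 3) * (2 * (kap e `|pt k - pt k'| *+ 2))); last by ring.
  apply: ler_wpM2l; first exact: G0.
  apply: le_trans (sum_abs_diff_le F0 (ltn_ord l)) _.
  rewrite ler_wpM2l// big_split_ord/= mulr2n lerD2l.
  apply: ler_sum => r _; rewrite /F ler_wpM2l ?invr_ge0// le_gker//.
    by rewrite !ltr_wpDr// pt_ge0.
  by rewrite lerD2l le_pt// leq_addl.
apply: le_trans (ler_sum _ (fun l _ => step l)) _.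
by rewrite -mulr_suml big_split_ord/= sum_mesh; lra.
Qed.

Definition rpot i : R := \sum_(k < K | (i <= k)%N) w k * kap e (pt k - pt i).

Lemma rpot_ge0 i : 0 <= rpot i.
Proof. by apply: sumr_ge0 => k _; rewrite mulr_ge0// kap_ge0. Qed.

Lemma rpot_le i : rpot i <= gker d e * \sum_(k < K) w k.
Proof.
rewrite [leRHS]mulrC mulr_suml [leRHS](bigID (fun k : 'I_K => (i <= k)%N))/=.
rewrite -[leLHS]addr0; apply: lerD.
  by apply: ler_sum => k ik; rewrite ler_wpM2l// kap_le// subr_ge0 le_pt.
by apply: sumr_ge0 => k _; rewrite mulr_ge0// exprn_ge0// invr_ge0 sqrtr_ge0.
Qed.

(** By symmetry the pairs with i <= k and those with k <= i contribute equally; the diagonal is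
    counted twice. *)
Lemma energy_le_rpot : energy <= 2 * \sum_(i < K) w i * rpot i.
Proof.
rewrite (_ : 2 * _ = (\sum_(i < K) w i * rpot i) + (\sum_(i < K) w i * rpot i)); last by ring.
have E : \sum_(i < K) w i * rpot i = \sum_(i < K) \sum_(k < K)
    (if (i <= k)%N then w i * w k * kap e `|pt i - pt k| else 0).
  apply: eq_bigr => i _; rewrite /rpot mulr_sumr -big_mkcond/=.
  apply: eq_bigr => k ik; rewrite mulrA distrC ger0_norm// subr_ge0; exact: le_pt.
have E2 : \sum_(i < K) w i * rpot i = \sum_(i < K) \sum_(k < K)
    (if (k <= i)%N then w i * w k * kap e `|pt i - pt k| else 0).
  rewrite E exchange_big/=; apply: eq_bigr => i _; apply: eq_bigr => k _.
  by rewrite distrC [w k * w i]mulrC.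
rewrite {1}E E2 -big_split; apply: ler_sum => i _.
rewrite -big_split; apply: ler_sum => k _ /=.
have W0 : 0 <= w i * w k * kap e `|pt i - pt k| by rewrite !mulr_ge0// kap_ge0.
have [ik|ki] := leqP i k; first by rewrite lerDl; case: ifP.
by rewrite (ltnW ki) lerDr.
Qed.

(* Cairoli's inequality: W is the two-parameter maximal function of zfun, bounded
   by Doob's inequality applied once in each parameter. *)
Lemma cairoli : exists W : path -> R, [/\ bmf W,
  \int[m]_y (W y ^+ 2) <= 16 * \int[m]_y (zfun y ^+ 2) &
  forall i j C (y : path), (i < K)%N -> (L0 <= j <= L0 + n.+1)%N -> 1 <= C ->
    (forall k, (k < K)%N -> pt k <= C) -> pt (L0 + (n.+1 + n.+1)) <= C ->
    \sum_(q < d) y q (pt i) (pt j) ^+ 2 <= e ->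
    expR (- 2^-1) * gker d C * rpot i <= W y].
Proof.
pose S1 i := @splice1 R d (pt i); pose S2 i := @splice2 R d (pt i).
have mS1 i : measurable_fun setT (S1 i) by exact: measurable_splice1.
have mS2 i : measurable_fun setT (S2 i) by exact: measurable_splice2.
have l1 i A : measurable A -> m A = (m \x m)%E (S1 i @^-1` A).
  by move=> mA; apply: splice1_law => //; exact: pt_ge0.
have l2 i A : measurable A -> m A = (m \x m)%E (S2 i @^-1` A).
  by move=> mA; apply: splice2_law => //; exact: pt_ge0.
have SS1 i j y y' y'' : (i <= j)%N -> S1 i (S1 j (y, y''), y') = S1 i (y, y').
  by move=> ij; apply: splice1_splice1; [exact: pt_ge0|exact: le_pt].
have SS2 i j y y' y'' : (i <= j)%N -> S2 i (S2 j (y, y''), y') = S2 i (y, y').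
  by move=> ij; apply: splice2_splice2; [exact: pt_ge0|exact: le_pt].
have bz : bmf zfun by exact: bmf_zfun.
(* The maximum over s comes first, then that of its conditional expectations over t; Doob's constant
   4 enters twice. *)
pose M := maxres m S1 zfun K; have bM : bmf M by exact: bmf_maxres.
pose W := maxres m S2 M (L0 + n.+1); exists W; split.
- exact: bmf_maxres.
- apply: le_trans (doob mS2 l2 SS2 _ bM) _.
  by have := doob mS1 l1 SS1 K bz; rewrite -/M; lra.
move=> i j C y iK /andP[L0j jL] C1 kC lC ye.
apply: le_trans (le_maxres m S2 M y jL).
have bR := bmf_resample m mS1 i bz.
(* Conditioning the maximum M at level j dominates conditioning its single term i, and the latter is
   the two-parameter conditional expectation at (i, j). *)
apply: le_trans (resample_le m mS2 j y bR bM (fun z => le_maxres m S1 zfun z (ltnW iK))).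
pose Y (y' : path) : path := S2 j (y, y').
have bsec2 (f : path -> R) : bmf f -> bmf (fun y' : path => f (Y y')).
  by move=> bf; apply: (bmf_comp bf (measurableT_comp (mS2 j) (measurable_pair1 y))).
have bsec1 (f : path -> R) (z : path) : bmf f -> bmf (fun y' : path => f (S1 i (z, y'))).
  by move=> bf; apply: (bmf_comp bf (measurableT_comp (mS1 i) (measurable_pair1 z))).
rewrite /resample.
have -> : \int[m]_y' \int[m]_y'' zfun (S1 i (S2 j (y, y'), y'')) =
  \sum_(k < K) w k * \sum_(l < n.+1 + n.+1) n.+1%:R^-1 *
    \int[m]_y' \int[m]_y'' nbump e (pt k) (pt (L0 + l)) (S1 i (S2 j (y, y'), y'')).
  have bI (f : path -> R) : bmf f -> bmf (fun y' : path => \int[m]_y'' f (S1 i (S2 j (y, y'), y''))).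
    by move=> bf; exact: (bsec2 _ (bmf_resample m mS1 i bf)).
  have b1 k l : bmf (fun y : path => nbump e (pt k) (pt (L0 + l)) y) by exact: bmf_nbump.
  transitivity (\int[m]_y' \sum_(k < K) w k * \sum_(l < n.+1 + n.+1) n.+1%:R^-1 *
      \int[m]_y'' nbump e (pt k) (pt (L0 + l)) (S1 i (S2 j (y, y'), y''))).
    apply: eq_Rintegral => y' _; rewrite /zfun.
    rewrite Rint_sum; last first.
      move=> k; apply: bmfZ; apply: bmf_sum => l; apply: bmfZ.
      exact: (bsec1 _ _ (b1 k l)).
    apply: eq_bigr => k _; rewrite RintZ; last first.
      by apply: bmf_sum => l; apply: bmfZ; exact: (bsec1 _ _ (b1 k l)).
    congr (_ * _); rewrite Rint_sum; last first.
      by move=> l; apply: bmfZ; exact: (bsec1 _ _ (b1 k l)).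
    by apply: eq_bigr => l _; rewrite RintZ//; exact: (bsec1 _ _ (b1 k l)).
  rewrite Rint_sum; last first.
    by move=> k; apply: bmfZ; apply: bmf_sum => l; apply: bmfZ; exact: bI.
  apply: eq_bigr => k _; rewrite RintZ; last first.
    by apply: bmf_sum => l; apply: bmfZ; exact: bI.
  congr (_ * _); rewrite Rint_sum; last by move=> l; apply: bmfZ; exact: bI.
  by apply: eq_bigr => l _; rewrite RintZ//; exact: bI.
have I0 k l : 0 <= \int[m]_y' \int[m]_y'' nbump e (pt k) (pt (L0 + l)) (S1 i (S2 j (y, y'), y'')).
  by apply: Rint_ge0 => y'; apply: Rint_ge0 => y''; exact: nbump_ge0.
have n0 : 0 <= n.+1%:R^-1 :> R by rewrite invr_ge0.
(* Terms with k < i are nonnegative and dropped; for k >= i only the n+1 times from j on are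
   kept. *)
rewrite /rpot mulr_sumr big_mkcond/=; apply: ler_sum => k _.
case: ifP => [ik|_]; last first.
  by rewrite mulr_ge0//; apply: sumr_ge0 => l _; rewrite mulr_ge0.
rewrite mulrCA ler_wpM2l// /kap mulr_sumr.
pose F l := n.+1%:R^-1 * \int[m]_y' \int[m]_y'' nbump e (pt k) (pt l) (S1 i (S2 j (y, y'), y'')).
have F0 l : 0 <= F l.
  by apply: mulr_ge0 => //; apply: Rint_ge0 => y'; apply: Rint_ge0 => y''; exact: nbump_ge0.
apply: (@le_trans _ _ (\sum_(r < n.+1) F (j + r)%N)).
  apply: ler_sum => r _; rewrite mulrCA ler_wpM2l//.
  rewrite /S1 /S2 (Rint_nbump_splice gm)// ?pt_ge0 ?le_pt// ?leq_addr//.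
  rewrite (_ : pt r = pt (j + r) - pt j); last by rewrite ptD addrC addKr.
  apply: nbump_ge => //; rewrite ?pt_ge0 ?le_pt ?leq_addr//; first exact: kC.
  apply: le_trans lC; apply: le_pt.
  by rewrite addnA leq_add// ltnW.
by apply: (sum_shift_le F0); rewrite L0j.
Qed.

End functional.

End grid.

(** * Comparison with the Riesz kernel *)

Section riesz_bounds.
Variable R : realType.
Implicit Types a b x y z : R.

Lemma riesz_kernel1 z : riesz_kernel ((1%:R - 2) / 2) z = 1%E.
Proof. by rewrite /riesz_kernel ifT//; lra. Qed.

Lemma riesz_kernel2 z : z != 0 ->
  riesz_kernel ((2%:R - 2) / 2) z = (Num.max 0 (ln `|z|^-1))%:E.
Proof. by move=> z0; rewrite /riesz_kernel subrr mul0r ltxx (negbTE z0) eqxx. Qed.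

(** As an integer power of a square root, the kernel has the shape of [gker]. *)
Lemma riesz_kernel3 k z : z != 0 ->
  riesz_kernel ((k.+3%:R - 2) / 2) z = ((Num.sqrt `|z|)^-1 ^+ k.+1)%:E.
Proof.
move=> z0.
have -> : (k.+3%:R - 2) / 2 = k.+1%:R / 2 :> R.
  by rewrite -addn2 natrD addrK.
have k0 : (0 : R) < k.+1%:R / 2 by rewrite divr_gt0.
rewrite /riesz_kernel ltNge (ltW k0)/= (negbTE z0) gt_eqF//; congr EFin.
rewrite powRN [k.+1%:R / 2]mulrC powRrM powR12_sqrt// powR_mulrn ?sqrtr_ge0//.
by rewrite exprVn.
Qed.

Lemma riesz_kernel_ge0 b z : (0 <= riesz_kernel b z)%E.
Proof.
rewrite /riesz_kernel; case: ifP => _; first by rewrite lee_fin.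
case: ifP => _; first exact: leey.
case: ifP => _; last by rewrite lee_fin powR_ge0.
by rewrite lee_fin le_max lexx.
Qed.

Lemma riesz_kernel0 b : 0 <= b -> riesz_kernel b 0 = +oo%E.
Proof. by move=> b0; rewrite /riesz_kernel ltNge b0/= eqxx. Qed.

Variable n : nat.
Local Notation dl := (n.+1%:R^-1 : R).

(** Comparison of a sum with an integral: g acts as an antiderivative of a bound for a^(-d/2), and
    n+1 steps of one mesh cover the length 1. *)
Lemma kap_telescope_le d (g : R -> R) y : 0 < y ->
  (forall a, y <= a -> dl * gker d a <= g (a + dl) - g a) ->
  kap d n y 0 <= g (y + 1) - g y.
Proof.
move=> y0 h; rewrite /kap.
rewrite (_ : g (y + 1) - g y = \sum_(0 <= r < n.+1) (g (y + pt R n r.+1) - g (y + pt R n r))).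
  rewrite big_mkord; apply: ler_sum => r _; rewrite addr0.
  rewrite (_ : y + pt R n r.+1 = (y + pt R n r) + dl).
    by apply: h; rewrite lerDl pt_ge0.
  by rewrite -addn1 ptD addrA [pt R n 1]/pt mul1r.
by rewrite (telescope_sumr (fun r => g (y + pt R n r)))// ptN /pt mul0r addr0.
Qed.

Lemma kap_telescope_ge d (g : R -> R) y : 0 < y ->
  (forall a, y <= a -> g (a + dl) - g a <= dl * gker d a) ->
  g (y + 1) - g y <= kap d n y 0.
Proof.
move=> y0 h; rewrite /kap.
rewrite (_ : g (y + 1) - g y = \sum_(0 <= r < n.+1) (g (y + pt R n r.+1) - g (y + pt R n r))).
  rewrite big_mkord; apply: ler_sum => r _; rewrite addr0.
  rewrite (_ : y + pt R n r.+1 = (y + pt R n r) + dl).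
    by apply: h; rewrite lerDl pt_ge0.
  by rewrite -addn1 ptD addrA [pt R n 1]/pt mul1r.
by rewrite (telescope_sumr (fun r => g (y + pt R n r)))// ptN /pt mul0r addr0.
Qed.

(** In terms of the two square roots the one-step bounds become polynomial inequalities; B <= 2 A
    because the mesh is at most a. *)
Let sqrt_step a : dl <= a -> 0 < a -> exists A B, [/\ Num.sqrt a = A,
  Num.sqrt (a + dl) = B, 0 < A, A <= B & [/\ B <= 2 * A & dl = B ^+ 2 - A ^+ 2]].
Proof.
move=> da a0; exists (Num.sqrt a), (Num.sqrt (a + dl)).
have d0 : 0 < dl by rewrite invr_gt0.
split=> //; first by rewrite sqrtr_gt0.
  by rewrite ler_wsqrtr// lerDl ltW.
split; last by rewrite !sqr_sqrtr ?addr_ge0 ?(ltW a0) ?(ltW d0)// [_ + dl]addrC addrK.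
rewrite -[2]ger0_norm// -sqrtr_sqr -sqrtrM ?sqr_ge0// ler_wsqrtr//.
by move: da d0; move: (n.+1%:R^-1 : R) => c; lra.
Qed.

Lemma kap1_le y : dl <= y -> 0 < y -> kap 1 n y 0 <= 3.
Proof.
move=> dy y0.
apply: (@le_trans _ _ (3 * Num.sqrt (y + 1) - 3 * Num.sqrt y)).
  (* The factor 3 comes from A + B <= 3 A. *)
  apply: (@kap_telescope_le 1 (fun a => 3 * Num.sqrt a)) => // a ya.
  have [A [B [sA -> A0 AB [B2 ->]]]] := sqrt_step (le_trans dy ya) (lt_le_trans y0 ya).
  rewrite /gker expr1 sA ler_pdivrMr//.
  have : 0 <= (B - A) * (2 * A - B) by rewrite mulr_ge0 ?subr_ge0.
  by move: (B) (A) => b a'; lra.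
rewrite -mulrBr -[leRHS]mulr1 ler_wpM2l// lerBlDr.
rewrite -(@ler_pXn2r _ 2%N) ?nnegrE ?addr_ge0 ?sqrtr_ge0//.
rewrite sqr_sqrtr ?addr_ge0 ?(ltW y0)// sqrrD expr1n mul1r sqr_sqrtr ?(ltW y0)//.
by have := sqrtr_ge0 y; lra.
Qed.

Lemma kap2_le y : dl <= y -> 0 < y -> kap 2 n y 0 <= 2 * (ln (y + 1) - ln y).
Proof.
move=> dy y0; rewrite mulrBr.
apply: (@kap_telescope_le 2 (fun a => 2 * ln a)) => // a ya.
have a0 := lt_le_trans y0 ya.
have d0 : 0 < dl by rewrite invr_gt0.
have b0 : 0 < a + dl by rewrite addr_gt0.
have -> : gker 2 a = a^-1 by rewrite /gker exprVn sqr_sqrtr// ltW.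
have da : dl <= a by exact: le_trans ya.
have h : ln a - ln (a + dl) <= - (dl / (a + dl)).
  rewrite -ln_div ?posrE// (_ : a / (a + dl) = 1 + - (dl / (a + dl))); last first.
    by rewrite -[X in X - _](divff (lt0r_neq0 b0)) -mulNr -mulrDl addrK.
  by rewrite le_ln1Dx// ltrN2 ltr_pdivrMr// mul1r ltrDr.
have h2 : dl / a <= 2 * (dl / (a + dl)).
  rewrite mulrCA ler_wpM2l ?(ltW d0)// ler_pdivlMr// mulrC ler_pdivrMr//.
  by move: da; move: (n.+1%:R^-1 : R) => c; lra.
move: h h2; move: (dl / a) (dl / (a + dl)) (ln a) (ln (a + dl)) => p q u v; lra.
Qed.

Lemma kap2_ge y : 0 < y -> ln (y + 1) - ln y <= kap 2 n y 0.
Proof.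
move=> y0; apply: (@kap_telescope_ge 2 (@ln R)) => // a ya.
have a0 := lt_le_trans y0 ya.
have d0 : 0 < dl by rewrite invr_gt0.
have -> : gker 2 a = a^-1 by rewrite /gker exprVn sqr_sqrtr// ltW.
rewrite -ln_div ?posrE ?addr_gt0//.
rewrite (_ : (a + dl) / a = 1 + dl / a); last by rewrite mulrDl divff ?gt_eqF.
by rewrite le_ln1Dx// (lt_trans (ltrN10 _))// divr_gt0.
Qed.

Lemma kap3_le k y : dl <= y -> 0 < y ->
  kap k.+3 n y 0 <= 6 * (Num.sqrt y)^-1 ^+ k.+1.
Proof.
move=> dy y0.
apply: (@le_trans _ _ (- (6 * (Num.sqrt (y + 1))^-1 ^+ k.+1) -
    - (6 * (Num.sqrt y)^-1 ^+ k.+1))).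
  (* The factor 6 comes from (A + B) B <= 6 A^2. *)
  apply: (@kap_telescope_le _ (fun a => - (6 * (Num.sqrt a)^-1 ^+ k.+1))) => // a ya.
  have [A [B [sA -> A0 AB [B2 ->]]]] := sqrt_step (le_trans dy ya) (lt_le_trans y0 ya).
  rewrite /gker sA opprK [leRHS]addrC.
  have B0 := lt_le_trans A0 AB.
  have h : (B ^+ 2 - A ^+ 2) * A^-1 ^+ 3 <= 6 * (A^-1 - B^-1).
    rewrite -subr_ge0 (_ : _ - _ =
      (B - A) * (6 * A ^+ 2 - (B + A) * B) * (A ^+ 3 * B)^-1); last first.
      by field; rewrite !gt_eqF.
    by rewrite !mulr_ge0 ?subr_ge0 ?invr_ge0 ?exprn_ge0 ?mulr_ge0 ?exprn_ge0 ?(ltW A0) ?(ltW B0)//; nra.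
  have h3 : B^-1 ^+ k.+1 <= A^-1 ^+ k * B^-1.
    rewrite exprSr ler_wpM2r ?invr_ge0 ?(ltW B0)// lerXn2r ?nnegrE ?invr_ge0 ?(ltW A0) ?(ltW B0)//.
    by rewrite lef_pV2.
  rewrite -mulrBr (_ : A^-1 ^+ k.+3 = A^-1 ^+ k * A^-1 ^+ 3); last by rewrite -exprD addn3.
  apply: (@le_trans _ _ (A^-1 ^+ k * (6 * (A^-1 - B^-1)))).
    by rewrite mulrCA ler_wpM2l// exprn_ge0// invr_ge0 ltW.
  by rewrite mulrCA ler_wpM2l// mulrBr -exprSr lerD2l lerN2.
by rewrite opprK gerDr oppr_le0 mulr_ge0// exprn_ge0// invr_ge0 sqrtr_ge0.
Qed.

Lemma subrX_le (a b : R) k : 0 <= b -> b <= a ->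
  a ^+ k.+1 - b ^+ k.+1 <= k.+1%:R * (a - b) * a ^+ k.
Proof.
move=> b0 ba; elim: k => [|k IH]; first by rewrite !expr1 expr0 mul1r mulr1.
have a0 := le_trans b0 ba.
rewrite (_ : a ^+ k.+2 - _ = a * (a ^+ k.+1 - b ^+ k.+1) + (a - b) * b ^+ k.+1); last first.
  by rewrite !exprS; ring.
rewrite -[k.+2%:R]natr1.
have h1 : a * (a ^+ k.+1 - b ^+ k.+1) <= a * (k.+1%:R * (a - b) * a ^+ k).
  by rewrite ler_wpM2l.
have h2 : (a - b) * b ^+ k.+1 <= (a - b) * a ^+ k.+1.
  by rewrite ler_wpM2l ?subr_ge0// lerXn2r ?nnegrE.
rewrite (_ : (k.+1%:R + 1) * _ * _ = a * (k.+1%:R * (a - b) * a ^+ k) +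
  (a - b) * a ^+ k.+1); first exact: lerD.
by rewrite exprS; ring.
Qed.

(** Telescoping leaves the value of the power at y + 1, which is at most 1 and is paid for by the
    summand 1. *)
Lemma kap3_ge k y : dl <= y -> 0 < y ->
  (Num.sqrt y)^-1 ^+ k.+1 <= k.+1%:R * kap k.+3 n y 0 + 1.
Proof.
move=> dy y0; rewrite -lerBlDr.
have k0 : 0 < k.+1%:R :> R by [].
rewrite mulrC -ler_pdivrMr//.
apply: (@le_trans _ _ (- ((Num.sqrt (y + 1))^-1 ^+ k.+1 / k.+1%:R) -
    - ((Num.sqrt y)^-1 ^+ k.+1 / k.+1%:R))).
  rewrite opprK [leRHS]addrC -mulrBl ler_wpM2r ?invr_ge0// lerD2l lerN2.
  rewrite exprn_ile1 ?invr_ge0 ?sqrtr_ge0// invf_le1 ?sqrtr_gt0 ?addr_gt0//.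
  by rewrite -[leLHS]sqrtr1 ler_wsqrtr// lerDr ltW.
apply: (@kap_telescope_ge _ (fun a => - ((Num.sqrt a)^-1 ^+ k.+1 / k.+1%:R))) => // a ya.
have [A [B [sA -> A0 AB [B2 ->]]]] := sqrt_step (le_trans dy ya) (lt_le_trans y0 ya).
rewrite /gker sA opprK [leLHS]addrC -mulrBl ler_pdivrMr//.
have B0 := lt_le_trans A0 AB.
apply: le_trans (subrX_le _ _ _) _; rewrite ?invr_ge0 ?(ltW B0) ?lef_pV2//.
have h : A^-1 - B^-1 <= (B ^+ 2 - A ^+ 2) * A^-1 ^+ 3.
  rewrite -subr_ge0 (_ : _ - _ =
      (B - A) * ((B + A) * B - A ^+ 2) * (A ^+ 3 * B)^-1); last first.
    by field; rewrite !gt_eqF.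
  by rewrite !mulr_ge0 ?subr_ge0 ?invr_ge0 ?exprn_ge0 ?mulr_ge0 ?exprn_ge0 ?(ltW A0) ?(ltW B0)//; nra.
rewrite -mulrA mulrC ler_wpM2r//.
rewrite (_ : A^-1 ^+ k.+3 = A^-1 ^+ 3 * A^-1 ^+ k); last by rewrite -exprD.
by rewrite mulrA ler_wpM2r// exprn_ge0// invr_ge0 ltW.
Qed.

End riesz_bounds.

Section riesz_kap.
Variable R : realType.
Implicit Types y z : R.

(** Here y is a regularised distance and z the true one. The summand 1 covers the logarithmic kernel
    where it vanishes, and 6 suffices in the three regimes d = 1, d = 2 and d >= 3. *)
Lemma kap_le_riesz d n y z : (1 <= d)%N -> n.+1%:R^-1 <= y -> 0 < y -> `|z| <= y ->
  ((kap d n y 0)%:E <= 6%:E * (1 + riesz_kernel ((d%:R - 2) / 2) z))%E.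
Proof.
move=> d1 dy y0 zy.
have [z0|z0] := eqVneq z 0.
  have [d2|d2] := leqP 2 d.
    by rewrite z0 riesz_kernel0 ?divr_ge0 ?subr_ge0 ?ler_nat// addey// mulry gtr0_sg// mul1e leey.
  have -> : d = 1%N by apply/eqP; rewrite eqn_leq d1 -ltnS d2.
  rewrite riesz_kernel1 -EFinD -EFinM lee_fin.
  by have := kap1_le dy y0; lra.
have nz : 0 < `|z| by rewrite normr_gt0.
case: d d1 => [//|[|[|k]]] _.
- rewrite riesz_kernel1 -EFinD -EFinM lee_fin.
  by have := kap1_le dy y0; lra.
- rewrite riesz_kernel2// -EFinD -EFinM lee_fin.
  have := kap2_le dy y0.
  set M := Num.max _ _.
  have M0 : 0 <= M by rewrite le_max lexx.
  have M1 : - ln `|z| <= M by rewrite -lnV ?posrE// le_max lexx orbT.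
  have h1 : ln (y + 1) - ln y <= 1 + M.
    have [y1|y1] := leP y 1.
      have h : ln (y + 1) <= 1.
        by rewrite addrC (le_trans (le_ln1Dx _))// (lt_trans (ltrN10 _)).
      have : ln `|z| <= ln y by rewrite ler_ln.
      by move: M1; lra.
    rewrite -ln_div ?posrE ?addr_gt0// mulrDl mul1r divff ?gt_eqF//.
    have yi : 0 < y^-1 by rewrite invr_gt0.
    apply: le_trans (le_ln1Dx (lt_trans (ltrN10 _) yi)) _.
    by rewrite (@le_trans _ _ 1) ?lerDl// invf_le1// ltW.
  by lra.
- rewrite riesz_kernel3// -EFinD -EFinM lee_fin.
  apply: le_trans (kap3_le _ dy y0) _.
  rewrite ler_wpM2l// -[leLHS]add0r lerD// lerXn2r ?nnegrE ?invr_ge0 ?sqrtr_ge0//.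
  by rewrite lef_pV2 ?posrE ?sqrtr_gt0// ler_wsqrtr.
Qed.

Lemma kap_ge_riesz d n y : (2 <= d)%N -> n.+1%:R^-1 <= y -> 0 < y ->
  (riesz_kernel ((d%:R - 2) / 2) y <= (d%:R * kap d n y 0 + 1)%:E)%E.
Proof.
move=> d2 dy y0; have y_neq0 : y != 0 by rewrite gt_eqF.
have K0 := kap_ge0 d n y 0.
case: d d2 K0 => [//|[//|[|k]]] _ K0.
- rewrite riesz_kernel2// lee_fin gtr0_norm// ge_max; apply/andP; split.
    by rewrite addr_ge0// mulr_ge0.
  have h0 : 0 <= ln (y + 1) by rewrite ln_ge0// lerDr ltW.
  have := kap2_ge n y0; rewrite lnV ?posrE//; lra.
- rewrite riesz_kernel3// lee_fin gtr0_norm//.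
  apply: le_trans (kap3_ge k dy y0) _.
  by rewrite lerD2r ler_wpM2r// ler_nat -addn2 leq_addr.
Qed.

Lemma measurable_riesz_kernel b : measurable_fun setT (@riesz_kernel R b).
Proof.
have [b0|b0] := ltP b 0.
  rewrite (_ : riesz_kernel b = cst 1%E) //.
  by apply/funext => x; rewrite /riesz_kernel b0.
pose g (x : R) : R := if b == 0 then Num.max 0 (ln `|x|^-1) else `|x| `^ (- b).
rewrite (_ : riesz_kernel b = fun x => if x == 0 then +oo%E else (g x)%:E); last first.
  apply/funext => x; rewrite /riesz_kernel ltNge b0/= /g; case: ifP => // _.
  by case: ifP.
apply: measurable_fun_ifT.
- exact: measurable_fun_eqr.
- exact: measurable_cst.
apply/measurable_EFinP; rewrite /g; have [b00|b00] := eqVneq b 0.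
  apply: measurable_maxr => //.
  rewrite (_ : (fun x => _) = fun x => - ln `|x|).
    apply: measurable_funN; apply: (measurableT_comp (@measurable_ln R)).
    exact: normr_measurable.
  apply/funext => x; have [->|x0] := eqVneq x 0; first by rewrite normr0 invr0 ln0// oppr0.
  by rewrite lnV// posrE normr_gt0.
apply: (measurableT_comp (f := fun x => x `^ - b)); first exact: measurable_powR.
exact: normr_measurable.
Qed.

End riesz_kap.

(** * The discrete energy of cell masses against the Riesz energy *)

Section cell_energy.
Context d0 (T : measurableType d0) (R : realType) (P : probability T R).
Variables (X : T -> R) (d n K : nat) (e : R).
Hypotheses (mX : measurable_fun setT X) (e0 : 0 < e).
Local Notation ptn := (pt R n).
Local Notation dl := (n.+1%:R^-1 : R).

Definition cell k : set R := `[ptn k, ptn k.+1[%classic.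

Lemma ptS k : ptn k.+1 = ptn k + dl.
Proof. by rewrite -addn1 ptD [ptn 1]/pt mul1r. Qed.

Lemma cell_inj k k' x : cell k x -> cell k' x -> k = k'.
Proof.
rewrite /cell/= !in_itv/= => /andP[a b] /andP[a' b'].
have lt u v : ptn u < ptn v -> (u < v)%N.
  by apply: contraTltn => vu; rewrite -leNgt le_pt.
have h1 := lt _ _ (le_lt_trans a b'); have h2 := lt _ _ (le_lt_trans a' b).
by apply/eqP; rewrite eqn_leq -ltnS h1 -ltnS h2.
Qed.

Lemma cell_truncn x : 0 <= x -> cell (Num.truncn (x * n.+1%:R)) x.
Proof.
move=> x0; rewrite /cell/= in_itv/= /pt ler_pdivrMr// ltr_pdivlMr//.
by rewrite truncn_itv// mulr_ge0.
Qed.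

Lemma cell_abs k k' x y : cell k x -> cell k' y ->
  `|x - y| <= `|ptn k - ptn k'| + dl /\ `|ptn k - ptn k'| <= `|x - y| + dl.
Proof.
rewrite /cell/= !in_itv/= !ptS => /andP[a b] /andP[a' b'].
have h : `|(x - y) - (ptn k - ptn k')| <= dl.
  move: a b a' b'; move: (n.+1%:R^-1 : R) => c a b a' b'.
  by rewrite ler_norml; apply/andP; split; lra.
split.
  rewrite -lerBlDl; apply: le_trans h; exact: lerB_dist.
rewrite -lerBlDl; apply: le_trans h; rewrite (distrC (x - y)); exact: lerB_dist.
Qed.

(** Cell masses of the law of X: later X is the identity under mu, or the selected zero under the
    conditional law given H. *)
Definition cellw k : R := fine (P (X @^-1` cell k)).

Lemma measurable_cellX k : measurable (X @^-1` cell k).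
Proof. by rewrite -[X in measurable X]setTI; apply: mX => //; exact: measurable_itv. Qed.

Lemma cellw_ge0 k : 0 <= cellw k.
Proof. exact: fine_ge0. Qed.

Lemma cellwE k : cellw k = \int[P]_u \1_(cell k) (X u).
Proof.
rewrite /cellw -Rint_indic; last exact: measurable_cellX.
by apply: eq_Rintegral => u _; rewrite !indicE; congr (nat_of_bool _)%:R;
  apply/idP/idP; rewrite !inE.
Qed.

Lemma bmf_cellX k : bmf (fun u => \1_(cell k) (X u) : R).
Proof.
apply: (@bmf_comp _ _ _ _ _ (\1_(cell k) : R -> R)) => //.
apply: bmf_indic; exact: measurable_itv.
Qed.

Lemma sum_cell x : \sum_(k < K) \1_(cell k) x = ((0 <= x < ptn K)%R)%:R :> R.
Proof.
case: (boolP (0 <= x < ptn K)) => [/andP[x0 xK]|xK].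
  have h := cell_truncn x0; set k := Num.truncn _ in h.
  have kK : (k < K)%N.
    move: h; rewrite /cell/= in_itv/= => /andP[kx _].
    by have := le_lt_trans kx xK; apply: contraTltn => Kk; rewrite -leNgt le_pt.
  rewrite (bigD1 (Ordinal kK))//= indicE mem_set// big1 ?addr0// => i ik.
  rewrite indicE memNset//= => hi; move/eqP: ik; apply; apply/val_inj => /=.
  exact: cell_inj hi h.
rewrite big1// => i _; rewrite indicE memNset//= => hi.
move: hi xK; rewrite /cell/= in_itv/= => /andP[a b] /negP; apply.
by rewrite (le_trans (pt_ge0 _ _ _) a) (lt_le_trans b)// le_pt.
Qed.

Lemma sum_cellw_le1 : \sum_(k < K) cellw k <= 1.
Proof.
under eq_bigr do rewrite cellwE.
rewrite -Rint_sum; last by move=> k; exact: bmf_cellX.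
rewrite -(Rint_cst P 1); apply: Rint_le; last 1 first.
- by move=> u; rewrite sum_cell /=; case: (_ && _); rewrite ?ler01.
- by apply: bmf_sum => k; exact: bmf_cellX.
- exact: bmf_cst.
Qed.

Lemma sum_cellw_ge1 (A : set T) : measurable A -> P A = 1%E ->
  (forall u, A u -> 0 <= X u < ptn K) -> 1 <= \sum_(k < K) cellw k.
Proof.
move=> mA PA hA; under eq_bigr do rewrite cellwE.
rewrite -Rint_sum; last by move=> k; exact: bmf_cellX.
rewrite (_ : 1 = \int[P]_u \1_A u); last by rewrite Rint_indic// PA.
apply: Rint_le; first exact: bmf_indic.
  by apply: bmf_sum => k; exact: bmf_cellX.
move=> u; rewrite sum_cell indicE; case: (boolP (u \in A)) => //.
by rewrite inE => /hA ->.
Qed.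

Let h (z : T * T) : R := \sum_(k < K) \sum_(k' < K)
  \1_(cell k) (X z.1) * \1_(cell k') (X z.2) * kap d n e `|ptn k - ptn k'|.

Let bh1 k k' : bmf (fun z : T * T =>
  \1_(cell k) (X z.1) * \1_(cell k') (X z.2) * kap d n e `|ptn k - ptn k'|).
Proof.
apply: bmfM; last exact: bmf_cst; apply: bmfM.
  exact: (bmf_comp (bmf_cellX k) measurable_fst).
exact: (bmf_comp (bmf_cellX k') measurable_snd).
Qed.

Let bh : bmf h.
Proof. by apply: bmf_sum => k; apply: bmf_sum => k'. Qed.

Lemma energy_cellE : energy d n cellw K e = \int[(P \x P)%E]_z h z.
Proof.
rewrite Rint_sum; last by move=> k; apply: bmf_sum => k'.
apply: eq_bigr => k _; rewrite Rint_sum//; apply: eq_bigr => k' _.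
rewrite Rint_prod1// !cellwE.
transitivity (\int[P]_u (\int[P]_v \1_(cell k') (X v) * kap d n e `|ptn k - ptn k'| *
   \1_(cell k) (X u))).
  by rewrite RintZ; [ring|exact: bmf_cellX].
apply: eq_Rintegral => u _ /=.
rewrite -mulrA mulrC -RintZ; last exact: bmf_cellX.
by apply: eq_Rintegral => v _; ring.
Qed.

Let h_cell u v k k' : (k < K)%N -> (k' < K)%N -> cell k (X u) -> cell k' (X v) ->
  h (u, v) = kap d n e `|ptn k - ptn k'|.
Proof.
move=> kK k'K hk hk'; rewrite /h (bigD1 (Ordinal kK))//= (bigD1 (Ordinal k'K))//=.
rewrite !indicE !mem_set//= !mul1r !big1 ?addr0// => i ik.
  rewrite big1// => j _; rewrite indicE memNset/= ?mul0r// => hi.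
  by move/eqP: ik; apply; apply/val_inj => /=; exact: cell_inj hi hk.
rewrite indicE memNset/= ?mulr0 ?mul0r// => hi.
by move/eqP: ik; apply; apply/val_inj => /=; exact: cell_inj hi hk'.
Qed.

Let find_cell x : 0 <= x < ptn K -> exists2 k, (k < K)%N & cell k x.
Proof.
move=> /andP[x0 xK]; have hx := cell_truncn x0; exists (Num.truncn (x * n.+1%:R)) => //.
move: hx; rewrite /cell/= in_itv/= => /andP[kx _].
by have := le_lt_trans kx xK; apply: contraTltn => Kk; rewrite -leNgt le_pt.
Qed.

Let h_out u v : ~~ ((0 <= X u < ptn K) && (0 <= X v < ptn K)) -> h (u, v) = 0.
Proof.
move=> uv; rewrite /h big1// => k _; rewrite big1// => k' _ /=.
rewrite !indicE; case: (boolP (X u \in cell k)) => [|_]; last by rewrite !mul0r.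
case: (boolP (X v \in cell k')) => [|_]; last by rewrite mulr0 mul0r.
rewrite !inE /cell/= !in_itv/= => /andP[a b] /andP[a' b'].
case/negP: uv; rewrite (le_trans (pt_ge0 _ _ _) a) (le_trans (pt_ge0 _ _ _) a').
by rewrite (lt_le_trans b')/= ?le_pt// (lt_le_trans b) ?le_pt.
Qed.

Lemma kap_shift (e' x : R) : kap d n e' x = kap d n (e' + x) 0.
Proof. by rewrite /kap; under [RHS]eq_bigr do rewrite addr0. Qed.

Lemma measurable_riesz_X b c : measurable_fun setT
  (fun z : T * T => riesz_kernel b (c + `|X z.1 - X z.2|)).
Proof.
apply: (measurableT_comp (measurable_riesz_kernel b)).
apply: measurable_funD => //; apply: measurableT_comp; first exact: normr_measurable.
by apply: measurable_funB; apply: (measurableT_comp mX).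
Qed.

(** Since the mesh is at most e, the grid distance plus e is at least the distance of any two points
    of the cells, and [kap_le_riesz] applies pointwise. *)
Lemma energy_cell_le : (1 <= d)%N -> dl <= e ->
  ((energy d n cellw K e)%:E <= 6%:E * (1 +
    \int[(P \x P)%E]_z riesz_kernel ((d%:R - 2) / 2) (0 + `|X z.1 - X z.2|)%R))%E.
Proof.
move=> d1 de; rewrite energy_cellE EFin_Rintegral//.
set b := (d%:R - 2) / 2.
have mr := measurable_riesz_X b 0.
have r0 z : (0 <= riesz_kernel b (0 + `|X z.1 - X z.2|)%R)%E by exact: riesz_kernel_ge0.
apply: (@le_trans _ _ (\int[(P \x P)%E]_z (6%:E * (1 + riesz_kernel b (0 + `|X z.1 - X z.2|)%R)))%E).
  apply: ge0_le_integral => //.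
  - move=> z _; rewrite lee_fin /h; apply: sumr_ge0 => k _; apply: sumr_ge0 => k' _.
    by rewrite !mulr_ge0 ?kap_ge0// indicE ler0n.
  - by apply/measurable_EFinP; case: bh.
  - by apply: measurable_funeM; apply: emeasurable_funD.
  - move=> [u v] _ /=.
    case: (boolP ((0 <= X u < ptn K) && (0 <= X v < ptn K))) => uv; last first.
      by rewrite h_out// mule_ge0// adde_ge0// riesz_kernel_ge0.
    case/andP: uv => /find_cell[k kK hk] /find_cell[k' k'K hk'].
    rewrite (h_cell kK k'K hk hk') kap_shift add0r.
    apply: kap_le_riesz => //.
    + by rewrite (le_trans de)// lerDl.
    + by rewrite ltr_wpDr.
    + rewrite normr_id; have [h1 _] := cell_abs hk hk'.
      by rewrite (le_trans h1)// addrC lerD2r.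
rewrite ge0_integralZl//; last 2 first.
- by apply: emeasurable_funD.
- by move=> z _; rewrite adde_ge0.
rewrite ge0_integralD//.
rewrite integral_cst// [X in (1 * X)%E](_ : _ = 1%E) ?mule1//.
exact: probability_setT.
Qed.

(** The true distance plus 2e is at least the grid distance plus e, one e paying for the mesh, and
    [kap] is decreasing. *)
Lemma energy_cell_ge : (2 <= d)%N -> dl <= e -> (forall u, 0 <= X u < ptn K) ->
  (\int[(P \x P)%E]_z riesz_kernel ((d%:R - 2) / 2) (e + e + `|X z.1 - X z.2|)%R <=
   (d%:R * energy d n cellw K e + 1)%:E)%E.
Proof.
move=> d2 de XK; rewrite energy_cellE.
have r0 z : (0 <= riesz_kernel ((d%:R - 2) / 2) (e + e + `|X z.1 - X z.2|)%R)%E.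
  exact: riesz_kernel_ge0.
have b' : bmf (fun z => d%:R * h z + 1) by apply: bmfD; [exact: bmfZ|exact: bmf_cst].
have -> : d%:R * \int[(P \x P)%E]_z h z + 1 = \int[(P \x P)%E]_z (d%:R * h z + 1).
  by rewrite RintD ?RintZ ?Rint_cst//; [exact: bmfZ|exact: bmf_cst].
rewrite EFin_Rintegral//.
apply: ge0_le_integral => //.
- exact: measurable_riesz_X.
- by apply/measurable_EFinP; case: b'.
move=> [u v] _ /=.
have [k kK hk] := find_cell (XK u); have [k' k'K hk'] := find_cell (XK v).
rewrite (h_cell kK k'K hk hk').
have y0 : 0 < e + e + `|X u - X v| by rewrite ltr_wpDr// addr_gt0.
apply: le_trans (kap_ge_riesz d2 (_ : dl <= _) y0) _.
  by rewrite (le_trans de)// -addrA lerDl addr_ge0// ltW.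
rewrite lee_fin lerD2r ler_wpM2l//; apply: kap_decr; first by rewrite ltr_wpDr.
rewrite addr0 -addrA lerD2l; have [_ h2] := cell_abs hk hk'.
by apply: le_trans h2 _; rewrite [leLHS]addrC lerD2r.
Qed.

End cell_energy.

(** * Zeros of a continuous field *)

Section quadrant_zeros.
Context (R : realType).
Implicit Types (f : R -> R -> R) (K L : set R).

Definition quadrant_continuous f := forall s t, 0 <= s -> 0 <= t ->
  forall e, 0 < e -> exists2 r, 0 < r & forall s' t', 0 <= s' -> 0 <= t' ->
  `|s - s'| < r -> `|t - t'| < r -> `|f s t - f s' t'| < e.

Definition cidx (n : nat) (x : R) := Num.truncn (x * n.+1%:R).

Lemma cidx_dist n x : 0 <= x -> `|x - pt R n (cidx n x)| <= n.+1%:R^-1.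
Proof.
move=> /(cell_truncn n); rewrite -/(cidx n x) /cell/= in_itv/= ptS => /andP[a b].
by rewrite ger0_norm ?subr_ge0// lerBlDl ltW.
Qed.

Lemma natSinv_small (r : R) : 0 < r -> exists N, forall n, (N <= n)%N -> n.+1%:R^-1 < r.
Proof.
move=> r0; have [N _ h] := near_infty_natSinv_lt (PosNum r0).
by exists N => n /h.
Qed.

Lemma zero_near_grid f s t e : quadrant_continuous f -> 0 <= s -> 0 <= t ->
  f s t = 0 -> 0 < e -> exists N, forall n, (N <= n)%N ->
  `|f (pt R n (cidx n s)) (pt R n (cidx n t))| < e.
Proof.
move=> cf s0 t0 fst e0; have [r r0 h] := cf _ _ s0 t0 _ e0.
have [N hN] := natSinv_small r0; exists N => n /hN nr.
have := h (pt R n (cidx n s)) (pt R n (cidx n t)) (pt_ge0 _ _ _) (pt_ge0 _ _ _).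
rewrite fst sub0r normrN; apply; apply: le_lt_trans nr; exact: cidx_dist.
Qed.

(** The pairs cluster by compactness, and continuity makes the cluster point a zero. Smallness of f
    is assumed at nearby points that may lie outside K and L, as grid points do; the last clause
    serves to locate the least zero. *)
Lemma zero_cluster f K L (x y x' y' : nat -> R) : quadrant_continuous f ->
  compact K -> compact L -> K `<=` `[0, +oo[ -> L `<=` `[0, +oo[ ->
  (forall m, K (x m)) -> (forall m, L (y m)) ->
  (forall m, 0 <= x' m) -> (forall m, 0 <= y' m) ->
  (forall m, `|x m - x' m| <= m.+1%:R^-1) -> (forall m, `|y m - y' m| <= m.+1%:R^-1) ->
  (forall m, `|f (x' m) (y' m)| <= m.+1%:R^-1) ->
  exists s t, [/\ K s, L t, f s t = 0 &
    forall r M, 0 < r -> exists2 m, (M <= m)%N & `|x m - s| < r].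
Proof.
move=> cf cK cL K0 L0 Kx Ly x'0 y'0 xx' yy' fm.
have [|[s t] [[/= Ks Lt] cl]] := @compact_setX _ _ _ _ cK cL ((x m, y m) @[m --> \oo]) _.
  by exists 0%N => // m _; split => /=.
have {}cl r M : 0 < r -> exists m, [/\ (M <= m)%N, `|s - x m| < r & `|t - y m| < r].
  move=> r0.
  have h1 : ((x m, y m) @[m --> \oo]) [set (x m, y m) | m in [set m | (M <= m)%N]].
    by exists M => // m /= Mm; exists m.
  have h2 : nbhs (s, t) (ball (s, t) r) by exact: nbhsx_ballx.
  have [z [[m /= Mm <-] [/= h3 h4]]] := cl _ _ h1 h2.
  by exists m; split.
have s0 : 0 <= s by move/K0: Ks; rewrite /= in_itv/= andbT.
have t0 : 0 <= t by move/L0: Lt; rewrite /= in_itv/= andbT.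
exists s, t; split=> //; last first.
  by move=> r M /(cl _ M)[m [Mm h _]]; exists m => //; rewrite distrC.
apply/eqP; rewrite -normr_le0 leNgt; apply/negP => fst.
have e0 : 0 < `|f s t| / 2 by rewrite divr_gt0.
have [r r0 h] := cf _ _ s0 t0 _ e0.
have r20 : 0 < r / 2 by rewrite divr_gt0.
have rm : 0 < Num.min (r / 2) (`|f s t| / 2) by rewrite lt_min r20.
have [N hN] := natSinv_small rm.
have [m [Nm sx ty]] := cl _ N r20.
have := hN _ Nm; rewrite lt_min => /andP[m1 m2].
have h' : `|f s t - f (x' m) (y' m)| < `|f s t| / 2.
  apply: h => //.
  - rewrite (_ : s - x' m = (s - x m) + (x m - x' m)); last by ring.
    apply: le_lt_trans (ler_normD _ _) _; rewrite [ltRHS](splitr r).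
    by apply: ltrD => //; exact: le_lt_trans (xx' m) m1.
  - rewrite (_ : t - y' m = (t - y m) + (y m - y' m)); last by ring.
    apply: le_lt_trans (ler_normD _ _) _; rewrite [ltRHS](splitr r).
    by apply: ltrD => //; exact: le_lt_trans (yy' m) m1.
have : `|f s t| < `|f s t|.
  rewrite {1}(_ : f s t = (f s t - f (x' m) (y' m)) + f (x' m) (y' m)); last by ring.
  apply: le_lt_trans (ler_normD _ _) _; rewrite [ltRHS]splitr.
  by apply: ltrD => //; exact: le_lt_trans (fm m) m2.
by rewrite ltxx.
Qed.

Definition zero_on f K L := exists2 s, K s & exists2 t, L t & f s t = 0.

(* The grid criterion exhibits the hitting event as a countable combination of
   events about single values of the field. *)
Lemma zero_onP f K L : quadrant_continuous f -> compact K -> compact L ->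
  K `<=` `[0, +oo[ -> L `<=` `[0, +oo[ ->
  zero_on f K L <-> forall m, exists n, (m <= n)%N /\ exists k l,
    [/\ exists2 x, K x & cell n k x, exists2 y, L y & cell n l y &
        `|f (pt R n k) (pt R n l)| <= m.+1%:R^-1].
Proof.
move=> cf cK cL K0 L0; split=> [[s Ks [t Lt fst]] m|h].
  have s0 : 0 <= s by move/K0: (Ks); rewrite /= in_itv/= andbT.
  have t0 : 0 <= t by move/L0: (Lt); rewrite /= in_itv/= andbT.
  have m0 : 0 < m.+1%:R^-1 :> R by rewrite invr_gt0.
  have [N hN] := zero_near_grid cf s0 t0 fst m0.
  exists (maxn m N); split; first exact: leq_maxl.
  exists (cidx (maxn m N) s), (cidx (maxn m N) t); split.
  - by exists s => //; exact: cell_truncn.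
  - by exists t => //; exact: cell_truncn.
  - by rewrite ltW// hN// leq_maxr.
have {}h m : exists q : R * R * (R * R), [/\ K q.1.1, L q.1.2 &
   [/\ 0 <= q.2.1, 0 <= q.2.2, `|q.1.1 - q.2.1| <= m.+1%:R^-1, `|q.1.2 - q.2.2| <= m.+1%:R^-1 &
     `|f q.2.1 q.2.2| <= m.+1%:R^-1]].
  have [n [mn [k [l [[x Kx kx] [y Ly ly] fkl]]]]] := h m.
  have dl : n.+1%:R^-1 <= m.+1%:R^-1 :> R by rewrite lef_pV2 ?posrE// ler_nat ltnS.
  exists ((x, y), (pt R n k, pt R n l)); split=> //=; split=> //; rewrite ?pt_ge0//.
  - apply: le_trans dl; move: kx; rewrite /cell/= in_itv/= ptS => /andP[a b].
    by rewrite ger0_norm ?subr_ge0// lerBlDl ltW.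
  - apply: le_trans dl; move: ly; rewrite /cell/= in_itv/= ptS => /andP[a b].
    by rewrite ger0_norm ?subr_ge0// lerBlDl ltW.
have [q hq] := choice h.
have [|||||||s [t [Ks Lt fst _]]] := zero_cluster cf cK cL K0 L0
  (x := fun m => (q m).1.1) (y := fun m => (q m).1.2)
  (x' := fun m => (q m).2.1) (y' := fun m => (q m).2.2);
  try by move=> m; case: (hq m) => ? ? [].
by exists s => //; exists t.
Qed.

(** Zeros whose first coordinates tend to the infimum cluster at a zero that attains it. *)
Lemma first_zero f K L : quadrant_continuous f -> compact K -> compact L ->
  K `<=` `[0, +oo[ -> L `<=` `[0, +oo[ -> zero_on f K L ->
  exists s, [/\ K s, exists2 t, L t & f s t = 0 &
    forall s' t, K s' -> L t -> f s' t = 0 -> s <= s'].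
Proof.
move=> cf cK cL K0 L0 [s1 Ks1 z1].
pose Z := [set s | K s /\ exists2 t, L t & f s t = 0].
have Zinf : has_inf Z.
  split; first by exists s1.
  by exists 0 => s [/K0]; rewrite /= in_itv/= andbT.
have h m : exists q : R * R, [/\ K q.1, L q.2, f q.1 q.2 = 0 & q.1 < inf Z + m.+1%:R^-1].
  have m0 : 0 < m.+1%:R^-1 :> R by rewrite invr_gt0.
  have [s [Ks [t Lt fst]] sl] := inf_adherent m0 Zinf.
  by exists (s, t).
have [q hq] := choice h.
have p1 m : 0 <= (q m).1 by case: (hq m) => /K0; rewrite /= in_itv/= andbT.
have p2 m : 0 <= (q m).2 by case: (hq m) => _ /L0; rewrite /= in_itv/= andbT.
have [|||||||s [t [Ks Lt fst cl]]] := zero_cluster cf cK cL K0 L0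
  (x := fun m => (q m).1) (y := fun m => (q m).2)
  (x' := fun m => (q m).1) (y' := fun m => (q m).2);
  try by move=> m; rewrite ?subrr ?normr0 ?invr_ge0 ?ler0n//; case: (hq m).
  by move=> m; case: (hq m) => _ _ -> _; rewrite normr0 invr_ge0.
have lb s' : Z s' -> inf Z <= s' by move=> Zs'; apply: ge_inf => //; case: Zinf.
exists s; split=> //; first by exists t.
move=> s' t' Ks' Lt' fs't'; apply: (@le_trans _ _ (inf Z)); last by apply: lb; split=> //; exists t'.
apply/ler_addgt0Pr => e e0.
have [N hN] := natSinv_small (divr_gt0 e0 (ltr0n R 2)).
have [m Nm sm] := cl _ N (divr_gt0 e0 (ltr0n R 2)).
have := hN _ Nm; case: (hq m) => _ _ _; move: sm (m.+1%:R^-1 : R) => + c.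
by rewrite ltr_norml => /andP[a _] b cc; move: (splitr e) => se; lra.
Qed.

End quadrant_zeros.

Section zero_events.
Context (R : realType) d0 (T : measurableType d0) (f : R -> R -> T -> R).
Hypotheses (mf : forall s t, measurable_fun setT (f s t))
  (cf : forall w, quadrant_continuous (fun s t => f s t w)).
Variables (K L : set R).
Hypotheses (cK : compact K) (cL : compact L).
Hypotheses (K0 : K `<=` `[0, +oo[) (L0 : L `<=` `[0, +oo[).

Lemma measurable_zero_on : measurable [set w | zero_on (fun s t => f s t w) K L].
Proof.
pose A m n k l := [set w : T | [/\ exists2 x, K x & cell n k x, exists2 y, L y & cell n l y &
        `|f (pt R n k) (pt R n l) w| <= m.+1%:R^-1]].
have mA m n k l : measurable (A m n k l).
  have [[h1 h2]|h] := pselect ((exists2 x, K x & cell n k x) /\ (exists2 y, L y & cell n l y)).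
    rewrite (_ : A m n k l = setT `&` (fun w => `|f (pt R n k) (pt R n l) w|) @^-1` `]-oo, m.+1%:R^-1]).
      apply: measurableT_comp => //; exact: measurable_itv.
    apply/seteqP; split=> w; rewrite /A/= in_itv/=; first by case.
    by case=> _ ?; split.
  rewrite (_ : A m n k l = set0); first exact: measurable0.
  by apply/seteqP; split=> w // [? ? _]; apply: h.
rewrite (_ : [set w | _] = \bigcap_m \bigcup_(n in [set n | (m <= n)%N]) \bigcup_k \bigcup_l A m n k l).
  apply: bigcap_measurable => // m _; apply: bigcup_measurable => n _.
  by apply: bigcup_measurable => k _; apply: bigcup_measurable => l _; exact: mA.
apply/seteqP; split=> w /=.
  move/(zero_onP (cf w) cK cL K0 L0) => h m _.
  have [n [mn [k [l hh]]]] := h m.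
  by exists n => //; exists k => //; exists l.
move=> h; apply/(zero_onP (cf w) cK cL K0 L0) => m.
have [n /= mn [k _ [l _ hh]]] := h m I.
by exists n; split=> //; exists k, l.
Qed.

End zero_events.

Section zero_selection.
Context (R : realType) d0 (T : measurableType d0) (f : R -> R -> T -> R).
Hypotheses (mf : forall s t, measurable_fun setT (f s t))
  (cf : forall w, quadrant_continuous (fun s t => f s t w)).
Variables (K L : set R).
Hypotheses (cK : compact K) (cL : compact L).
Hypotheses (K0 : K `<=` `[0, +oo[) (L0 : L `<=` `[0, +oo[).

(* The least zero is selected: its distribution function is a hitting event. *)
Lemma zero_selection : K !=set0 -> exists X : T -> R, [/\ measurable_fun setT X,
  forall w, K (X w) & forall w, zero_on (fun s t => f s t w) K L ->
    exists2 t, L t & f (X w) t w = 0].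
Proof.
move=> [f0 Kf0].
have h w : exists s, [/\ K s, zero_on (fun s t => f s t w) K L ->
      (exists2 t, L t & f s t w = 0) /\ forall s' t, K s' -> L t -> f s' t w = 0 -> s <= s' &
    ~ zero_on (fun s t => f s t w) K L -> s = f0].
  have [z|z] := pselect (zero_on (fun s t => f s t w) K L).
    have [s [Ks s1 s2]] := first_zero (cf w) cK cL K0 L0 z.
    by exists s; split.
  (* Off the hitting event the value is a fixed point of K, so that X lies in K everywhere. *)
  by exists f0; split.
have [X hX] := choice h.
exists X; split; last 2 first.
- by move=> w; case: (hX w).
- by move=> w z; case: (hX w) => _ /(_ z)[].
suff mX c : measurable [set w | X w <= c].
  apply: (@measurability _ _ T R setT X (@RGenOInfty.G R)
      (RGenOInfty.measurableE R)) => //= _ [_ [a ->] <-].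
  rewrite setTI (_ : _ @^-1` _ = ~` [set w | X w <= a]); first exact: measurableC.
  by apply/seteqP; split=> w /=; rewrite in_itv/= andbT ltNge => /negP.
have Kc : compact (K `&` `]-oo, c]).
  by apply: compact_closedI => //; exact: interval_closed.
have mz := measurable_zero_on mf cf Kc cL (subset_trans (@subIsetl _ _ _) K0) L0.
have mz' := measurable_zero_on mf cf cK cL K0 L0.
rewrite (_ : [set w | X w <= c] = [set w | zero_on (fun s t => f s t w) (K `&` `]-oo, c]) L] `|`
  (~` [set w | zero_on (fun s t => f s t w) K L] `&` [set w | f0 <= c])); last first.
  apply/seteqP; split=> w /=.
    move=> Xc; have [z|z] := pselect (zero_on (fun s t => f s t w) K L).
      left; case: (hX w) => KX /(_ z)[[t Lt ft] _] _.
      by exists (X w); [split=> //=; rewrite in_itv|exists t].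
    by right; split=> //; case: (hX w) => _ _ /(_ z) <-.
  case=> [[s [Ks /= sc] [t Lt ft]]|[z f0c]].
    case: (hX w) => _ h' _; case: h'; first by exists s => //; exists t.
    move=> _ /(_ _ _ Ks Lt ft) Xs; apply: le_trans Xs _.
    by move: sc; rewrite in_itv.
  by case: (hX w) => _ _ /(_ z) ->.
apply: measurableU => //; apply: measurableI; first exact: measurableC.
case: (boolP (f0 <= c)) => f0c.
  by rewrite (_ : [set w | _] = setT)//; apply/seteqP; split.
by rewrite (_ : [set w | _] = set0)//; apply/seteqP; split.
Qed.

End zero_selection.

Section squared_norm.
Context (R : realType) (d : nat) d0 (T : measurableType d0) (P : probability T R).
Variable (B : 'I_d -> R -> R -> T -> R).
Hypothesis BP : brownian_sheet P B.

(** A scalar continuous field with the zeros of the vector-valued sheet, as the selection of zeros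
    requires. *)
Definition sqnorm s t w : R := \sum_(q < d) B q s t w ^+ 2.

Lemma sqnorm_ge0 s t w : 0 <= sqnorm s t w.
Proof. by apply: sumr_ge0 => q _; exact: sqr_ge0. Qed.

Lemma sqnorm_eq0 s t w : sqnorm s t w = 0 <-> forall q, B q s t w = 0.
Proof.
split=> [/eqP|h]; last by rewrite /sqnorm big1// => q _; rewrite h expr0n.
rewrite psumr_eq0 => [/allP h q|q _]; last exact: sqr_ge0.
by have := h q (mem_index_enum _); rewrite sqrf_eq0 => /eqP.
Qed.

Lemma measurable_sqnorm s t : measurable_fun setT (sqnorm s t).
Proof.
case: BP => mB _ _; apply: measurable_sum => q; apply: measurable_funX; exact: mB.
Qed.

Lemma quadrant_continuous_sqnorm w : quadrant_continuous (fun s t => sqnorm s t w).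
Proof.
case: BP => _ cB _ s t s0 t0 e e0.
set A := [set st : R * R | 0 <= st.1 /\ 0 <= st.2].
have As : A (s, t) by split.
have h q : B q st.1 st.2 w @[st --> within A (nbhs (s, t))] --> B q s t w.
  by have := cB w q => /subspace_continuousP/(_ _ As).
have : sqnorm st.1 st.2 w @[st --> within A (nbhs (s, t))] --> sqnorm s t w.
  rewrite /sqnorm; apply: cvg_big => [|q _]; first exact: add_continuous.
  by under eq_fun do rewrite expr2; rewrite expr2; apply: cvgM; exact: h.
move/cvgrPdist_lt => /(_ _ e0).
rewrite near_withinE => /nbhs_ballP[r /= r0 hr].
exists r => // s' t' s'0 t'0 ss tt.
by apply: (hr (s', t')); split.
Qed.

End squared_norm.

(** * From hitting to finite energy and back *)

Section conditioning.
Context d0 (T : measurableType d0) (R : realType) (P : probability T R).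

Lemma conditional_probability (H : set T) : measurable H -> (0 < P H)%E ->
  exists PH : probability T R, forall A, measurable A ->
    fine (P H) * fine (PH A) = fine (P (H `&` A)).
Proof.
move=> mH PH0; exists (mnormalize (mrestr P mH) P) => A mA /=.
have PHfin : P H \is a fin_num by exact: fin_num_measure.
have PAfin : P (A `&` H) \is a fin_num by apply: fin_num_measure; exact: measurableI.
rewrite /mnormalize /= /mrestr setTI (gt_eqF PH0)/=.
rewrite (lt_eqF (_ : P H < +oo)%E) ?ltey_eq ?PHfin//.
rewrite fineM// mulrCA divff ?mulr1 1?setIC//.
by rewrite gt_eqF// fine_gt0// PH0 ltey_eq PHfin.
Qed.

End conditioning.

Section cidx.
Context (R : realType).
Implicit Types x y : R.

Lemma le_cidx n x y : 0 <= x -> x <= y -> (cidx n x <= cidx n y)%N.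
Proof. by move=> x0 xy; apply: le_truncn; rewrite ler_wpM2r. Qed.

Lemma cidxDn n x : 0 <= x -> cidx n (x + 1) = (cidx n x + n.+1)%N.
Proof.
move=> x0; apply: (@cell_inj R n _ _ (x + 1)).
  by apply: cell_truncn; rewrite addr_ge0.
have := cell_truncn n x0; rewrite -/(cidx n x) /cell/= !in_itv/=.
by rewrite -addSn !ptD ptN lerD2r ltrD2r.
Qed.

End cidx.

(** * Hitting bounds the discrete energies uniformly *)

Section hitting_energy.
Context (R : realType) (d : nat) d0 (T : measurableType d0) (P : probability T R).
Variable (B : 'I_d -> R -> R -> T -> R).
Hypothesis BP : brownian_sheet P B.
Variables (H : set T) (X : T -> R) (a b p : R).
Hypotheses (mH : measurable H) (mX : measurable_fun setT X).
Hypotheses (a0 : 0 < a) (p0 : 0 < p) (Xab : forall w, a <= X w <= b).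
Hypothesis HX : forall w, H w -> exists2 t, p <= t <= p + 1 & sqnorm B (X w) t w = 0.
Variable (PH : probability T R).
Hypotheses (PH0 : 0 < fine (P H))
  (PHE : forall A, measurable A -> fine (P H) * fine (PH A) = fine (P (H `&` A))).

(** The grid detects the zero: in the cell of X some grid time has squared norm at most e, the
    condition under which [cairoli] bounds W from below. *)
Definition seen (e : R) n : set T := [set w | exists i j, [/\ cell n i (X w),
  (cidx n p <= j <= cidx n p + n.+1)%N & sqnorm B (pt R n i) (pt R n j) w <= e]].

Lemma measurable_seen e n : measurable (seen e n).
Proof.
rewrite (_ : seen e n = \bigcup_i \bigcup_(j in [set j | (cidx n p <= j <= cidx n p + n.+1)%N])
  (X @^-1` cell n i `&` [set w | sqnorm B (pt R n i) (pt R n j) w <= e])).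
  apply: bigcup_measurable => i _; apply: bigcup_measurable => j _; apply: measurableI.
    by rewrite -[X in measurable X]setTI; apply: mX => //; exact: measurable_itv.
  rewrite (_ : [set w | _] = setT `&` sqnorm B (pt R n i) (pt R n j) @^-1` `]-oo, e]).
    by apply: (measurable_sqnorm BP) => //; exact: measurable_itv.
  by rewrite setTI; apply/seteqP; split=> w /=; rewrite in_itv.
apply/seteqP; split=> w.
  by move=> [i [j [h1 h2 h3]]]; exists i => //; exists j.
by move=> [i _ [j /= h2 [h1 h3]]]; exists i, j.
Qed.

Lemma eventually_seen e w : 0 < e -> H w -> exists N, forall n, (N <= n)%N -> seen e n w.
Proof.
move=> e0 /HX[t /andP[pt1 pt2] st].
have X0 : 0 <= X w by case/andP: (Xab w) => /(lt_le_trans a0)/ltW.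
have t0 : 0 <= t by rewrite (le_trans _ pt1)// ltW.
have [N hN] := zero_near_grid (quadrant_continuous_sqnorm BP w) X0 t0 st e0.
exists N => n Nn; exists (cidx n (X w)), (cidx n t); split.
- exact: cell_truncn.
- rewrite le_cidx ?(ltW p0)//= -cidxDn ?(ltW p0)//; apply: le_cidx => //.
- by have := hN _ Nn; rewrite ger0_norm ?sqnorm_ge0// => /ltW.
Qed.

Lemma unseen_small e eps : 0 < e -> 0 < eps -> exists N, forall n, (N <= n)%N ->
  \int[P]_w \1_(H `\` seen e n) w <= eps.
Proof.
move=> e0 eps0.
have : \int[P]_w \1_(H `\` seen e n) w @[n --> \oo] --> \int[P]_w (cst 0 w : R).
  apply: (@Rint_cvg _ _ _ P _ _ 1).
  - move=> n; apply: measurable_indic; apply: measurableD => //; exact: measurable_seen.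
  - by move=> n w; rewrite indicE; case: (_ \in _); rewrite ?normr0 ?normr1.
  - move=> w; apply: cvg_near_cst.
    have [Hw|Hw] := pselect (H w); last first.
      by near=> n; rewrite indicE memNset// => -[].
    have [N hN] := eventually_seen e0 Hw.
    exists N => // n /= Nn; rewrite indicE memNset//= => -[_]; apply; exact: hN.
rewrite (_ : \int[P]_w cst 0 w = 0); last by rewrite (Rint_cst P 0).
move/cvgrPdist_le => /(_ _ eps0)[N _ hN]; exists N => n /hN /=.
by rewrite sub0r normrN => /(le_trans (ler_norm _)).
Unshelve. all: by end_near. Qed.

(** The averaged potential Q occurs on both sides: on the left through [f], on the right through the
    second moment of W. Young's inequality makes the second occurrence half of the first, and it is
    absorbed. M is fixed before e; only the required mesh depends on e. *)
Lemma energy_bounded : exists M, forall e, 0 < e -> exists N, forall n, (N <= n)%N ->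
  energy d n (cellw PH X n) (cidx n b).+1 e <= M.
Proof.
(* A mesh at most c loses at most half of a or p, so charged grid points keep both coordinates above
   c. *)
pose c := Num.min (p / 2) (Num.min (a / 2) 1).
have c0 : 0 < c by rewrite !lt_min !divr_gt0//=.
(* An upper bound for all coordinates: s is at most b and the times end before p + 2. *)
pose C := Num.max 1 (Num.max b (p + 2)).
have C0 : 0 < C by rewrite lt_max ltr01.
pose c1 := expR (- 2^-1) * gker d C.
have c10 : 0 < c1 by rewrite mulr_gt0 ?expR_gt0 ?gker_gt0.
pose g := gker d (c ^+ 3); have g0 : 0 < g by rewrite gker_gt0 ?exprn_gt0.
pose pH := fine (P H); have pH0 : 0 < pH by exact: PH0.
(* With 128 = 16 * 8 from [cairoli] and [Rint_zfun2_le], this weight makes 128 g (2 Q) / (4 la)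
   equal to half of c1 pH Q. *)
pose la := 128 * g / (c1 * pH).
have la0 : 0 < la by apply: divr_gt0; apply: mulr_gt0.
pose M := 2 * (2 * (la + c1) / (c1 * pH)).
exists M => e e0.
have ge0' := gker_gt0 d e0.
have ie0 : 0 < (gker d e)^-1 by rewrite invr_gt0.
(* The unseen part of H is made small enough to offset the crude bound [gker d e] of the
   potential. *)
have [N1 hN1] := unseen_small e0 ie0.
have [N2 hN2] := natSinv_small c0.
exists (maxn N1 N2) => n; rewrite geq_max => /andP[/hN1 bad /hN2/ltW dc].
set K := (cidx n b).+1; set w := cellw PH X n; set L0 := cidx n p.
have b0 : 0 <= b.
  by case/andP: (Xab point) => h1 h2; rewrite (le_trans (ltW a0))// (le_trans h1).
have w0 k : 0 <= w k by exact: cellw_ge0.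
(* The potential at the cell of X, on H. As w is the law of X given H, its mean is pH times the
   w-average of the potential. *)
pose f om : R := \sum_(i < K) \1_H om * \1_(cell n i) (X om) * rpot d n w K e i.
have bHc i : bmf (fun om => \1_H om * \1_(cell n i) (X om) : R).
  by apply: bmfM; [exact: bmf_indic|exact: bmf_cellX].
have bf : bmf f by apply: bmf_sum => i; apply: bmfM => //; exact: bmf_cst.
have fE : \int[P]_om f om = pH * \sum_(i < K) w i * rpot d n w K e i.
  rewrite /f Rint_sum; last by move=> i; apply: bmfM => //; exact: bmf_cst.
  rewrite mulr_sumr; apply: eq_bigr => i _.
  transitivity (\int[P]_om (rpot d n w K e i * (\1_H om * \1_(cell n i) (X om)))).
    by apply: eq_Rintegral => om _; rewrite mulrC.
  rewrite RintZ// mulrC mulrA; congr (_ * _).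
  have mc : measurable (X @^-1` cell n i).
    by rewrite -[X in measurable X]setTI; apply: mX => //; exact: measurable_itv.
  rewrite /w /cellw PHE// -Rint_indic; last exact: measurableI.
  apply: eq_Rintegral => om _; by rewrite indicI.
have [W [bW W2 Wge]] := cairoli n (sheet_law_gaussian BP) K L0 w0 e0.
have bWs : bmf (W \o sheet_map B).
  by apply: (bmf_comp bW); exact: measurable_sheet_map BP.
have W2s : \int[P]_om (W (sheet_map B om) ^+ 2) <= 128 * g * energy d n w K e.
  rewrite -(Rint_sheet_law BP (bmfX 2 bW)); apply: le_trans W2 _.
  have -> : 128 * g * energy d n w K e = 16 * (8 * g * energy d n w K e) by ring.
  rewrite ler_pM2l//; apply: (Rint_zfun2_le (sheet_law_gaussian BP) w0 e0) => //.
  - by rewrite c0 !ge_min lexx !orbT.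
  - move=> k kK wk; move: wk; apply: contraNT; rewrite -ltNge => kc.
    rewrite /w /cellw (_ : X @^-1` _ = set0) ?measure0//.
    rewrite -subset0 => om /=; rewrite /cell/= in_itv/= ptS => /andP[_ Xk].
    have /andP[aX _] := Xab om.
    have c2a : c <= a / 2 by rewrite !ge_min lexx !orbT.
    have := lt_le_trans Xk (lerD (ltW kc) dc); rewrite ltNge => /negP; apply.
    by apply: le_trans aX; rewrite [leRHS]splitr lerD.
  - have c2p : c <= p / 2 by rewrite !ge_min lexx.
    have := cell_truncn n (ltW p0); rewrite -/(cidx n p) /cell/= in_itv/= ptS => /andP[_ h].
    rewrite -/L0 in h; move: c2p dc h (splitr p).
    move: (pt R n L0) (n.+1%:R^-1 : R) (p / 2) {hN2} (c) => q u p2 c'.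
    by move=> *; lra.
have ptC k : (k < K)%N -> pt R n k <= C.
  rewrite ltnS => kb; apply: le_trans (le_pt R n kb) _.
  have := cell_truncn n b0; rewrite -/(cidx n b) /cell/= in_itv/= => /andP[h _].
  by rewrite !le_max h orbT.
have ptC' : pt R n (L0 + (n.+1 + n.+1)) <= C.
  have := cell_truncn n (ltW p0); rewrite -/(cidx n p) -/L0 /cell/= in_itv/= => /andP[h _].
  by rewrite !ptD ptN !le_max -[2]/(1 + 1)%R lerD2r h !orbT.
have r0 i : 0 <= rpot d n w K e i by exact: rpot_ge0.
(* Outside H the left side vanishes; where the zero is seen, W dominates it and y <= la + y^2 / (4
   la); elsewhere the crude bound of the potential applies. *)
have pw om : c1 * f om <= la + (4 * la)^-1 * W (sheet_map B om) ^+ 2 +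
    c1 * gker d e * \1_(H `\` seen e n) om.
  have x0 : 0 <= la + (4 * la)^-1 * W (sheet_map B om) ^+ 2.
    by rewrite addr_ge0 ?(ltW la0)// mulr_ge0 ?sqr_ge0// invr_ge0 mulr_ge0// ltW.
  have y0 : 0 <= c1 * gker d e by rewrite mulr_ge0// ltW.
  have [Hom|Hom] := pselect (H om); last first.
    rewrite /f big1 => [|i _]; last by rewrite indicE memNset// !mul0r.
    by rewrite mulr0 addr_ge0// mulr_ge0// indicE ler0n.
  have X0 : 0 <= X om by case/andP: (Xab om) => /(lt_le_trans a0)/ltW.
  have iK : (cidx n (X om) < K)%N.
    by rewrite ltnS le_cidx//; case/andP: (Xab om).
  have cX : cell n (cidx n (X om)) (X om) by exact: cell_truncn.
  have -> : f om = rpot d n w K e (cidx n (X om)).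
    rewrite /f (bigD1 (Ordinal iK))//= indicE mem_set// mul1r indicE mem_set// mul1r.
    rewrite big1 ?addr0// => i ik; rewrite [\1_(cell _ _) _]indicE memNset ?mulr0 ?mul0r//=.
    by move=> hi; move/eqP: ik; apply; apply/val_inj => /=; exact: cell_inj hi cX.
  have [[i [j [iX jL sq]]]|ns] := pselect (seen e n om).
    rewrite -(cell_inj cX iX) in sq.
    have hW : c1 * rpot d n w K e (cidx n (X om)) <= W (sheet_map B om).
      apply: (Wge _ j) => //; first by rewrite le_max lexx.
      by rewrite /sheet_map !ger0_norm ?pt_ge0.
    apply: (le_trans hW); apply: (@le_trans _ _ (la + (4 * la)^-1 * W (sheet_map B om) ^+ 2)).
      rewrite -subr_ge0; set y := W _.
      have -> : la + (4 * la)^-1 * y ^+ 2 - y = (4 * la)^-1 * (y - 2 * la) ^+ 2.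
        by field; rewrite gt_eqF.
      by rewrite mulr_ge0 ?sqr_ge0// invr_ge0 mulr_ge0// ltW.
    by rewrite lerDl mulr_ge0// indicE ler0n.
  rewrite indicE mem_set// mulr1.
  apply: (@le_trans _ _ (c1 * gker d e)); last by rewrite lerDr.
  rewrite ler_pM2l//; apply: le_trans (rpot_le d n K w0 e0 _) _.
  by rewrite ler_piMr ?(ltW ge0')//; exact: sum_cellw_le1.
have iD : bmf (\1_(H `\` seen e n) : T -> R).
  by apply: bmf_indic; apply: measurableD => //; exact: measurable_seen.
have := Rint_le P (bmfZ c1 bf) (bmfD (bmfD (bmf_cst _ la) (bmfZ (4 * la)^-1 (bmfX 2 bWs)))
  (bmfZ (c1 * gker d e) iD)) pw.
set En := energy d n w K e; set Q := \sum_(i < K) w i * rpot d n w K e i in fE.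
have bs := bmfZ (4 * la)^-1 (bmfX 2 bWs).
have -> : \int[P]_x (la + (4 * la)^-1 * (W \o sheet_map B) x ^+ 2 +
      c1 * gker d e * \1_(H `\` seen e n) x) =
    la + (4 * la)^-1 * \int[P]_x ((W \o sheet_map B) x ^+ 2) +
    c1 * gker d e * \int[P]_x \1_(H `\` seen e n) x.
  rewrite RintD; [|exact: (bmfD (bmf_cst _ la) bs)|exact: bmfZ].
  rewrite RintD//; last exact: bmf_cst.
  by rewrite (Rint_cst P la) !RintZ//; exact: bmfX.
rewrite (RintZ P c1 bf) fE => h.
have EQ : En <= 2 * Q by exact: energy_le_rpot.
have h1 : (4 * la)^-1 * \int[P]_x ((W \o sheet_map B) x ^+ 2) <= c1 * pH / 2 * Q.
  have -> : c1 * pH / 2 * Q = (4 * la)^-1 * (128 * g * (2 * Q)).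
    by rewrite /la; field; rewrite !gt_eqF.
  have la4 : 0 < (4 * la)^-1 by rewrite invr_gt0; apply: mulr_gt0.
  have g128 : 0 < 128 * g by apply: mulr_gt0.
  rewrite (ler_pM2l la4); apply: (le_trans W2s).
  by rewrite (ler_pM2l g128).
have h2 : c1 * gker d e * \int[P]_x \1_(H `\` seen e n) x <= c1.
  rewrite -[leRHS](mulfK (lt0r_neq0 ge0')).
  by rewrite (ler_pM2l (mulr_gt0 c10 ge0')); exact: bad.
have h3 : c1 * pH / 2 * Q <= la + c1.
  have : c1 * (pH * Q) <= la + c1 * pH / 2 * Q + c1.
    by apply: (le_trans h); apply: lerD h2; apply: lerD h1.
  have -> : c1 * (pH * Q) = c1 * pH / 2 * Q + c1 * pH / 2 * Q by field.
  by move: (c1 * pH / 2 * Q) => z; lra.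
apply: le_trans EQ _; rewrite /M ler_pM2l//.
rewrite (ler_pdivlMr _ _ (mulr_gt0 c10 pH0)).
have -> : Q * (c1 * pH) = 2 * (c1 * pH / 2 * Q) by field.
by rewrite ler_pM2l.
Qed.

End hitting_energy.

(** * Removing the regularisation of the kernel *)

Section riesz_limits.
Context (R : realType).
Implicit Types (b z : R).

(** The kernel as a function of v = ln z, continuous on the whole line, so that the logarithmic and
    power cases share one limit argument. *)
Definition riesz_log b (v : R) : R :=
  if b == 0 then (- v + `|v|) / 2 else expR (- (b * v)).

Lemma riesz_kernel_log b z : 0 <= b -> 0 < z -> riesz_kernel b z = (riesz_log b (ln z))%:E.
Proof.
move=> b0 z0; rewrite /riesz_kernel ltNge b0/= gt_eqF// gtr0_norm// /riesz_log.
case: eqP => [_|_].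
  by rewrite lnV ?posrE// maxr_absE add0r sub0r opprK.
by rewrite /powR gt_eqF// mulNr.
Qed.

Lemma continuous_riesz_log b : continuous (riesz_log b).
Proof.
move=> v; rewrite /riesz_log; case: (b == 0).
  apply: cvgM; last exact: cvg_cst.
  by apply: cvgD; [apply: cvgN; exact: cvg_id|apply: cvg_norm; exact: cvg_id].
apply: (@continuous_comp _ _ _ (fun v => - (b * v)) expR); last exact: continuous_expR.
by apply: cvgN; apply: cvgM; [exact: cvg_cst|exact: cvg_id].
Qed.

Lemma riesz_kernel_cvg b z (u : nat -> R) : 0 <= b -> 0 <= z -> (forall n, 0 < u n) ->
  u n @[n --> \oo] --> (0 : R) ->
  riesz_kernel b (u n + z) @[n --> \oo] --> riesz_kernel b z.
Proof.
move=> b0; rewrite le_eqVlt => /predU1P[<-|z0] u0 cu.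
  under eq_fun do rewrite addr0 riesz_kernel_log//.
  rewrite riesz_kernel0//; apply/cvgeyPge => A.
  (* Chosen so that ln (u n) <= -m makes the kernel at least |A| in either case. *)
  pose m := if b == 0 then `|A| else `|A| / b.
  have m0 : 0 <= m by rewrite /m; case: eqP => // _; rewrite divr_ge0.
  have [N _ hN] := (cvgr0_norm_lt (u : nat -> R^o) cu _ (expR_gt0 (- m))).
  exists N => // n /hN /=; rewrite gtr0_norm// => /ltW um; rewrite lee_fin.
  have lm : ln (u n) <= - m by rewrite -(expRK (- m)) ler_ln ?posrE ?expR_gt0.
  apply: le_trans (ler_norm A) _.
  move: m0 lm; rewrite /m /riesz_log; case: eqP => [_ m0 lm|/eqP bn0 m0 lm].
    rewrite (@ler0_norm _ (ln (u n))); last by rewrite (le_trans lm)// oppr_le0.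
    by rewrite ler_pdivlMr//; lra.
  have bp : 0 < b by rewrite lt0r bn0.
  apply: (@le_trans _ _ (expR `|A|)).
    by apply: le_trans (expR_ge1Dx _); rewrite lerDr.
  rewrite ler_expR -mulrN mulrC -ler_pdivrMr// lerNr; exact: lm.
rewrite riesz_kernel_log//.
under eq_fun do rewrite riesz_kernel_log ?addr_gt0//.
apply: cvg_EFin; first exact: nearW.
apply: continuous_cvg; first exact: continuous_riesz_log.
apply: continuous_cvg; first exact: continuous_ln.
by rewrite -[X in _ --> X]add0r; apply: cvgD => //; exact: cvg_cst.
Qed.

End riesz_limits.

Lemma prod_distribution d1 d2 (T1 : measurableType d1) (T2 : measurableType d2) (R : realType)
    (P : probability T1 R) (mu : probability T2 R) (X : T1 -> T2) (f : T2 * T2 -> \bar R) :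
  measurable_fun setT X -> (forall A, measurable A -> mu A = P (X @^-1` A)) ->
  measurable_fun setT f -> (forall z, 0 <= f z)%E ->
  (\int[(mu \x mu)%E]_z f z = \int[(P \x P)%E]_z f (X z.1, X z.2))%E.
Proof.
move=> mX muE mf f0.
have pf (g : T2 -> \bar R) : measurable_fun setT g -> (forall y, 0 <= g y)%E ->
    (\int[mu]_y g y = \int[P]_x g (X x))%E.
  move=> mg g0; transitivity (\int[pushforward P X]_y g y)%E.
    by apply: eq_measure_integral => A mA _; exact: muE.
  by rewrite ge0_integral_pushforward.
have mf' : measurable_fun setT (fun z : T1 * T1 => f (X z.1, X z.2)).
  apply: (measurableT_comp mf); apply/measurable_fun_pairP; split => /=.
    exact: (measurableT_comp mX measurable_fst).
  exact: (measurableT_comp mX measurable_snd).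
rewrite (fubini_tonelli1 _ mf f0) (fubini_tonelli1 _ mf'); last by move=> z; exact: f0.
rewrite /fubini_F pf; last 2 first.
- exact: measurable_fun_fubini_tonelli_F.
- by move=> y; exact: integral_ge0.
apply: eq_integral => x _ /=; rewrite pf//.
exact: (measurableT_comp mf (measurable_pair1 _)).
Qed.

Lemma riesz_kernel_norm (R : realType) (b x : R) : riesz_kernel b `|x| = riesz_kernel b x.
Proof. by rewrite /riesz_kernel normr_eq0 normr_id. Qed.

Lemma limn_einf_le_cst (R : realType) (u : (\bar R)^nat) (c : \bar R) :
  (forall n, u n <= c)%E -> (limn_einf u <= c)%E.
Proof.
move=> uc; rewrite limn_einf_lim; apply: lime_le; first exact: is_cvg_einfs.
by apply: nearW => n; apply: le_trans (uc n); apply: ereal_inf_lbound; exists n => /=.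
Qed.

Section hitting_capacity.
Context (R : realType) (d : nat) d0 (T : measurableType d0) (P : probability T R).
Variable (B : 'I_d -> R -> R -> T -> R).
Hypotheses (d2 : (2 <= d)%N) (BP : brownian_sheet P B).
Variables (H : set T) (X : T -> R) (F : set R) (a b p : R).
Hypotheses (mH : measurable H) (PH0 : (0 < P H)%E) (mX : measurable_fun setT X).
Hypotheses (Fab : F `<=` `[a, b]) (FX : forall w, F (X w)).
Hypotheses (a0 : 0 < a) (p0 : 0 < p).
Hypothesis HX : forall w, H w -> exists2 t, p <= t <= p + 1 & sqnorm B (X w) t w = 0.

Lemma hitting_capacity : exists mu : probability R R,
  mu F = 1%E /\ (riesz_energy ((d%:R - 2) / 2) mu < +oo)%E.
Proof.
have Xab w : a <= X w <= b by have := Fab (FX w); rewrite /= in_itv.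
have [PH PHE] := conditional_probability mH PH0.
have PH0' : 0 < fine (P H).
  by rewrite fine_gt0// PH0 ltey_eq fin_num_measure.
have [M hM] := energy_bounded BP mH mX a0 p0 Xab HX PH0' PHE.
set be := (d%:R - 2) / 2.
have be0 : 0 <= be by rewrite divr_ge0 ?subr_ge0 ?ler_nat.
pose Xf : {mfun T >-> R} := HB.pack X (isMeasurableFun.Build _ _ _ _ X mX).
pose mu : probability R R := distribution PH Xf.
exists mu; split.
  rewrite [LHS](_ : _ = PH setT); first exact: probability_setT.
  by congr (PH _); apply/seteqP; split=> w // _; exact: FX.
rewrite /riesz_energy (@prod_distribution _ _ _ _ _ PH mu X)//; last 2 first.
- exact: (measurableT_comp (measurable_riesz_kernel be) (measurable_funB measurable_fst measurable_snd)).
- by move=> z; exact: riesz_kernel_ge0.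
(* The bump variance e = 1/(N+1) enters twice, as in [energy_cell_ge]. *)
pose f N (z : T * T) := riesz_kernel be (N.+1%:R^-1 + N.+1%:R^-1 + `|X z.1 - X z.2|).
have mXX : measurable_fun setT (fun z : T * T => X z.1 - X z.2).
  apply: measurable_funB.
    exact: (measurableT_comp mX measurable_fst).
  exact: (measurableT_comp mX measurable_snd).
have mf N : measurable_fun setT (f N).
  apply: (measurableT_comp (measurable_riesz_kernel be)).
  by apply: measurable_funD => //; exact: measurableT_comp.
have intf N : (\int[(PH \x PH)%E]_z f N z <= (d%:R * M + 1)%:E)%E.
  have e0 : 0 < N.+1%:R^-1 :> R by rewrite invr_gt0.
  have [N' hN'] := hM _ e0.
  have /hN' hE := leq_maxr N N'.
  have dl : (maxn N N').+1%:R^-1 <= N.+1%:R^-1 :> R.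
    by rewrite lef_pV2 ?posrE// ler_nat ltnS leq_maxl.
  have XK u : 0 <= X u < pt R (maxn N N') (cidx (maxn N N') b).+1.
    have /andP[aX Xb] := Xab u; have X0 := le_trans (ltW a0) aX.
    rewrite X0; apply: le_lt_trans Xb _.
    have := cell_truncn (maxn N N') (le_trans X0 (proj2 (andP (Xab u)))).
    by rewrite -/(cidx _ b) /cell/= in_itv/= => /andP[].
  apply: le_trans (energy_cell_ge PH mX e0 d2 dl XK) _.
  by rewrite lee_fin lerD2r ler_wpM2l.
apply: (@le_lt_trans _ _ (d%:R * M + 1)%:E); last exact: ltry.
apply: le_trans (limn_einf_le_cst intf).
have lim z : riesz_kernel be (X z.1 - X z.2) = limn_einf (f ^~ z).
  rewrite -riesz_kernel_norm; apply/esym; apply: (cvg_limn_einf_sup _).1.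
  apply: riesz_kernel_cvg => //.
  rewrite -[X in _ --> X]addr0; apply: cvgD; exact: cvg_harmonic.
under eq_integral do rewrite lim.
by apply: fatou => // N z _; exact: riesz_kernel_ge0.
Qed.

End hitting_capacity.

(** * Finite energy implies hitting *)

Section capacity_hitting.
Context (R : realType) (d : nat) d0 (T : measurableType d0) (P : probability T R).
Variable (B : 'I_d -> R -> R -> T -> R).
Hypotheses (d1 : (1 <= d)%N) (BP : brownian_sheet P B).
Variables (F : set R) (a b : R) (mu : probability R R).
Hypotheses (cF : compact F) (mF : measurable F) (Fab : F `<=` `[a, b]) (a0 : 0 < a).
Hypotheses (muF : mu F = 1%E) (Imu : (riesz_energy ((d%:R - 2) / 2) mu < +oo)%E).

(** With x = n+1 and r = q/(d+1), the inequality x exp(-r x) <= 1/r raised to the power d+1 leaves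
    one spare factor 1/x. *)
Lemma sqrt_expR_bound (q : R) n : 0 < q -> gker d n.+1%:R^-1 * expR (- (q * n.+1%:R)) <=
  (q / d.+1%:R)^-1 ^+ d.+1 * n.+1%:R^-1.
Proof.
move=> q0; set x : R := n.+1%:R; set r := q / d.+1%:R.
have x1 : 1 <= x by rewrite /x ler1n.
have x0 : 0 < x by exact: lt_le_trans x1.
have r0 : 0 < r by rewrite divr_gt0.
have gx : gker d x^-1 <= x ^+ d.
  rewrite /gker sqrtrV ?(ltW x0)// invrK; apply: lerXn2r; rewrite ?nnegrE ?sqrtr_ge0 ?(ltW x0)//.
  by rewrite -[leRHS](ger0_norm (ltW x0)) -sqrtr_sqr ler_wsqrtr// expr2 ler_peMl// ltW.
have xr : x * expR (- (r * x)) <= r^-1.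
  rewrite expRN ler_pdivrMr ?expR_gt0// mulrC -ler_pdivrMr ?invr_gt0// invrK mulrC.
  by apply: le_trans (expR_ge1Dx _); rewrite lerDr.
have -> : expR (- (q * x)) = expR (- (r * x)) ^+ d.+1.
  by rewrite -expRM_natl; congr expR; rewrite /r; field.
apply: (@le_trans _ _ (x ^+ d * expR (- (r * x)) ^+ d.+1)).
  by rewrite ler_pM2r// exprn_gt0// expR_gt0.
have -> : x ^+ d * expR (- (r * x)) ^+ d.+1 = (x * expR (- (r * x))) ^+ d.+1 * x^-1.
  rewrite exprMn [x ^+ d.+1]exprSr; move: (_ ^+ d.+1) (x ^+ d) => E' y.
  by field; rewrite gt_eqF.
rewrite ler_pM2r ?invr_gt0//; apply: lerXn2r => //; rewrite nnegrE.
  by rewrite mulr_ge0 ?expR_ge0// ltW.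
by rewrite invr_ge0 ltW.
Qed.

Let w n := cellw mu id n.
Let K n := (cidx n b).+1.
Let dl n : R := n.+1%:R^-1.
(** The bump variance is the mesh, and the start index n+1 puts the times in [1, 3], away from the
    axis. *)
Let zs n om : R := zfun n (w n) (K n) n.+1 (dl n) (sheet_map B om).
Let Hit := [set om | zero_on (fun s t => sqnorm B s t om) F `[1, 3]].

Let dl0 n : 0 < dl n. Proof. by rewrite invr_gt0. Qed.

Let w0 n k : 0 <= w n k. Proof. exact: cellw_ge0. Qed.

Let w_neq0 n k : w n k != 0 -> exists2 x, F x & cell n k x.
Proof.
move=> wk; apply: contrapT => h; move/eqP: wk; apply.
rewrite /w /cellw preimage_id (_ : mu (cell n k) = 0)//.
apply: (@subset_measure0 _ _ _ mu _ (~` F)).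
- exact: measurable_itv.
- exact: measurableC.
- by move=> x xk Fx; apply: h; exists x.
- by apply: (etrans (probability_setC mu mF)); rewrite muF subee.
Qed.

(** A pathwise fact: without a zero, the negation of [zero_onP] gives one m such that for all n >= m
    the squared norm exceeds 1/(m+1) at every relevant grid point of a charged cell, and all bumps
    are exponentially small. *)
Let zs_cvg om : ~ Hit om -> zs n om @[n --> \oo] --> (0 : R).
Proof.
have F0 : F `<=` `[0, +oo[.
  by move=> x /Fab; rewrite /= !in_itv/= andbT => /andP[ax _]; exact: le_trans (ltW a0) ax.
have I0 : `[1, 3] `<=` `[0 : R, +oo[.
  by move=> x /=; rewrite !in_itv/= andbT => /andP[x1 _]; exact: le_trans ler01 x1.
have cI : compact `[1 : R, 3] by exact: segment_compact.
move=> nH; have nh : ~ forall m, exists n, (m <= n)%N /\ exists k l,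
    [/\ exists2 x, F x & cell n k x, exists2 y, `[1 : R, 3]%classic y & cell n l y &
        `|sqnorm B (pt R n k) (pt R n l) om| <= m.+1%:R^-1].
  move=> h. apply: nH; apply/(zero_onP (quadrant_continuous_sqnorm BP om) cF cI F0 I0).
  exact: h.
have [m hm] := (existsNP _).2 nh.
pose q : R := m.+1%:R^-1 / 2; have q0 : 0 < q by rewrite divr_gt0 ?invr_gt0.
pose u n : R := 2 * ((q / d.+1%:R)^-1 ^+ d.+1 * n.+1%:R^-1).
have zu n : (m <= n)%N -> 0 <= zs n om <= u n.
  move=> mn; apply/andP; split; first by apply: zfun_ge0; exact: w0.
  pose B0 := gker d (dl n) * expR (- (q * n.+1%:R)).
  have B00 : 0 <= B0 by rewrite mulr_ge0 ?expR_ge0// ltW// gker_gt0.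
  have hk (k : 'I_(K n)) : w n k * (\sum_(l < n.+1 + n.+1) n.+1%:R^-1 *
      nbump (dl n) (pt R n k) (pt R n (n.+1 + l)) (sheet_map B om)) <= w n k * (2 * B0).
    have [->|wk] := eqVneq (w n k) 0; first by rewrite !mul0r.
    rewrite ler_wpM2l//.
    have -> : 2 * B0 = \sum_(l < n.+1 + n.+1) n.+1%:R^-1 * B0.
      rewrite -mulr_suml; congr (_ * _).
      by rewrite sumr_const card_ord mulrnDr -[_^-1 *+ _]mulr_natl divff.
    apply: ler_sum => l _; rewrite ler_pM2l ?invr_gt0// nbumpE ler_pM2l ?gker_gt0//.
    rewrite ler_expR mulNr lerN2.
    have -> : \sum_(i < d) sheet_map B om i (pt R n k) (pt R n (n.+1 + l)) ^+ 2 =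
        sqnorm B (pt R n k) (pt R n (n.+1 + l)) om.
      by rewrite /sheet_map !ger0_norm ?pt_ge0.
    have : m.+1%:R^-1 <= sqnorm B (pt R n k) (pt R n (n.+1 + l)) om.
      rewrite leNgt; apply/negP => sq; apply: hm; exists n; split=> //.
      exists k, (n.+1 + l)%N; split; [exact: w_neq0|exists (pt R n (n.+1 + l))|].
      - rewrite /= in_itv/= ptD ptN lerDl pt_ge0/=.
        have : pt R n l <= pt R n (n.+1 + n.+1) by rewrite le_pt// ltnW.
        by rewrite ptD ptN => ?; lra.
      - rewrite /cell/= in_itv/= lexx ptS ltrDl /=; exact: dl0.
      - by rewrite ger0_norm ?sqnorm_ge0// ltW.
    rewrite -(ler_pM2r (_ : 0 < 2^-1 * n.+1%:R)) ?mulr_gt0 ?invr_gt0//.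
    by rewrite /q /dl invfM invrK mulrA.
  apply: le_trans (ler_sum _ (fun k _ => hk k)) _.
  rewrite -mulr_suml /u; apply: (@le_trans _ _ (2 * B0)).
    apply: ler_piMl; first by rewrite mulr_ge0.
    exact: (sum_cellw_le1 mu n (K n) (@measurable_id _ _ setT)).
  by rewrite ler_pM2l//; exact: sqrt_expR_bound.
apply: (@squeeze_cvgr _ _ _ _ (cst 0) u).
- by exists m => // n /= mn; exact: zu.
- exact: cvg_cst.
- rewrite -(mulr0 2); apply: cvgM; first exact: cvg_cst.
  rewrite -[X in _ --> X](mulr0 ((q / d.+1%:R)^-1 ^+ d.+1)); apply: cvgM; first exact: cvg_cst.
  exact: cvg_harmonic.
Qed.

Lemma measurable_Hit : measurable Hit.
Proof.
apply: measurable_zero_on => //.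
- exact: measurable_sqnorm BP.
- exact: quadrant_continuous_sqnorm BP.
- exact: segment_compact.
- by move=> x /Fab; rewrite /= !in_itv/= andbT => /andP[ax _]; exact: le_trans (ltW a0) ax.
- by move=> x /=; rewrite !in_itv/= andbT => /andP[x1 _]; exact: le_trans ler01 x1.
Qed.

Let bz n : bmf (zs n).
Proof.
apply: (@bmf_comp _ _ _ _ _ (zfun n (w n) (K n) n.+1 (dl n))).
  exact: bmf_zfun.
exact: measurable_sheet_map BP.
Qed.

Let C := Num.max 3 b.

Let Rint_zs_ge n : gker d (1 + C ^+ 2) <= \int[P]_om zs n om.
Proof.
have Fb x : F x -> 0 <= x < pt R n (K n).
  move=> /Fab; rewrite /= in_itv/= => /andP[ax xb]; have x0 := le_trans (ltW a0) ax.
  rewrite x0; apply: (le_lt_trans xb); have := cell_truncn n (le_trans x0 xb).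
  by rewrite -/(cidx _ b) /cell/= in_itv/= => /andP[].
have S1 : 1 <= \sum_(k < K n) w n k.
  exact: (sum_cellw_ge1 (@measurable_id _ _ setT) mF muF Fb).
have b0 : 0 <= b.
  have [|F0] := eqVneq F set0.
    by move=> F0; move: muF; rewrite F0 measure0 => /eqP; rewrite eqe eq_sym oner_eq0.
  have [x /Fab] := (set0P _).1 F0; rewrite /= in_itv/= => /andP[ax xb].
  by rewrite (le_trans _ xb)// (le_trans (ltW a0)).
have bzn : bmf (zfun n (w n) (K n) n.+1 (dl n) : path R d -> R) by exact: bmf_zfun.
rewrite -(Rint_sheet_law BP bzn).
have ptC k : (k < K n)%N -> pt R n k <= C.
  rewrite ltnS => kb; apply: le_trans (le_pt R n kb) _.
  have := cell_truncn n b0; rewrite -/(cidx n b) /cell/= in_itv/= => /andP[h _].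
  by rewrite le_max h orbT.
have ptC' : pt R n (n.+1 + (n.+1 + n.+1)) <= C.
  by rewrite !ptD ptN le_max; apply/orP; left; lra.
apply: le_trans (Rint_zfun_ge (sheet_law_gaussian BP) (w0 n) (dl0 n) ptC ptC').
have d1' : dl n <= 1 by rewrite /dl invf_le1// ler1n.
have C2 : 0 <= C ^+ 2 by exact: sqr_ge0.
apply: (@le_trans _ _ (gker d (dl n + C ^+ 2))).
  by apply: le_gker; [rewrite ltr_wpDr|rewrite lerD2r].
by rewrite ler_peMr// ltW// gker_gt0// ltr_wpDr.
Qed.

Let c := Num.min 1 (a / 2).

Let Rint_zs2_le : exists V, forall n, dl n <= a / 2 -> \int[P]_om (zs n om ^+ 2) <= V.
Proof.
have I0 : (0 <= riesz_energy ((d%:R - 2) / 2) mu)%E.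
  by apply: integral_ge0 => z _; exact: riesz_kernel_ge0.
have If : riesz_energy ((d%:R - 2) / 2) mu \is a fin_num by rewrite ge0_fin_numE.
set I := fine (riesz_energy ((d%:R - 2) / 2) mu).
exists (8 * gker d (c ^+ 3) * (6 * (1 + I))) => n dn.
have bzn : bmf (zfun n (w n) (K n) n.+1 (dl n) : path R d -> R) by exact: bmf_zfun.
have c0 : 0 < c by rewrite lt_min ltr01 divr_gt0.
rewrite -(Rint_sheet_law BP (bmfX 2 bzn)).
apply: le_trans (Rint_zfun2_le (c := c) (sheet_law_gaussian BP) (w0 n) (dl0 n) _ _ _) _.
- by rewrite c0 ge_min lexx.
- move=> k _ /w_neq0[x /Fab]; rewrite /cell/= !in_itv/= ptS => /andP[ax _] /andP[_ xk].
  rewrite ge_min; apply/orP; right.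
  move: dn xk ax (splitr a); rewrite /dl; move: (n.+1%:R^-1 : R) (pt R n k) (a / 2).
  by move=> *; lra.
- by rewrite ptN ge_min lexx.
rewrite ler_pM2l; last by rewrite mulr_gt0// gker_gt0// exprn_gt0.
rewrite -lee_fin; apply: le_trans (energy_cell_le mu (K n) (@measurable_id _ _ setT) (dl0 n) d1 (lexx _)) _.
rewrite EFinM lee_pmul2l//.
rewrite EFinD; apply: leeD2l; rewrite /I (fineK If) /riesz_energy.
under eq_integral do rewrite add0r riesz_kernel_norm.
exact: lexx.
Qed.

(** Truncation at L: zs exceeds min(zs, L) by at most zs^2 / L. If Hit were null, the truncated part
    would tend to 0 in mean by bounded convergence, while the excess has mean at most half of the
    lower bound for the mean of zs. *)
Lemma capacity_hitting : (0 < P Hit)%E.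
Proof.
rewrite lt0e measure_ge0 andbT; apply/eqP => PH.
have [V hV] := Rint_zs2_le.
set g0 := gker d (1 + C ^+ 2).
have g00 : 0 < g0 by rewrite gker_gt0// ltr_wpDr// sqr_ge0.
pose V1 := Num.max 1 V.
have V10 : 0 < V1 by rewrite lt_max ltr01.
(* This level makes V1 / L equal to g0 / 2. *)
pose L := 2 * V1 / g0.
have L0 : 0 < L by rewrite divr_gt0// mulr_gt0.
have z0 n om : 0 <= zs n om by apply: zfun_ge0; exact: w0.
(* The bracket is min(zs, L), written with the maximum. *)
pose f n om := \1_(~` Hit) om * (zs n om + L - Num.max (zs n om) L).
have tr n om : 0 <= zs n om + L - Num.max (zs n om) L <= Num.min (zs n om) L.
  have := z0 n om; case: (leP (zs n om) L); move: (zs n om) => z; lra.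
have iH : bmf (\1_(~` Hit) : T -> R) by apply: bmf_indic; apply: measurableC; exact: measurable_Hit.
have iH' : bmf (\1_Hit : T -> R) by apply: bmf_indic; exact: measurable_Hit.
have bf n : bmf (f n).
  apply: bmfM => //; apply: bmfB; first by apply: bmfD => //; exact: bmf_cst.
  by apply: bmf_max => //; exact: bmf_cst.
have cf : \int[P]_om f n om @[n --> \oo] --> \int[P]_om (cst 0 om : R).
  apply: (@Rint_cvg _ _ _ P _ _ L).
  - by move=> n; case: (bf n).
  - move=> n om; have := tr n om; rewrite le_min /f indicE => /and3P[t0 _ tL].
    by case: (_ \in _); rewrite ?mul1r ?mul0r ?normr0 ?(ltW L0)// ger0_norm.
  - move=> om; have [Hom|Hom] := pselect (Hit om).
      by under eq_fun do rewrite /f indicE memNset//= ?mul0r; exact: cvg_cst.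
    apply: (@squeeze_cvgr _ _ _ _ (cst 0) (zs ^~ om)); last exact: zs_cvg.
      apply: nearW => n; have := tr n om; rewrite le_min /f indicE mem_set//= mul1r.
      by move=> /and3P[-> ->].
    exact: cvg_cst.
rewrite (Rint_cst P 0) in cf.
have pw n om : zs n om <= f n om + L * \1_Hit om + L^-1 * zs n om ^+ 2.
  have q0 : 0 <= L^-1 * zs n om ^+ 2 by rewrite mulr_ge0 ?sqr_ge0// invr_ge0 ltW.
  have key : zs n om <= (zs n om + L - Num.max (zs n om) L) + L^-1 * zs n om ^+ 2.
    case: (leP (zs n om) L) => h; first by rewrite addrK lerDl.
    rewrite [zs n om + L]addrC addrK; apply: (@le_trans _ _ (L^-1 * zs n om ^+ 2)).
      by rewrite mulrC ler_pdivlMr// expr2 ler_pM2l ?(lt_trans L0 h)// ltW.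
    by rewrite lerDr ltW.
  apply: le_trans key _; rewrite lerD2r /f !indicE in_setC.
  have := tr n om; rewrite le_min => /and3P[_ _ tL].
  by case: (_ \in _); rewrite ?mul0r ?mul1r ?mulr0 ?mulr1 ?add0r ?addr0.
have ineq n : dl n <= a / 2 -> g0 / 2 <= \int[P]_om f n om.
  move=> dn; have b2 := bmfX 2 (bz n).
  have := Rint_le P (bz n) (bmfD (bmfD (bf n) (bmfZ L iH')) (bmfZ L^-1 b2)) (pw n).
  rewrite RintD; [|exact: (bmfD (bf n) (bmfZ L iH'))|exact: bmfZ].
  rewrite RintD//; last exact: bmfZ.
  rewrite !RintZ// Rint_indic ?PH ?mulr0 ?addr0; last exact: measurable_Hit.
  move/(le_trans (Rint_zs_ge n)); rewrite -/g0 => h.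
  have h2 : L^-1 * \int[P]_om (zs n om ^+ 2) <= g0 / 2.
    have -> : g0 / 2 = L^-1 * V1 by rewrite /L; field; rewrite !gt_eqF.
    by rewrite ler_pM2l ?invr_gt0// (le_trans (hV _ dn))// le_max lexx orbT.
  by move: h h2 (splitr g0); lra.
have [N hN] := natSinv_small (divr_gt0 a0 (ltr0n R 2)).
have g2 : 0 < g0 / 2 by rewrite divr_gt0.
move/cvgr0_norm_lt: cf => /(_ _ g2)[N' _ hN'].
have /= := hN' _ (leq_maxr N N').
have := ineq _ (ltW (hN _ (leq_maxl N N'))).
by move=> h1 h2; have := le_lt_trans (le_trans h1 (ler_norm _)) h2; rewrite ltxx.
Qed.

End capacity_hitting.

(** * Positive capacity, localisation and conclusion *)

Section capacity_facts.
Context (R : realType).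

Lemma riesz_cap_gt0 (b : R) (F : set R) : (0 < riesz_cap b F)%E <->
  exists mu : probability R R, mu F = 1%E /\ (riesz_energy b mu < +oo)%E.
Proof.
rewrite /riesz_cap; set S := [set _ | _ in _].
have S0 : (0 <= ereal_inf S)%E.
  apply/ereal_infP => _ [mu _ <-]; apply: integral_ge0 => z _; exact: riesz_kernel_ge0.
rewrite /einv; split.
  case: eqP => [_|Sy _]; first by rewrite ltxx.
  have /ereal_inf_lt[_ [mu muF <-] Imu] : (ereal_inf S < +oo)%E.
    by rewrite ltey; apply/eqP.
  by exists mu.
move=> [mu [muF Imu]].
have Sy : (ereal_inf S < +oo)%E.
  by apply: le_lt_trans Imu; apply: ereal_inf_lbound; exists mu.
rewrite (lt_eqF Sy); case: eqP => [_|/eqP S_neq0]; first exact: ltry.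
by rewrite lte_fin invr_gt0 fine_gt0// Sy lt0e S_neq0 S0.
Qed.

Lemma compact_pos_itv (F : set R) : compact F -> F `<=` `]0, +oo[ ->
  exists a b, 0 < a /\ F `<=` `[a, b].
Proof.
move=> cF F0; have [M [_ FM]] := compact_bounded cF.
have cl : closed F by apply: compact_closed => //; exact: Rhausdorff.
have nF : (~` F) 0 by move/F0; rewrite /= in_itv/= ltxx.
have : nbhs (0 : R) (~` F) by apply: open_nbhs_nbhs; split=> //; exact: closed_openC.
move=> /nbhs_ballP[r /= r0 hr].
exists r, (M + 1); split=> // x Fx.
have x0 : 0 < x by move/F0: (Fx); rewrite /= in_itv/= andbT.
rewrite /= in_itv/=; apply/andP; split.
  rewrite leNgt; apply/negP => xr; apply: (hr x) => //=.
  by rewrite /ball/= sub0r normrN gtr0_norm.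
by apply: le_trans (ler_norm x) _; apply: FM => //; rewrite ltrDl.
Qed.

End capacity_facts.

Lemma measure_bigcup_gt0 d (T : measurableType d) (R : realType) (P : probability T R)
    (A : nat -> set T) : (forall n, measurable (A n)) ->
  (0 < P (\bigcup_n A n))%E -> exists n, (0 < P (A n))%E.
Proof.
move=> mA; apply: contraPP => /forallNP h; apply/negP; rewrite -leNgt.
have mU : measurable (\bigcup_n A n) by exact: bigcup_measurable.
suff /(negligibleP P mU) -> : P.-negligible (\bigcup_n A n) by [].
apply: negligible_bigcup => n; apply/negligibleP => //; apply/eqP.
by rewrite -measure_le0 leNgt; apply/negP; exact: h.
Qed.

Theorem theorem1p1 (R : realType) (d : nat) (d0 : measure_display)
  (T : measurableType d0) (P : probability T R) (B : 'I_d -> R -> R -> T -> R)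
  (F : set R) :
  (1 <= d)%N -> brownian_sheet P B ->
  compact F -> F `<=` `]0, +oo[ ->
  ((0 < P [set w | exists2 s, F s &
              exists t, (0 < t)%R /\ forall i, B i s t w = 0%R])%E
   <-> (0 < riesz_cap ((d%:R - 2) / 2) F)%E).
Proof.
move=> d1 BP cF F0.
have [a [b [a0 Fab]]] := compact_pos_itv cF F0.
have mF : measurable F.
  by apply: closed_measurable; apply: compact_closed => //; exact: Rhausdorff.
have F0' : F `<=` `[0, +oo[.
  by move=> x /F0; rewrite /= !in_itv/= !andbT => /ltW.
set E := [set w | _].
(* Countably many unit windows of times exhaust t > 0; the index [k.+1] keeps the left end positive,
   as the moment bounds demand. *)
pose H m k := [set w | zero_on (fun s t => sqnorm B s t w) F
  `[pt R m k.+1, pt R m k.+1 + 1]].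
have I0 m k : `[pt R m k.+1, pt R m k.+1 + 1] `<=` `[0, +oo[.
  move=> x /=; rewrite !in_itv/= andbT => /andP[+ _]; apply: le_trans; exact: pt_ge0.
have cI m k : compact `[pt R m k.+1, pt R m k.+1 + 1] by exact: segment_compact.
have ms := measurable_sqnorm BP; have qc := quadrant_continuous_sqnorm BP.
have mH m k : measurable (H m k).
  exact: (measurable_zero_on ms qc cF (cI m k) F0' (I0 m k)).
have pt0 m k : 0 < pt R m k.+1 by rewrite /pt divr_gt0.
have EH : E = \bigcup_m \bigcup_k H m k.
  apply/seteqP; split=> w.
    move=> [s Fs [t [t0 Bst]]].
    have [N hN] := natSinv_small t0; have := hN N (leqnn _) => Nt.
    have := cell_truncn N (ltW t0); rewrite -/(cidx N t) /cell/= in_itv/= => /andP[c1 c2].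
    (* Index 0 is impossible because t exceeds the mesh. *)
    exists N => //; case: (cidx N t) c1 c2 => [_|k c1 c2].
      by rewrite /pt mul1r ltNge (ltW Nt).
    exists k => //; exists s => //; exists t; last exact/sqnorm_eq0.
    rewrite /= in_itv/= c1/= (le_trans (ltW c2))// ptS lerD2l.
    by rewrite invf_le1// ler1n.
  move=> [m _ [k _ [s Fs [t /= + /sqnorm_eq0 Bst]]]]; rewrite in_itv/= => /andP[c1 _].
  by exists s => //; exists t; split=> //; exact: lt_le_trans c1.
have mE : measurable E.
  by rewrite EH; apply: bigcup_measurable => m _; apply: bigcup_measurable => k _.
rewrite riesz_cap_gt0; split=> [|[mu [muF Imu]]]; last first.
  apply: lt_le_trans (capacity_hitting d1 BP cF mF Fab a0 muF Imu) _.
  apply: le_measure; rewrite ?inE//; first exact: (measurable_Hit BP cF Fab a0).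
  move=> w [s Fs [t /= + /sqnorm_eq0 Bst]]; rewrite in_itv/= => /andP[c1 _].
  by exists s => //; exists t; split=> //; exact: lt_le_trans c1.
rewrite EH => /measure_bigcup_gt0[|m]; first by move=> m; exact: bigcup_measurable.
move/measure_bigcup_gt0 => [//|k PH].
have F_neq0 : F !=set0.
  have [//|nF] := pselect (F !=set0); exfalso; move: PH.
  rewrite (_ : H m k = set0) ?measure0 ?ltxx//.
  by rewrite -subset0 => w [s Fs _]; apply: nF; exists s.
move: d1; rewrite leq_eqVlt => /predU1P[d1|d2].
  (* For d = 1 the kernel is identically 1, so a point mass has finite energy. *)
  have [x Fx] := F_neq0; pose mu : probability R R := \d_x.
  exists mu; split; first by rewrite /mu /= diracE mem_set.
  rewrite /riesz_energy -d1; under eq_integral do rewrite riesz_kernel1.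
  rewrite integral_cst// mul1e; apply: le_lt_trans (ltry 1).
  exact: probability_le1.
have [X [mX FX HX]] := zero_selection ms qc cF (cI m k) F0' (I0 m k) F_neq0.
have HX' w : H m k w -> exists2 t, pt R m k.+1 <= t <= pt R m k.+1 + 1 &
    sqnorm B (X w) t w = 0.
  by move=> /HX[t]; rewrite /= in_itv => ? ?; exists t.
exact: (hitting_capacity d2 BP (mH m k) PH mX Fab FX a0 (pt0 m k) HX').

Qed.
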